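(* Let $X$ be a $PK^0$ curve. Then $X$ is a ramified covering of a torus if and only if there are two distinct directions $V$ and $H$ such that the $V$-periods of $X$ form a discrete subgroup of $\mathbb{R}$ and the $H$-periods of $X$ form a discrete subgroup of $\mathbb{R}$.
   Context: All manifolds are connected and compact. A $PK^0$ curve is a compact connected real surface $X$ with a fixed simplicial decomposition and a flat metric obtained by isometrically gluing flat triangles, such that the flat metric on the complement of the vertices has trivial holonomy. Near each vertex, $X$ is isometric to a cone of angle $2\pi\alpha$ (with $\alpha$ a positive integer, because the holonomy is trivial), and $X$ carries the complex structure which is the flat one away from the vertices and has chart $z\mapsto z^{\alpha}$ at a vertex. A holomorphic 1-form on $X$ is compatible with the flat structure if, at any non-singular point, it is locally the pull-back of a constant-coefficient form $a\,\mathrm{d}z$ on $\mathbb{C}$ by an isometric chart; such forms make up a 1-dimensional space, and $\mathrm{d}z$ denotes a fixed non-zero one. Directions and periods: two distinct directions $H,V$ are given by two $\mathbb{R}$-linearly independent vectors $h,v\in\mathbb{C}$. For any closed path $\gamma$ on $X$ write $\int_\gamma \mathrm{d}z = a\,h+b\,v$ with $a,b\in\mathbb{R}$; then $a$ is called an $H$-period and $b$ a $V$-period of $X$. (For $h=1$, $v=\mathrm{i}$ these are the real and imaginary parts of the periods.) The $H$-periods and the $V$-periods each form a subgroup of $\mathbb{R}$. A ramified covering of a torus means a finite-sheeted ramified holomorphic covering $\pi:X\to\mathbb{C}/\Gamma$, with $\Gamma$ a lattice in $\mathbb{C}$, which is compatible with the flat structures, i.e. a local isometry (for a flat metric on $\mathbb{C}/\Gamma$)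 away from the singular and ramification points. *)

(* Defs.v *)
From HB Require Import structures.
From mathcomp Require Import all_boot all_order all_algebra.
From mathcomp Require Import complex.
From mathcomp Require Import all_classical all_reals all_analysis.

Set Implicit Arguments.
Unset Strict Implicit.
Unset Printing Implicit Defensive.

Import Order.TTheory GRing.Theory Num.Theory.
Import numFieldNormedType.Exports.

Local Open Scope classical_set_scope.
Local Open Scope ring_scope.

(* [R[i]] carries its topology and normed-module structure (over itself)
   through the regular-algebra alias. *)
Notation CC R := (complex R)^o.

(* A closed oriented simplicial surface with vertex set ['I_nv], together with
   the edge lengths of the flat triangles that are glued.  Two adjacent flat
   triangles are glued along their common edge by the isometry that fixes its
   end points, so the glued metric amounts to one length per edge; values of
   [len] off the edges are irrelevant.
   [pos u v w] says that (u, v, w) is a positively ordered face. *)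
Record flat_surface (R : realType) := FlatSurface {
  nv : nat;
  face : {set {set 'I_nv}};
  len : 'I_nv -> 'I_nv -> R;
  pos : 'I_nv -> 'I_nv -> 'I_nv -> bool;
  face_card : forall t, t \in face -> #|t| = 3%N;
  face_cover : forall v, exists2 t, t \in face & v \in t;
  face_edge : forall u v t, t \in face -> u \in t -> v \in t -> u != v ->
    #|[set s in face | (u \in s) && (v \in s)]%SET| = 2%N;
  (* with [face_edge], this says that the link of [v] is a cycle *)
  face_link : forall v s t, s \in face -> t \in face -> v \in s -> v \in t ->
    connect [rel a b : {set 'I_nv} | [&& a \in face, b \in face,
               v \in a, v \in b & #|a :&: b| == 2%N]] s t;
  len_gt0 : forall t u v, t \in face -> u \in t -> v \in t -> u != v ->
    0 < len u v;
  len_sym : forall u v, len u v = len v u;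
  len_triangle : forall u v w, [set u; v; w]%SET \in face ->
    len u v < len u w + len w v;
  pos_face : forall u v w, pos u v w -> [set u; v; w]%SET \in face;
  pos_rot : forall u v w, pos u v w = pos v w u;
  pos_swap : forall u v w, [set u; v; w]%SET \in face ->
    pos u v w = ~~ pos v u w;
  pos_coherent : forall u v w w', w != w' ->
    [set u; v; w]%SET \in face -> [set u; v; w']%SET \in face ->
    pos u v w = ~~ pos u v w'
}.

Section Realization.
Variables (R : realType) (X : flat_surface R).

Definition in_face (t : {set 'I_(nv X)}) (x : 'rV[R]_(nv X)) : bool :=
  [&& [forall v, 0 <= x 0 v], \sum_v x 0 v == 1 &
      [forall v, (v \notin t) ==> (x 0 v == 0)]].

(* points are given by their barycentric coordinates *)
Definition realization_pt : pred 'rV[R]_(nv X) :=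
  [pred x | [exists t in face X, in_face t x]].

Definition realization : Type :=
  initial_topology (val : {x : 'rV[R]_(nv X) | realization_pt x} -> _).

HB.instance Definition _ := PseudoMetric.on realization.

Definition bary (x : realization) (v : 'I_(nv X)) : R := val x 0 v.

Definition is_vertex (x : realization) : Prop :=
  exists v, val x = delta_mx 0 v.

(* For points P_u of the plane at mutual distances [len u v] and coefficients
   c_u of sum 0, |sum_u c_u P_u|^2 = - 1/2 sum_(u, v) c_u c_v (len u v)^2.
   Meaningful only when x and y lie in a common face. *)
Definition face_dist (x y : realization) : R :=
  Num.sqrt (- 2^-1 * \sum_u \sum_(v | v != u)
     (bary x u - bary y u) * (bary x v - bary y v) * len u v ^+ 2).

Definition same_face : rel realization :=
  [rel x y | [exists t in face X, in_face t (val x) && in_face t (val y)]].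

Fixpoint chain_length (x : realization) (s : seq realization) : R :=
  if s is y :: s' then face_dist x y + chain_length y s' else 0.

(* the flat metric: the quotient metric obtained by gluing the flat triangles *)
Definition flat_dist (x y : realization) : R :=
  inf [set chain_length x s | s in
        [set s : seq realization | path same_face x s /\ last x s = y]].

End Realization.

Definition open_embedding (S T : topologicalType) (U : set S) (f : S -> T) :=
  [/\ open U, {in U &, injective f}, (forall x, U x -> {for x, continuous f})
    & forall V, open V -> V `<=` U -> open (f @` V)].

Definition ccw (R : realType) (a b c : CC R) : Prop :=
  0 < complex.Im ((c - a) / (b - a)).

Section Charts.
Variables (R : realType) (X : flat_surface R).
Local Notation S := (realization X).
Local Notation C := (CC R).

(* Distances are compared only near [p]: [flat_dist] is a global distance, and
   a chart is an isometry in the Riemannian sense.  The second clause says that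
   [phi] preserves orientation. *)
Definition isometric_at (p : S) (phi : S -> C) : Prop :=
  (\forall x & y \near p, ComplexField.Normc.normc (phi x - phi y) = flat_dist x y) /\
  forall u v w, pos u v w -> exists a b c : C, ccw a b c /\
    \forall x \near p, in_face [set u; v; w]%SET (val x) ->
      phi x = (bary x u)%:C%C * a + (bary x v)%:C%C * b + (bary x w)%:C%C * c.

Definition isometric_chart (U : set S) (phi : S -> C) : Prop :=
  open_embedding U phi /\ forall p, U p -> isometric_at p phi.

Definition nonsingular (p : S) : Prop :=
  exists U phi, isometric_chart U phi /\ U p.

(* the chart z^(1/alpha) at a vertex of cone angle 2 pi alpha, z being a flat
   coordinate: its alpha-th power is a flat coordinate off the vertex, which
   forces the value of alpha *)
Definition cone_chart (U : set S) (w : S -> C) : Prop :=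
  exists (p : S) (alpha : nat), [/\ is_vertex p, U p, (0 < alpha)%N,
    open_embedding U w /\ w p = 0 &
    forall q, U q -> q <> p -> isometric_at q (fun x => w x ^+ alpha)].

Definition complex_chart (U : set S) (w : S -> C) : Prop :=
  isometric_chart U w \/ cone_chart U w.

Definition subdivision (n : nat) (tau : nat -> R) : Prop :=
  [/\ tau 0%N = 0, tau n = 1 & forall i, (i < n)%N -> tau i < tau i.+1].

Definition closed_path (g : R -> S) : Prop :=
  {within `[0, 1], continuous g} /\ g 0 = g 1.

(* Continuing an isometric chart along a closed path that avoids the vertices
   brings it back to itself up to a translation: parallel transport along the
   path is the identity. *)
Definition trivial_holonomy : Prop :=
  forall (g : R -> S) (n : nat) (tau : nat -> R)
         (U : nat -> set S) (phi : nat -> S -> C),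
    closed_path g -> (forall s, 0 <= s <= 1 -> ~ is_vertex (g s)) ->
    subdivision n.+1 tau ->
    (forall i, (i <= n)%N -> isometric_chart (U i) (phi i) /\
       (forall s, tau i <= s <= tau i.+1 -> U i (g s))) ->
    (forall i, (i < n)%N ->
       \forall x \near g (tau i.+1), phi i.+1 x = phi i x) ->
    exists b : C, \forall x \near g 0, phi n x = phi 0%N x + b.

Definition PK0_curve : Prop :=
  [/\ [set: S] !=set0, connected [set: S] & trivial_holonomy].

(* A 1-form g(w) dw is given by its coefficient g in each chart (U, w). *)
Definition one_form := set S -> (S -> C) -> C -> C.

(* [T] is the change of coordinates w' o w^-1 near w(p) *)
Definition holomorphic_form (omega : one_form) : Prop :=
  (forall U w p, complex_chart U w -> U p ->
     derivable (omega U w : C -> C) (w p) 1) /\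
  (forall U w U' w' p (T : C -> C) (l : C),
     complex_chart U w -> complex_chart U' w' -> U p -> U' p ->
     (\forall x \near p, w' x = T (w x)) -> is_derive (w p) 1 T l ->
     omega U w (w p) = omega U' w' (w' p) * l).

Definition compatible_form (omega : one_form) : Prop :=
  holomorphic_form omega /\
  forall p, nonsingular p -> exists U phi (a : C),
    [/\ isometric_chart U phi, U p & forall x, U x -> omega U phi (phi x) = a].

Definition nonzero_form (omega : one_form) : Prop :=
  exists U w p, [/\ complex_chart U w, U p & omega U w (w p) <> 0].

(* [z] is the integral of [omega] along [g], computed from local primitives F *)
Definition path_integral (omega : one_form) (g : R -> S) (z : C) : Prop :=
  exists (n : nat) (tau : nat -> R) (U : nat -> set S) (w : nat -> S -> C)
         (F : nat -> C -> C),
    [/\ subdivision n tau,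
        forall i, (i < n)%N -> complex_chart (U i) (w i) /\
          (forall s, tau i <= s <= tau i.+1 -> U i (g s)),
        forall i x, (i < n)%N -> U i x ->
          is_derive (w i x) 1 (F i) (omega (U i) (w i) (w i x)) &
        z = \sum_(i < n) (F i (w i (g (tau i.+1))) - F i (w i (g (tau i))))].

Definition independent (h v : C) : Prop :=
  forall a b : R, a%:C%C * h + b%:C%C * v = 0 -> a = 0 /\ b = 0.

Definition H_periods (omega : one_form) (h v : C) : set R :=
  [set a | exists (g : R -> S) (b : R),
     closed_path g /\ path_integral omega g (a%:C%C * h + b%:C%C * v)].

Definition V_periods (omega : one_form) (h v : C) : set R :=
  [set b | exists (g : R -> S) (a : R),
     closed_path g /\ path_integral omega g (a%:C%C * h + b%:C%C * v)].

End Charts.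

Definition discrete_subgroup (R : realType) (A : set R) : Prop :=
  [/\ A 0, (forall a b, A a -> A b -> A (a - b)) & A `<=` isolated A].

Section Torus.
Variables (R : realType) (w1 w2 : CC R).
Local Notation C := (CC R).

Definition lattice : set C := [set z | exists m n : int, z = w1 *~ m + w2 *~ n].

Definition lattice_rel (z z' : C) : bool := `[< lattice (z - z') >].

Lemma lattice_rel_equiv : equiv_class_of lattice_rel.
Proof.
split.
- by move=> z; apply/asboolP; exists 0, 0; rewrite subrr !mulr0z addr0.
- move=> z z'; apply/asboolP/asboolP => -[m [n e]]; exists (- m), (- n);
  by rewrite !mulrNz -opprD -e opprB.
- move=> z z' z'' /asboolP[m [n e]] /asboolP[m' [n' e']].
  apply/asboolP; exists (m + m'), (n + n').
  by rewrite !mulrzDr addrACA -e -e' addrA subrK.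
Qed.

Canonical lattice_equiv := EquivRelPack lattice_rel_equiv.

Definition torus : Type := quotient_topology {eq_quot lattice_equiv}%qT.

HB.instance Definition _ := Topological.on torus.

Definition torus_proj (z : C) : torus := (\pi_torus z)%qT.

(* inverse branches of the projection *)
Definition torus_chart (W : set torus) (s : torus -> C) : Prop :=
  open_embedding W s /\ forall a, W a -> torus_proj (s a) = a.

(* the distance of the flat metric k |dz| on the torus *)
Definition torus_dist (k : R) (a b : torus) : R :=
  inf [set r | exists z z' : C, [/\ torus_proj z = a, torus_proj z' = b &
                                  r = k * ComplexField.Normc.normc (z - z')]].

End Torus.

Section Covering.
Variables (R : realType) (X : flat_surface R) (w1 w2 : CC R).
Local Notation S := (realization X).
Local Notation T := (torus w1 w2).
Local Notation C := (CC R).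

Definition holomorphic_map (f : S -> T) : Prop :=
  continuous f /\
  forall (U : set S) (w : S -> C) (W : set T) (s : T -> C) p,
    complex_chart U w -> torus_chart W s -> U p -> W (f p) ->
    exists g : C -> C,
      (\forall x \near p, s (f x) = g (w x)) /\ derivable g (w p) 1.

Definition ramification_pt (f : S -> T) (p : S) : Prop :=
  ~ exists2 U, open U /\ U p & {in U &, injective f}.

Definition evenly_covered (f : S -> T) (W : set T) : Prop :=
  exists (n : nat) (U : 'I_n -> set S),
    [/\ trivIset setT U, f @^-1` W = \bigcup_i U i &
        forall i, open_embedding (U i) f /\ f @` U i = W].

(* B contains the branch points *)
Definition finite_ramified_covering (f : S -> T) : Prop :=
  [/\ f @` setT = setT, (forall y, finite_set (f @^-1` [set y])) &
    exists2 B : set T, finite_set B & forall y, ~ B y ->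
      exists W, [/\ open W, W y & evenly_covered f W]].

Definition local_isometry_at (k : R) (f : S -> T) (p : S) : Prop :=
  exists U, [/\ open U, U p, open (f @` U) &
    forall x y, U x -> U y -> torus_dist k (f x) (f y) = flat_dist x y].

End Covering.

(* A flat metric on C / Gamma in its conformal class is k |dz| with k > 0. *)
Definition ramified_covering_of_torus (R : realType) (X : flat_surface R) :=
  exists (w1 w2 : CC R) (f : realization X -> torus w1 w2) (k : R),
    [/\ independent w1 w2, 0 < k, holomorphic_map f,
        finite_ramified_covering f &
        forall p, nonsingular p -> ~ ramification_pt f p ->
          local_isometry_at k f p].

(* Main.v *)
Require Import Defs.
From mathcomp Require Import all_boot all_order all_algebra.
From mathcomp Require Import ring lra zify.
From mathcomp Require Import complex.
From mathcomp Require Import all_classical all_reals all_analysis.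

Set Implicit Arguments.
Unset Strict Implicit.
Unset Printing Implicit Defensive.

Import Order.TTheory GRing.Theory Num.Theory.
Import numFieldNormedType.Exports.

Local Open Scope classical_set_scope.
Local Open Scope ring_scope.

(** Why the criterion holds.

    The form [dz] has a constant coefficient in every isometric chart, so it can be
    integrated along the edges of the triangulation. The resulting vectors [e u v] add
    up to 0 around each face and lay the two faces at any edge flat in the plane, at a
    fixed scale [k]: this is a [development]. On the star of a vertex [u], the
    piecewise affine map [dev (e u)] is a primitive of [dz] in every complex chart, the
    charts at the cone points included ([normal_form]).

    Let [f] be a covering of the torus C / Gamma. It is a local isometry off the
    ramification points and it is holomorphic, so there it is of the form
    [x -> l * dev (e u) x + m] modulo Gamma. The slope [l] is locally constant; it
    extends over the ramification points, which are isolated, because a holomorphic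
    function that is locally affine off a point is affine, and it extends over the
    vertices by continuity ([slope_everywhere]). Hence [l] times the integral of [dz]
    along a closed path lies in Gamma, and in the directions of the generators of
    Gamma / l all periods are integers ([covering_periods]).

    Conversely, discrete subgroups of the line are cyclic ([discrete_cyclic]), so if the
    periods in two directions form discrete groups, the integrals of [dz] along closed
    paths lie in a lattice Gamma. Then [dz] can be integrated from a base point modulo
    Gamma, first to the vertices ([vertex_positions]) and then to all points; this is
    the map [dev_map] to C / Gamma. It is holomorphic and scales distances by [k], as
    [dev (e u)] does. Off the vertices it is open, and the surface is compact; therefore
    it is onto ([dev_map_surjective]), its fibres are finite, and it evenly covers the
    complement of the images of the vertices ([dev_map_evenly_covered]). *)

Local Notation nm := ComplexField.Normc.normc.

(** * Complex numbers and primitives on discs *)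

Section Complex.
Variable R : realType.
Local Notation C := (CC R).
Implicit Types z w : C.

Lemma nmE z : `|z| = (nm z)%:C%C.
Proof. by []. Qed.

Lemma nm_sqr z : nm z ^+ 2 = complex.Re z ^+ 2 + complex.Im z ^+ 2.
Proof. by case: z => a b /=; rewrite sqr_sqrtr// addr_ge0// sqr_ge0. Qed.

Lemma nm_ge0 z : 0 <= nm z.
Proof. by case: z => a b /=; rewrite sqrtr_ge0. Qed.

Lemma nmM z w : nm (z * w) = nm z * nm w.
Proof. exact: ComplexField.Normc.normcM. Qed.

Lemma nmV z : nm z^-1 = (nm z)^-1.
Proof. exact: ComplexField.Normc.normcV. Qed.

Lemma nmN z : nm (- z) = nm z.
Proof. by case: z => a b /=; rewrite !sqrrN. Qed.

Lemma nmD z w : nm (z + w) <= nm z + nm w.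
Proof. by rewrite -lecR rmorphD /= -!nmE ler_normD. Qed.

Lemma nmBC z w : nm (z - w) = nm (w - z).
Proof. by rewrite -nmN opprB. Qed.

Lemma nm0 : nm (0 : C) = 0.
Proof. exact: ComplexField.Normc.normc0. Qed.

Lemma nm1 : nm (1 : C) = 1.
Proof. exact: ComplexField.Normc.normc1. Qed.

Lemma nm_eq0 z : (nm z == 0) = (z == 0).
Proof.
apply/eqP/eqP => [/ComplexField.Normc.eq0_normc//|->].
exact: nm0.
Qed.

Lemma nm_gt0 z : (0 < nm z) = (z != 0).
Proof. by rewrite lt_def nm_ge0 andbT nm_eq0. Qed.

Lemma nm_real (a : R) : nm (a%:C%C : C) = `|a|.
Proof. by rewrite /= expr0n /= addr0 sqrtr_sqr. Qed.

Lemma nmBD w z z' : nm (z - z') <= nm (z - w) + nm (w - z').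
Proof. by rewrite (le_trans _ (nmD _ _))// addrA subrK. Qed.

Lemma Re_le z : `|complex.Re z| <= nm z.
Proof.
case: z => a b /=; rewrite -sqrtr_sqr ler_wsqrtr// lerDl sqr_ge0//.
Qed.

Lemma Im_le z : `|complex.Im z| <= nm z.
Proof.
case: z => a b /=; rewrite -sqrtr_sqr ler_wsqrtr// lerDr sqr_ge0//.
Qed.

Lemma nbhs_CP z (A : set C) :
  nbhs z A <-> exists2 r : R, 0 < r & forall z', nm (z' - z) < r -> A z'.
Proof.
split.
  move=> /nbhs_ballP[e e0 H]; have : 0 < e := e0.
  rewrite ltcE => /andP[/eqP /= ie re].
  exists (complex.Re e) => // z' h; apply: H; rewrite -ball_normE /ball_ /=.
  rewrite distrC nmE ltcE /= h andbT ie//.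
case=> r r0 H; apply/nbhs_ballP; exists (r%:C)%C; first by rewrite /= ltcR.
move=> z'; rewrite -ball_normE /ball_ /= distrC nmE ltcR; exact: H.
Qed.

Lemma near_disc z (r : R) : 0 < r -> \forall z' \near z, nm (z' - z) < r.
Proof. by move=> r0; apply/nbhs_CP; exists r. Qed.

Lemma open_CP (A : set C) :
  open A <-> forall z, A z -> exists2 r : R, 0 < r & forall z', nm (z' - z) < r -> A z'.
Proof.
rewrite openE; split=> H z Az; first by apply/nbhs_CP; apply: H.
by apply/nbhs_CP; exact: H.
Qed.

Lemma open_disc z (r : R) : open [set z' : C | nm (z' - z) < r].
Proof.
apply/open_CP => z1 z1r; exists (r - nm (z1 - z)); first by rewrite subr_gt0.
by move=> z2 z2r; rewrite /=; have := nmBD z1 z2 z; lra.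
Qed.

Lemma is_deriveC z (T : C -> C) (l : C) :
  is_derive z 1 T l <->
  forall e : R, 0 < e -> exists2 d : R, 0 < d & forall z', nm (z' - z) < d ->
    nm (T z' - T z - l * (z' - z)) <= e * nm (z' - z).
Proof.
have key (h : C) : h != 0 ->
    h^-1 *: ((T \o shift z) (h *: (1 : C)) - T z) - l =
    h^-1 * (T (h + z) - T z - l * (h + z - z)).
  move=> h0; rewrite /= /GRing.scale /= mulr1 addrK.
  by field.
split.
  move=> [dT lT] e e0.
  have /cvgrPdist_lt /(_ e%:C%C) : (fun h : C => h^-1 *: ((T \o shift z) (h *: (1:C)) - T z)) @ 0^' --> l.
    by rewrite -lT; exact: dT.
  rewrite ltcR => /(_ e0) /nbhs_CP[d d0 H]; exists d => // z' z'd.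
  have [->|zz'] := eqVneq z' z; first by rewrite !subrr mulr0 subr0 nm0 mulr0.
  have h0 : z' - z != 0 by rewrite subr_eq0.
  have := H (z' - z); rewrite subr0 => /(_ z'd h0).
  rewrite distrC key// nmE ltcR nmM nmV subrK mulrC ltr_pdivrMr ?nm_gt0//.
  exact: ltW.
move=> H.
have cv : (fun h : C => h^-1 *: ((T \o shift z) (h *: (1:C)) - T z)) @ 0^' --> l.
  apply/cvgrPdist_le => e e0; have := e0; rewrite ltcE => /andP[/eqP ie re].
  have [d d0 {}H] := H _ re.
  apply/nbhs_CP; exists d => // h; rewrite subr0 => hd h0.
  rewrite distrC key// nmE lecE /= ie eqxx /= nmM nmV mulrC ler_pdivrMr ?nm_gt0//.
  by have := H (h + z); rewrite addrK => /(_ hd).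
split; last exact: cvg_lim cv.
by apply/cvg_ex; exists l.
Qed.

Lemma derivable_is_derive z (T : C -> C) :
  derivable T z 1 -> exists l, is_derive z 1 T l.
Proof. by move=> d; exists ('D_1 T z); split. Qed.

(** The supremum of the points that are related to [a] is itself related to [a], and
    no point below [b] can be that supremum. With a bound on increments for [Q] this
    yields a mean value inequality, with a transfer of a property from [s] to [t] it
    replaces connectedness. *)
Lemma continuous_induction (Q : R -> R -> Prop) (a b : R) : a <= b ->
  (forall s t r, s <= t -> t <= r -> Q s t -> Q t r -> Q s r) ->
  (forall c, a <= c <= b -> exists2 d : R, 0 < d &
     forall s t, a <= s -> s <= c -> c <= t -> t <= b ->
       c - d < s -> t < c + d -> Q s t) ->
  Q a b.
Proof.
move=> ab Qtr Qloc.
pose E := [set t | a <= t <= b /\ Q a t].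
have Ea : E a.
  split; first by rewrite lexx ab.
  have [|d d0 H] := Qloc a; first by rewrite lexx ab.
  by apply: H => //; rewrite ?ltrBlDr ltrDl.
have ubE : ubound E b by move=> t [/andP[]].
have supE : has_sup E by split; [exists a | exists b].
have acb : a <= sup E <= b.
  rewrite (ub_le_sup (proj2 supE) Ea) /=.
  by apply: ge_sup => //; exists a.
have [d d0 H] := Qloc _ acb.
have [t0 [/andP[at0 t0b] Qt0] ct0] := sup_adherent d0 supE.
have t0c : t0 <= sup E by apply: ub_le_sup; [exact: proj2 supE | split=> //; rewrite at0].
pose t1 := Num.min b (sup E + d / 2).
have /andP[_ cb] := acb.
have ct1 : sup E <= t1 by rewrite le_min cb lerDl divr_ge0// ltW.
have t1b : t1 <= b by rewrite /t1 ge_min lexx.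
have Qat1 : Q a t1.
  apply: (Qtr a t0 t1) => //; first exact: le_trans ct1.
  apply: H => //.
  by rewrite /t1 gt_min; apply/orP; right; lra.
have h1 : t1 <= sup E.
  apply: ub_le_sup; first exact: proj2 supE.
  by split=> //; rewrite t1b andbT; case/andP: acb => h _; exact: le_trans ct1.
have [e|e] := leP b (sup E + d / 2); first by move: Qat1; rewrite /t1 (min_idPl e).
exfalso; move: h1; rewrite /t1 (min_idPr (ltW e)); lra.
Qed.

Lemma locally_constant_itv (P : R -> Prop) (a b : R) : a <= b ->
  (forall c, a <= c <= b -> exists2 d : R, 0 < d &
     forall s, a <= s <= b -> `|s - c| < d -> (P s <-> P c)) ->
  P a -> P b.
Proof.
move=> ab H; apply: (continuous_induction (Q := fun s t => P s -> P t)) => //.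
  by move=> s t r _ _ h1 h2 /h1/h2.
move=> c acb; have [d d0 {}H] := H c acb; exists d => // s t as_ sc ct tb cs tc Ps.
have /andP[ac cb] := acb.
apply/(H t).
- by rewrite tb (le_trans ac).
- by rewrite ger0_norm ?subr_ge0//; lra.
apply/(H s) => //.
- by rewrite as_ (le_trans sc).
- by rewrite distrC ger0_norm ?subr_ge0//; lra.
Qed.

Definition seg (z0 z1 : C) (s : R) : C := z0 + s%:C%C * (z1 - z0).

Lemma seg0 z0 z1 : seg z0 z1 0 = z0.
Proof. by rewrite /seg mul0r addr0. Qed.

Lemma seg1 z0 z1 : seg z0 z1 1 = z1.
Proof. by rewrite /seg mul1r addrC subrK. Qed.

Lemma segB z0 z1 s t : seg z0 z1 t - seg z0 z1 s = (t - s)%:C%C * (z1 - z0).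
Proof. by rewrite /seg rmorphB /=; ring. Qed.

Lemma seg_disc z0 z1 c (r s : R) : 0 <= s <= 1 -> nm (z0 - c) < r -> nm (z1 - c) < r ->
  nm (seg z0 z1 s - c) < r.
Proof.
move=> /andP[s0 s1] h0 h1.
have -> : seg z0 z1 s - c = (1 - s)%:C%C * (z0 - c) + s%:C%C * (z1 - c).
  by rewrite /seg rmorphB rmorph1 /=; ring.
apply: le_lt_trans (nmD _ _) _; rewrite !nmM !nm_real ger0_norm ?subr_ge0// ger0_norm//.
have [->|sn] := eqVneq s 0; first by lra.
have : 0 < s by rewrite lt_neqAle eq_sym sn.
nra.
Qed.

(** Bounds on increments add up along the segment, so it suffices to bound small
    increments, where the definition of the derivative gives the bound up to an
    arbitrarily small [n]. *)
Lemma segment_derive_le (T : C -> C) (z0 z1 l : C) (e : R) :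
  (forall s, 0 <= s <= 1 -> exists2 l', nm (l' - l) <= e &
     is_derive (seg z0 z1 s) 1 T l') ->
  nm (T z1 - T z0 - l * (z1 - z0)) <= e * nm (z1 - z0).
Proof.
move=> H; set D := nm (z1 - z0).
suff K (n : R) : 0 < n -> nm (T z1 - T z0 - l * (z1 - z0)) <= (e + n) * D.
  have [D0|D0] := eqVneq D 0; first by have := K 1 ltr01; rewrite D0 !mulr0.
  apply/ler_addgt0Pr => n n0.
  have Dp : 0 < D by rewrite lt_def D0 nm_ge0.
  have := K (n / D) (divr_gt0 n0 Dp).
  by rewrite mulrDl divfK.
move=> n0.
pose Q s t := nm (T (seg z0 z1 t) - T (seg z0 z1 s) - l * (seg z0 z1 t - seg z0 z1 s))
  <= (e + n) * D * (t - s).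
suff : Q 0 1 by rewrite /Q !seg0 !seg1 subr0 mulr1.
apply: (continuous_induction (Q := Q)) => //.
  move=> s t r _ _; rewrite /Q => h1 h2.
  have -> : T (seg z0 z1 r) - T (seg z0 z1 s) - l * (seg z0 z1 r - seg z0 z1 s) =
   (T (seg z0 z1 t) - T (seg z0 z1 s) - l * (seg z0 z1 t - seg z0 z1 s)) +
   (T (seg z0 z1 r) - T (seg z0 z1 t) - l * (seg z0 z1 r - seg z0 z1 t)) by ring.
  by apply: le_trans (nmD _ _) _; lra.
move=> c c01; have [l' l'l /is_deriveC/(_ n n0)[d d0 Hd]] := H c c01.
exists (d / (D + 1)).
  by apply: divr_gt0 => //; have := nm_ge0 (z1 - z0); rewrite -/D; lra.
have Q1 s : `|s - c| < d / (D + 1) ->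
    nm (T (seg z0 z1 s) - T (seg z0 z1 c) - l * (seg z0 z1 s - seg z0 z1 c)) <=
    (e + n) * D * `|s - c|.
  move=> sc; have D0 : 0 <= D by exact: nm_ge0.
  have nms : nm (seg z0 z1 s - seg z0 z1 c) = `|s - c| * D by rewrite segB nmM nm_real.
  have hd : nm (seg z0 z1 s - seg z0 z1 c) < d.
    rewrite nms; move: sc; rewrite ltr_pdivlMr; last lra.
    by have := normr_ge0 (s - c); nra.
  have := Hd _ hd; set A := T _ - T _ => hA.
  have -> : A - l * (seg z0 z1 s - seg z0 z1 c) =
    (A - l' * (seg z0 z1 s - seg z0 z1 c)) + (l' - l) * (seg z0 z1 s - seg z0 z1 c) by ring.
  apply: le_trans (nmD _ _) _; rewrite nmM; move: hA; rewrite nms => hA.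
  have : 0 <= `|s - c| * D by exact: mulr_ge0.
  by move: hA l'l; nra.
move=> s t s0 sc ct t1 cs tc; rewrite /Q.
have h1 := Q1 s; have h2 := Q1 t.
have -> : T (seg z0 z1 t) - T (seg z0 z1 s) - l * (seg z0 z1 t - seg z0 z1 s) =
   (T (seg z0 z1 t) - T (seg z0 z1 c) - l * (seg z0 z1 t - seg z0 z1 c)) -
   (T (seg z0 z1 s) - T (seg z0 z1 c) - l * (seg z0 z1 s - seg z0 z1 c)) by ring.
apply: le_trans (nmD _ _) _; rewrite nmN.
have e1 : `|s - c| = c - s by rewrite distrC ger0_norm ?subr_ge0.
have e2 : `|t - c| = t - c by rewrite ger0_norm ?subr_ge0.
rewrite e1 in h1; rewrite e2 in h2.
have {}h1 := h1 ltac:(lra); have {}h2 := h2 ltac:(lra).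
lra.
Qed.

Lemma primitive_unique (T T' : C -> C) (g : C -> C) z0 (r : R) :
  (forall z, nm (z - z0) < r -> is_derive z 1 T (g z)) ->
  (forall z, nm (z - z0) < r -> is_derive z 1 T' (g z)) ->
  forall z, nm (z - z0) < r -> T z - T' z = T z0 - T' z0.
Proof.
move=> HT HT' z zr.
have r0 : nm (z0 - z0) < r by rewrite subrr nm0; exact: le_lt_trans (nm_ge0 _) zr.
have := @segment_derive_le (T - T') z0 z 0 0.
rewrite mul0r mul0r subr0 => /(_ _) H.
apply/eqP; rewrite -subr_eq0 -nm_eq0 eq_le nm_ge0 andbT; apply: H => s s01.
have sr := seg_disc s01 r0 zr.
exists 0; first by rewrite subrr nm0.
rewrite -(subrr (g (seg z0 z s))).
have := HT _ sr; have := HT' _ sr => h1 h2; exact: is_deriveB.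
Qed.

(** Removable singularity: the mean value inequality holds on segments that start
    close to [z0], but not at [z0], and continuity of [T] lets the starting point
    tend to [z0]. *)
Lemma derive_punctured (T g : C -> C) z0 (r : R) : 0 < r ->
  {for z0, continuous T} -> {for z0, continuous g} ->
  (forall z, z != z0 -> nm (z - z0) < r -> is_derive z 1 T (g z)) ->
  is_derive z0 1 T (g z0).
Proof.
move=> r0 cT cg H; apply/is_deriveC => e e0.
have /cg/nbhs_CP[d1 d10 Hd1] : nbhs (g z0) [set w | nm (w - g z0) < e] by exact: near_disc.
exists (Num.min d1 r); first by rewrite lt_min d10.
move=> z; rewrite lt_min => /andP[zd1 zr].
have [->|zz0] := eqVneq z z0; first by rewrite !subrr mulr0 subr0 nm0 mulr0.
set D := nm (z - z0); have D0 : 0 < D by rewrite nm_gt0 subr_eq0.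
apply/ler_addgt0Pr => n n0.
have n20 : 0 < n / 2 by lra.
have /cT/nbhs_CP[d2 d20 Hd2] : nbhs (T z0) [set w | nm (w - T z0) < n / 2] by exact: near_disc.
set G := nm (g z0); have G0 : 0 <= G by exact: nm_ge0.
have GD : 0 < 2 * (G + 1) * D by rewrite !mulr_gt0//; lra.
(* [seg z0 z s] is the starting point: so close to [z0] that [T] and the linear term
    vary by less than [n / 2] in between. *)
pose s := Num.min (1 / 2) (Num.min (d2 / (2 * D)) (n / (2 * (G + 1) * D))).
have s0 : 0 < s.
  by rewrite !lt_min !divr_gt0//; rewrite mulr_gt0.
have s1 : s < 1 by rewrite gt_min; apply/orP; left; lra.
have sd2 : s * D < d2.
  apply: (@le_lt_trans _ _ (d2 / (2 * D) * D)).
    by rewrite ler_pM2r// /s !ge_min lexx !orbT.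
  rewrite invfM mulrA divfK ?gt_eqF//; lra.
have sG : G * (s * D) <= n / 2.
  have : s * (2 * (G + 1) * D) <= n.
    by rewrite -ler_pdivlMr// /s !ge_min lexx !orbT.
  have : 0 < s * D by rewrite mulr_gt0.
  by nra.
have zsE : seg z0 z s - z0 = s%:C%C * (z - z0) by rewrite /seg addrAC subrr add0r.
have nzs : nm (seg z0 z s - z0) = s * D by rewrite zsE nmM nm_real gtr0_norm.
have Tzs : nm (T (seg z0 z s) - T z0) < n / 2 by apply: Hd2; rewrite nzs.
have M : nm (T z - T (seg z0 z s) - g z0 * (z - seg z0 z s)) <= e * nm (z - seg z0 z s).
  apply: segment_derive_le => t /andP[t0 t1].
  have E : seg (seg z0 z s) z t - z0 = (s + t * (1 - s))%:C%C * (z - z0).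
    by rewrite /seg !rmorphD rmorphM rmorphB rmorph1 /=; ring.
  have k0 : 0 < s + t * (1 - s) by rewrite ltr_wpDr// mulr_ge0//; lra.
  have k1 : s + t * (1 - s) <= 1 by nra.
  have nE : nm (seg (seg z0 z s) z t - z0) <= D.
    by rewrite E nmM nm_real gtr0_norm// ler_piMl// ltW.
  have nE0 : seg (seg z0 z s) z t != z0.
    by rewrite -subr_eq0 E -nm_eq0 nmM nm_real gtr0_norm// mulf_neq0 ?gt_eqF.
  exists (g (seg (seg z0 z s) z t)).
    by apply/ltW/Hd1; apply: le_lt_trans nE _.
  by apply: H => //; apply: le_lt_trans nE _.
have -> : T z - T z0 - g z0 * (z - z0) = (T z - T (seg z0 z s) - g z0 * (z - seg z0 z s))
   + ((T (seg z0 z s) - T z0) - g z0 * (seg z0 z s - z0)) by ring.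
apply: le_trans (nmD _ _) _.
have E2 : nm ((T (seg z0 z s) - T z0) - g z0 * (seg z0 z s - z0)) <= n / 2 + n / 2.
  by apply: le_trans (nmD _ _) _; rewrite nmN nmM nzs lerD// ltW.
have E3 : nm (z - seg z0 z s) <= D.
  have -> : z - seg z0 z s = (1 - s)%:C%C * (z - z0).
    by rewrite /seg rmorphB rmorph1 /=; ring.
  rewrite nmM nm_real gtr0_norm; last lra.
  by rewrite ler_piMl//; [exact: ltW | lra].
have := ler_wpM2l (ltW e0) E3; lra.
Qed.

(** Normalize [T] to an isometry [U] that fixes 0 and the point [p] of the real axis.
    Distances to these two points determine [Re (U z) = Re z] and [Im (U z)] up to sign,
    and the distance to the image of the point [p] of the imaginary axis shows that
    the sign does not depend on [z]. *)
Lemma disc_similarity (T : C -> C) z0 (r k : R) : 0 < r -> 0 < k ->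
  (forall z z', nm (z - z0) < r -> nm (z' - z0) < r ->
     nm (T z - T z') = k * nm (z - z')) ->
  exists l m, nm l = k /\
    ((forall z, nm (z - z0) < r -> T z = l * z + m) \/
     (forall z, nm (z - z0) < r -> T z = l * conjc z + m)).
Proof.
move=> r0 k0 H; pose p := r / 2.
have p0 : 0 < p by rewrite divr_gt0.
have pr : p < r by rewrite /p; lra.
have pC : p%:C%C != 0 :> C by rewrite -nm_eq0 nm_real normr_eq0 gt_eqF.
have dz0 z : z0 + z - z0 = z by rewrite addrC addKr.
pose l := (T (z0 + p%:C%C) - T z0) / p%:C%C.
have ri : nm (0 : C) < r by rewrite nm0.
have rp : nm (p%:C%C : C) < r by rewrite nm_real gtr0_norm.
have rip : nm ((0 +i* p)%C : C) < r by rewrite /= expr0n add0r sqrtr_sqr gtr0_norm.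
have nl : nm l = k.
  rewrite /l nmM nmV H ?dz0// ?subrr// nm_real gtr0_norm// mulfK// gt_eqF//.
have l0 : l != 0 by rewrite -nm_gt0 nl.
pose U z := (T (z0 + z) - T z0) / l.
have TU z : T z = l * U (z - z0) + T z0.
  by rewrite /U [z0 + _]addrC subrK mulrC divfK// subrK.
have iso z z' : nm z < r -> nm z' < r -> nm (U z - U z') ^+ 2 = nm (z - z') ^+ 2.
  move=> zr z'r; have -> : U z - U z' = (T (z0 + z) - T (z0 + z')) / l by rewrite /U; ring.
  rewrite nmM nmV H ?dz0// nl mulrAC divff ?gt_eqF// mul1r.
  by congr (nm _ ^+ 2); ring.
have U0 : U 0 = 0 by rewrite /U addr0 subrr mul0r.
have Up : U p%:C%C = p%:C%C.
  have A0 : T (z0 + p%:C%C) - T z0 != 0 by apply: contraNneq l0 => A0; rewrite /l A0 mul0r.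
  by rewrite /U /l; field; rewrite A0 pC.
have coords z : nm z < r -> complex.Re (U z) = complex.Re z /\
    complex.Im (U z) ^+ 2 = complex.Im z ^+ 2.
  move=> zr; have := iso z 0 zr ri; have := iso z _ zr rp.
  rewrite U0 Up !subr0 !nm_sqr; case: (U z) => a b; case: z zr => x y zr /= e1 e2.
  have e : p * a = p * x by lra.
  by move: e2; rewrite (mulfI (lt0r_neq0 p0) e) => e2; split=> //; lra.
have [cr ci] := coords _ rip.
have main z : nm z < r -> complex.Im (U (0 +i* p)%C) * complex.Im (U z) = p * complex.Im z.
  move=> zr; have [c1 c2] := coords z zr; have := iso z _ zr rip.
  move: cr ci c1 c2; rewrite !nm_sqr; case: (U z) => a b; case: (U _) => a' b'.
  by case: z zr => x y _ /= -> ci -> c2; lra.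
exists l; move: ci => /= /eqP; rewrite eqf_sqr => /orP[]/eqP sg.
  exists (T z0 - l * z0); split=> //; left => z zr; rewrite TU.
  suff -> : U (z - z0) = z - z0 by ring.
  have [c1 _] := coords _ zr; have := main _ zr; rewrite sg => /(mulfI (lt0r_neq0 p0)) c2.
  by apply/eqP; rewrite eq_complex c1 c2 !eqxx.
exists (T z0 - l * conjc z0); split=> //; right => z zr; rewrite TU.
suff -> : U (z - z0) = conjc z - conjc z0 by ring.
have [c1 _] := coords _ zr; have := main _ zr; rewrite sg mulNr -mulrN => /(mulfI (lt0r_neq0 p0)) c2.
rewrite -rmorphB; move: c1 c2; case: (U _) => a b; case: (z - z0) => x y /= -> c2.
by rewrite -c2 opprK.
Qed.

(** The difference quotients along 1 and along the imaginary unit tend to [l] and to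
    its opposite. *)
Lemma conj_not_derivable (T : C -> C) z0 (l m : C) (r : R) : 0 < r ->
  (forall z, nm (z - z0) < r -> T z = l * conjc z + m) ->
  derivable T z0 1 -> l = 0.
Proof.
move=> r0 HT /derivable_is_derive[d /is_deriveC Hd].
apply/eqP; rewrite -nm_eq0 eq_le nm_ge0 andbT.
apply/ler_addgt0Pr => e e0; rewrite add0r.
have [dl dl0 {}Hd] := Hd e e0.
pose t := Num.min (r / 2) (dl / 2).
have t0 : 0 < t by rewrite lt_min !divr_gt0.
have tr : t < r by rewrite gt_min; apply/orP; left; lra.
have td : t < dl by rewrite gt_min; apply/orP; right; lra.
have i0 : nm (z0 - z0) < r by rewrite subrr nm0.
have K (u : C) : nm u = 1 -> nm (l * conjc u - d * u) <= e.
  move=> u1; have E : z0 + t%:C%C * u - z0 = t%:C%C * u by ring.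
  have nE : nm (t%:C%C * u) = t by rewrite nmM u1 mulr1 nm_real gtr0_norm.
  have := Hd (z0 + t%:C%C * u); rewrite E nE => /(_ td).
  have EJ : conjc (z0 + t%:C%C * u) = conjc z0 + t%:C%C * conjc u.
    by rewrite rmorphD rmorphM /= oppr0.
  rewrite !HT ?E ?nE// EJ.
  have -> : l * (conjc z0 + t%:C%C * conjc u) + m - (l * conjc z0 + m) - d * (t%:C%C * u)
    = t%:C%C * (l * conjc u - d * u) by ring.
  by rewrite nmM nm_real gtr0_norm// mulrC ler_pM2r.
have k1 := K 1 nm1; rewrite conjc1 !mulr1 in k1.
have ki : nm (l + d) <= e.
  have := K (0 +i* 1)%C; rewrite /= !expr0n expr1n /= add0r sqrtr1 => /(_ erefl).
  have -> : l * (0 -i* 1)%C - d * (0 +i* 1)%C = (0 -i* 1)%C * (l + d).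
    by rewrite -[(0 +i* 1)%C]opprK; have -> : - (0 +i* 1)%C = (0 -i* 1)%C :> C; [by rewrite /GRing.opp /= oppr0 | ring].
  by rewrite nmM /= expr0n sqrrN expr1n /= add0r sqrtr1 mul1r.
have : nm (l + l) <= e + e.
  have -> : l + l = (l - d) + (l + d) by ring.
  by apply: le_trans (nmD _ _) _; exact: lerD.
have -> : l + l = 2%:R%:C%C * l by rewrite rmorph_nat mulr2n mulrDl !mul1r.
by rewrite nmM nm_real ger0_norm//; lra.
Qed.

End Complex.

(** * Topology and combinatorics of the surface *)

Section SumC.
Variable R : realType.
Local Notation C := (CC R).

Lemma nm_sum (I : Type) (r : seq I) (P : pred I) (F : I -> C) :
  nm (\sum_(i <- r | P i) F i) <= \sum_(i <- r | P i) nm (F i).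
Proof.
elim/big_rec2 : _ => [|i y z _ h]; first by rewrite nm0.
by apply: le_trans (nmD _ _) _; rewrite lerD2l.
Qed.
End SumC.

Section Surface.
Variables (R : realType) (X : flat_surface R).
Local Notation C := (CC R).
Local Notation S := (realization X).
Local Notation I := 'I_(nv X).
Implicit Types (x y p : S) (t : {set I}) (u v w : I).

Lemma point_face x : exists2 t, t \in face X & in_face t (val x).
Proof. by have /existsP[t /andP[tf xt]] := valP x; exists t. Qed.

Lemma bary_ge0 x v : 0 <= bary x v.
Proof. by have [t _ /and3P[/forallP/(_ v)]] := point_face x. Qed.

Lemma bary_sum x : \sum_v bary x v = 1.
Proof. by have [t _ /and3P[_ /eqP]] := point_face x. Qed.

Lemma in_faceP t x : reflect (forall v, v \notin t -> bary x v = 0) (in_face t (val x)).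
Proof.
apply: (iffP idP) => [/and3P[_ _ /forallP H] v vt|H].
  by have /implyP/(_ vt)/eqP := H v.
have [t' _ /and3P[h1 h2 _]] := point_face x.
by rewrite /in_face h1 h2 /=; apply/forallP => v; apply/implyP => /H/eqP.
Qed.

Lemma bary_pos_in t x v : in_face t (val x) -> 0 < bary x v -> v \in t.
Proof.
move=> /in_faceP H; apply: contraTT => /H ->; by rewrite ltxx.
Qed.

Lemma bary_inj x y : bary x =1 bary y -> x = y.
Proof. by move=> H; apply: val_inj; apply/rowP => j; exact: H. Qed.

Lemma face_two_vertices t : t \in face X -> exists u v, [/\ u \in t, v \in t & u != v].
Proof.
move=> tf; have : (1 < #|t|)%N by rewrite (face_card tf).
by move=> /card_gt1P[u [v [ut vt uv]]]; exists u, v.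
Qed.

Lemma exists_bary_pos x : exists u, 0 < bary x u.
Proof.
have : \sum_v bary x v != 0 by rewrite bary_sum oner_neq0.
rewrite psumr_neq0; last by move=> i _; exact: bary_ge0.
by move=> /hasP[u _ /andP[_ h]]; exists u.
Qed.

Lemma nbhs_SP p (A : set S) :
  nbhs p A <-> exists2 r : R, 0 < r &
    forall x, (forall v, `|bary x v - bary p v| < r) -> A x.
Proof.
split.
  move=> /nbhs_ballP[r r0 H]; exists r => // x h; apply: H.
  split; first exact: r0.
  move=> i j; rewrite ord1; have := h j; rewrite /bary => hj; rewrite -ball_normE /ball_ /= distrC; exact: hj.
move=> [r r0 H]; apply/nbhs_ballP; exists r => // x h; apply: H => v.
by have := proj2 h 0 v; rewrite -ball_normE /ball_ /= distrC.
Qed.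

Lemma open_SP (A : set S) : open A <-> forall p, A p -> exists2 r : R, 0 < r &
    forall x, (forall v, `|bary x v - bary p v| < r) -> A x.
Proof.
rewrite openE; split=> H z Az; first by apply/nbhs_SP; apply: H.
by apply/nbhs_SP; exact: H.
Qed.

Lemma near_star p u : 0 < bary p u -> \forall x \near p, 0 < bary x u.
Proof.
move=> pu; apply/nbhs_SP; exists (bary p u) => // x /(_ u); rewrite ltr_norml; lra.
Qed.

(** The open kite formed by the two faces at the edge [uv]; these kites cover the
    complement of the vertices. *)
Definition edge_star u v : set S := [set x | 0 < bary x u /\ 0 < bary x v].

Lemma open_edge_star u v : open (edge_star u v).
Proof.
rewrite openE => x [xu xv]; near=> y; split; near: y; exact: near_star.
Unshelve. all: by end_near. Qed.

(** A barycentric coordinate that is positive at [p] stays positive nearby. *)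
Lemma near_in_face p : \forall x \near p, forall t, in_face t (val x) -> in_face t (val p).
Proof.
suff: \forall x \near p, forall v, 0 < bary p v -> 0 < bary x v.
  apply: filterS => x H t xt; apply/in_faceP => v vt.
  apply/eqP; rewrite eq_le bary_ge0 andbT leNgt; apply: contra vt => /H.
  exact: bary_pos_in.
suff H : forall v, \forall x \near p, 0 < bary p v -> 0 < bary x v by exact: filter_forall H.
move=> v.
have [pv|pv] := ltP 0 (bary p v).
  by apply: filterS (near_star pv).
by apply: (@filterS _ _ _ setT) => [x _|]; [lra | exact: filterT].
Qed.

(** The map that is affine on every face and has the values [e] at the vertices:
    flat coordinates are locally of this form. *)
Definition dev (e : I -> C) x : C := \sum_v (bary x v)%:C%C * e v.

Lemma dev_continuous e : continuous (dev e : S -> C).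
Proof.
move=> p A /nbhs_CP[r r0 H]; apply/nbhs_SP.
pose M := \sum_v nm (e v).
have M0 : 0 <= M by apply: sumr_ge0 => v _; exact: nm_ge0.
exists (r / (M + 1)); first by apply: divr_gt0 => //; lra.
move=> x Hx; apply: H; rewrite /dev -sumrB.
apply: le_lt_trans (nm_sum _ _ _) _.
apply: (@le_lt_trans _ _ (r / (M + 1) * M)).
  rewrite /M mulr_sumr; apply: ler_sum => v _.
  rewrite -mulrBl nmM -rmorphB nm_real ler_wpM2r ?nm_ge0//.
  exact/ltW/Hx.
by rewrite mulrAC ltr_pdivrMr; nra.
Qed.

(** A finite union of closed simplices of the space of row vectors. *)
Lemma compactS : compact [set: S].
Proof.
have cK : compact [set v : 'rV[R]_(nv X) | realization_pt v].
  apply: bounded_closed_compact.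
    apply: filterS (nbhs_pinfty_ge (num_real (1 : R))) => M M1 v /= /existsP[t /andP[tf /and3P[h1 h2 _]]].
    apply: le_trans M1; rewrite [`|_|]mx_normrE; apply/bigmax_leP => /=; split=> // -[i j] _ /=.
    rewrite ord1 -(eqP h2) ger0_norm; last by have /forallP := h1.
    by rewrite (bigD1 j)//= lerDl sumr_ge0// => k _; have /forallP := h1.
  have -> : [set v : 'rV[R]_(nv X) | realization_pt v] =
     \big[setU/set0]_(t <- enum (face X)) [set v | in_face t v].
    rewrite -bigcup_seq; apply/seteqP; split=> v /=.
      by move=> /existsP[t /andP[tf vt]]; exists t => //=; rewrite mem_enum.
    by move=> [t /=]; rewrite mem_enum => tf vt; apply/existsP; exists t; rewrite tf.
  apply: closed_bigsetU => t _.
  have cc (j : I) : continuous (fun v : 'rV[R]_(nv X) => v 0 j) by exact: coord_continuous.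
  have -> : [set v : 'rV[R]_(nv X) | in_face t v] =
    \bigcap_(j in [set: I]) [set v | 0 <= v 0 j] `&` [set v | \sum_j v 0 j = 1] `&`
    \bigcap_(j in [set j | j \notin t]) [set v | v 0 j = 0].
    apply/seteqP; split=> v /=.
      move=> /and3P[/forallP h1 /eqP h2 /forallP h3]; split; first by split=> // j _; exact: h1.
      by move=> j jt; have /implyP/(_ jt)/eqP := h3 j.
    move=> [[h1 h2] h3]; apply/and3P; split; [apply/forallP => j; exact: h1|exact/eqP|].
    by apply/forallP => j; apply/implyP => jt; apply/eqP/h3.
  apply: closedI; first apply: closedI.
  - apply: closed_bigI => j _; apply: (@preimage_closed _ _ (fun v : 'rV[R]_(nv X) => v 0 j) [set y : R | 0 <= y] _ (@closed_ge _ _)).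
    by move=> v _; exact: cc.
  - have cs : continuous (fun v : 'rV[R]_(nv X) => \sum_j v 0 j).
      have ac : continuous (fun x : R * R => x.1 + x.2) by exact: add_continuous.
      by apply: (continuous_big ac (F := fun j (v : 'rV[R]_(nv X)) => v 0 j)) => j _; exact: cc.
    apply: (@preimage_closed _ _ (fun v : 'rV[R]_(nv X) => \sum_j v 0 j) [set y : R | y = 1] _ (@closed_eq _ _)).
    by move=> v _; exact: cs.
  - apply: closed_bigI => j _; apply: (@preimage_closed _ _ (fun v : 'rV[R]_(nv X) => v 0 j) [set y : R | y = 0] _ (@closed_eq _ _)).
    by move=> v _; exact: cc.
move=> F PF FT.
pose G := fmap (val : S -> 'rV[R]_(nv X)) F.
have GK : G [set v | realization_pt v].
  by rewrite /G /fmap /=; apply: filterS FT => x _ /=; exact: valP.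
have [a [Ka ca]] := cK G _ GK.
exists (exist _ a Ka : S); split=> // A B FA /nbhs_SP[r r0 HB].
have GA : G ((val : S -> 'rV[R]_(nv X)) @` A).
  by apply: (@filterS S F _ A) => // x Ax; exists x.
have NB : nbhs a [set v | forall j, `|v 0 j - a 0 j| < r].
  apply/nbhs_ballP; exists r => // v h j /=.
  by have := proj2 h 0 j; rewrite -ball_normE /ball_ /= distrC.
have [_ [[x Ax <-] /= h]] := ca _ _ GA NB.
by exists x; split=> //; apply: HB.
Qed.

Lemma bary_le1 x v : bary x v <= 1.
Proof. by rewrite -(bary_sum x) (bigD1 v)//= lerDl sumr_ge0// => k _; exact: bary_ge0. Qed.

Lemma exists_point t (c : I -> R) : t \in face X -> (forall v, 0 <= c v) ->
  \sum_v c v = 1 -> (forall v, v \notin t -> c v = 0) ->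
  exists x : S, bary x =1 c.
Proof.
move=> tf c0 c1 ct.
have H : realization_pt (\row_v c v : 'rV[R]_(nv X)).
  apply/existsP; exists t; rewrite tf /=; apply/and3P; split.
  - by apply/forallP => v; rewrite mxE.
  - by apply/eqP; rewrite -c1; apply: eq_bigr => v _; rewrite mxE.
  - by apply/forallP => v; apply/implyP => /ct h; rewrite mxE h.
by exists (exist (fun x : 'rV[R]_(nv X) => realization_pt x) _ H) => v; rewrite /bary /= mxE.
Qed.

Definition is_barycenter t x := forall v, bary x v = (v \in t)%:R / 3.

Lemma exists_barycenter t : t \in face X -> exists x, is_barycenter t x.
Proof.
move=> tf; apply: (exists_point tf) => [v||v /negbTE -> ]; last by rewrite mul0r.
  by rewrite divr_ge0.
rewrite -mulr_suml.
have -> : \sum_(i : I) (i \in t)%:R = #|t|%:R :> R.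
  by rewrite -sum1_card natr_sum [RHS]big_mkcond /=; apply: eq_bigr => i _; case: (i \in t).
by rewrite (face_card tf) divff.
Qed.

Lemma barycenter_pos t x v : is_barycenter t x -> v \in t -> 0 < bary x v.
Proof. by move=> xE vt; rewrite xE vt divr_gt0. Qed.

Lemma barycenter_in_face t x : is_barycenter t x -> in_face t (val x).
Proof. by move=> xE; apply/in_faceP => v /negbTE vt; rewrite xE vt mul0r. Qed.

Lemma exists_midpoint u v : u != v -> (exists2 t, t \in face X & (u \in t) && (v \in t)) ->
  exists m, edge_star u v m /\ forall t, u \in t -> v \in t -> in_face t (val m).
Proof.
move=> uv [t tf /andP[ut vt]].
have [|||m mE] := exists_point (c := fun a => (a == u)%:R / 2 + (a == v)%:R / 2) tf.
- by move=> a; rewrite addr_ge0// divr_ge0.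
- rewrite big_split /= -!mulr_suml -!natr_sum -!big_mkcond /= !big_pred1_eq.
  by field.
- move=> a at_; have -> : (a == u) = false by apply: contraNF at_ => /eqP ->.
  have -> : (a == v) = false by apply: contraNF at_ => /eqP ->.
  by rewrite !mul0r addr0.
exists m; split.
  split; rewrite mE eqxx; first by rewrite (negbTE uv) mul0r addr0 divr_gt0.
  by rewrite eq_sym (negbTE uv) mul0r add0r divr_gt0.
move=> t' ut' vt'; apply/in_faceP => a at_; rewrite mE.
have -> : (a == u) = false by apply: contraNF at_ => /eqP ->.
have -> : (a == v) = false by apply: contraNF at_ => /eqP ->.
by rewrite !mul0r addr0.
Qed.

Lemma exists_vertex u : exists x : S, forall v, bary x v = (v == u)%:R.
Proof.
have [t tf ut] := face_cover u; apply: (exists_point tf) => [v||v].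
- by [].
- by rewrite (bigD1 u)//= eqxx big1 ?addr0// => i /negbTE ->.
- by case: (eqVneq v u) => [->|//]; rewrite ut.
Qed.

(** The segment from [x] to [y] inside a common face; the value is arbitrary when
    they have none. *)
Definition mix x y (s : R) : S :=
  xget x [set z | forall v, bary z v = (1 - s) * bary x v + s * bary y v].

Lemma mixE t x y s : t \in face X -> in_face t (val x) -> in_face t (val y) ->
  0 <= s <= 1 -> forall v, bary (mix x y s) v = (1 - s) * bary x v + s * bary y v.
Proof.
move=> tf /in_faceP xt /in_faceP yt /andP[s0 s1]; rewrite /mix; case: xgetP => [z -> //|].
have [||v vt|z zE /(_ z)//] := exists_point (c := fun v => (1 - s) * bary x v + s * bary y v) tf.
- by move=> v; rewrite addr_ge0// mulr_ge0 ?bary_ge0// subr_ge0.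
- by rewrite big_split /= -!mulr_sumr !bary_sum; ring.
- by rewrite xt// yt// !mulr0 addr0.
Qed.

Lemma mix_in_face t x y s : t \in face X -> in_face t (val x) -> in_face t (val y) ->
  0 <= s <= 1 -> in_face t (val (mix x y s)).
Proof.
move=> tf xt yt s01; apply/in_faceP => v vt; rewrite (mixE tf)//.
by move/in_faceP/(_ _ vt): xt => ->; move/in_faceP/(_ _ vt): yt => ->; rewrite !mulr0 addr0.
Qed.

Lemma dev_mix e t x y s : t \in face X -> in_face t (val x) -> in_face t (val y) ->
  0 <= s <= 1 -> dev e (mix x y s) = seg (dev e x) (dev e y) s.
Proof.
move=> tf xt yt s01; rewrite /seg /dev -sumrB mulr_sumr -big_split /=.
by apply: eq_bigr => v _; rewrite (mixE tf)// rmorphD !rmorphM rmorphB rmorph1 /=; ring.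
Qed.

Lemma mix_pos t x y s v : t \in face X -> in_face t (val x) -> in_face t (val y) ->
  0 <= s <= 1 -> 0 < bary x v -> 0 < bary y v -> 0 < bary (mix x y s) v.
Proof. move=> tf xt yt s01 xv yv; rewrite (mixE tf)//; move/andP: s01 => -[]; nra. Qed.

Lemma mix0 t x y : t \in face X -> in_face t (val x) -> in_face t (val y) -> mix x y 0 = x.
Proof.
move=> tf xt yt; apply: bary_inj => v; rewrite (mixE tf)// ?lexx ?ler01//.
by rewrite subr0 mul1r mul0r addr0.
Qed.

Lemma mix1 t x y : t \in face X -> in_face t (val x) -> in_face t (val y) -> mix x y 1 = y.
Proof.
move=> tf xt yt; apply: bary_inj => v; rewrite (mixE tf)// ?lexx ?ler01//.
by rewrite subrr mul1r mul0r add0r.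
Qed.

Lemma path_continuousP (g : R -> S) : {within `[0, 1], continuous g} <->
  forall c, 0 <= c <= 1 -> forall A, nbhs (g c) A ->
    exists2 d : R, 0 < d & forall s, 0 <= s <= 1 -> `|s - c| < d -> A (g s).
Proof.
split.
  move=> /subspace_continuousP H c c01 A /(H c _); rewrite /= in_itv /= => /(_ c01).
  move=> /nbhs_ballP[d d0 h]; exists d => // s s01 sc; apply: h; last by rewrite /= in_itv.
  by rewrite -ball_normE /ball_ /= distrC.
move=> H; apply/subspace_continuousP => c; rewrite /= in_itv /= => c01 A /(H c c01)[d d0 h].
apply/nbhs_ballP; exists d => // s; rewrite -ball_normE /ball_ /= distrC => sd.
by rewrite in_itv /= => s01; exact: h.
Qed.

Lemma mix_path t x y : t \in face X -> in_face t (val x) -> in_face t (val y) ->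
  {within `[0, 1], continuous (mix x y)}.
Proof.
move=> tf xt yt; apply/path_continuousP => c c01 A /nbhs_SP[r r0 H].
exists r => // s s01 sc; apply: H => v; rewrite !(mixE tf)//.
have -> : (1 - s) * bary x v + s * bary y v - ((1 - c) * bary x v + c * bary y v) =
  (s - c) * (bary y v - bary x v) by ring.
rewrite normrM; apply: le_lt_trans sc; rewrite ler_piMr// ler_norml.
by have := bary_ge0 x v; have := bary_ge0 y v; have := bary_le1 x v; have := bary_le1 y v; lra.
Qed.

(** The faces with [P] cover a set that is open as well as closed: around a point on
    several faces, [face_link] carries [P] from one of them to all others. *)
Lemma face_connected (P : {set I} -> Prop) : connected [set: S] ->
  (forall s t, s \in face X -> t \in face X -> #|s :&: t| = 2%N -> P s -> P t) ->
  forall s t, s \in face X -> t \in face X -> P s -> P t.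
Proof.
move=> cS HP s t sf tf Ps.
pose B : set S := [set x | exists s, [/\ s \in face X, in_face s (val x) & P s]].
have key x : B x -> forall t, t \in face X -> in_face t (val x) -> P t.
  move=> [s1 [s1f xs1 Ps1]] t1 t1f xt1.
  have [v xv] := exists_bary_pos x.
  have /connectP[q] := face_link s1f t1f (bary_pos_in xs1 xv) (bary_pos_in xt1 xv).
  move=> + ->; elim: q s1 s1f xs1 Ps1 => //= a q IH s1 s1f xs1 Ps1 /andP[/and5P[_ af v1 va /eqP c2] pq].
  have Pa : P a by exact: HP Ps1.
  clear IH; elim: q a af Pa va pq {c2} => //= b q IH a af Pa va /andP[/and5P[_ bf _ vb /eqP c2] pq].
  by apply: (IH b) => //; exact: HP Pa.
have [b bE] := exists_barycenter sf; have [b' bE'] := exists_barycenter tf.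
have ins := barycenter_in_face bE; have int := barycenter_in_face bE'.
apply: (key b') => //; suff -> : B = setT by [].
apply: cS.
- by exists b, s.
- exists B; last by rewrite setTI.
  rewrite openE => x Bx; apply: filterS (near_in_face x) => y H.
  have [a af ya] := point_face y; exists a; split=> //; exact: key (H _ ya).
- exists B; last by rewrite setTI.
  rewrite -openC openE => x Bx; apply: filterS (near_in_face x) => y H By; apply: Bx.
  by have [a [af ya Pa]] := By; exists a; split=> //; exact: H.
Qed.

(** The edge [uv] together with the two faces on its sides; orientation puts [w] on
    the left and [w'] on the right. *)
Definition hinge u v w w' := [/\ u != v, w != w', pos u v w & pos v u w'].

Lemma face_third t u v : t \in face X -> u \in t -> v \in t -> u != v ->
  exists w, [/\ t = [set u; v; w]%SET, w != u & w != v].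
Proof.
move=> tf ut vt uv.
have : #|t :\: [set u; v]| == 1%N.
  rewrite cardsD (finset.setIidPr _) ?cards2 ?uv ?(face_card tf)//.
  by apply/fintype.subsetP => z; rewrite !inE => /orP[]/eqP ->.
move=> /cards1P[w E]; exists w.
have : w \in t :\: [set u; v] by rewrite E inE.
rewrite !inE negb_or => /andP[/andP[wu wv] wt]; split=> //.
apply/setP => z; rewrite !inE.
have := congr1 (fun A : {set I} => z \in A) E; rewrite /= !inE => Ez.
have [->|zu] := eqVneq z u; first by rewrite ut.
have [->|zv] := eqVneq z v; first by rewrite vt.
by move: Ez; rewrite (negbTE zu) (negbTE zv).
Qed.

Lemma pos_neq u v w : pos u v w -> [/\ u != v, v != w & w != u] :> Prop.
Proof.
move=> /[dup] p0 /pos_face /face_card; have [<-|uv] := eqVneq u v.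
  by rewrite finset.setUid cards2; case: (_ == _).
have [<-|vw] := eqVneq v w; first by rewrite -finset.setUA finset.setUid cards2; case: (_ == _).
by have [<-|//] := eqVneq w u; rewrite finset.setUAC finset.setUid cards2; case: (_ == _).
Qed.

Lemma exists_hinge t u v : t \in face X -> u \in t -> v \in t -> u != v ->
  exists w w', hinge u v w w'.
Proof.
move=> tf ut vt uv; have /eqP/cards2P[s1 [s2 [s12 E]]] := face_edge tf ut vt uv.
have : s1 \in [set s in face X | (u \in s) && (v \in s)]%SET by rewrite E !inE eqxx.
have : s2 \in [set s in face X | (u \in s) && (v \in s)]%SET by rewrite E !inE eqxx orbT.
rewrite !inE => /and3P[f2 u2 v2] /and3P[f1 u1 v1].
have [w1 [E1 _ _]] := face_third f1 u1 v1 uv.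
have [w2 [E2 _ _]] := face_third f2 u2 v2 uv.
have w12 : w1 != w2 by apply: contra s12 => /eqP e; rewrite E1 E2 e.
rewrite E1 in f1; rewrite E2 in f2.
have C := pos_coherent w12 f1 f2.
have [p1|p1] := boolP (pos u v w1).
  by exists w1, w2; split=> //; move: C; rewrite p1 (pos_swap f2) negbK.
exists w2, w1; split=> //; first by rewrite eq_sym.
  by move: C; rewrite (negbTE p1) => /esym/negbFE.
by move: p1; rewrite (pos_swap f1) negbK.
Qed.

Lemma hinge_faces t u v w w' : hinge u v w w' -> t \in face X -> u \in t -> v \in t ->
  t = [set u; v; w]%SET \/ t = [set u; v; w']%SET.
Proof.
move=> [uv ww' p1 p2] tf ut vt.
have f1 := pos_face p1; have := pos_face p2; rewrite (finset.setUC [set v]%SET) => f2.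
have /eqP c2 := face_edge tf ut vt uv.
pose F := [set s in face X | (u \in s) && (v \in s)]%SET.
have [_ _ wu] := pos_neq p1; have [_ _ w'v] := pos_neq p2.
have s12 : [set u; v; w]%SET != [set u; v; w']%SET.
  apply/eqP => /(congr1 (fun A : {set I} => w \in A)); rewrite !inE eqxx orbT (negbTE ww').
  have [_ vw _] := pos_neq p1; rewrite (eq_sym w v) (negbTE vw) (negbTE wu)//.
have /eqP E : [set [set u; v; w]; [set u; v; w']]%SET == F.
  rewrite eqEcard (eqP c2) cards2 s12 andbT; apply/fintype.subsetP => s.
  by rewrite !inE => /orP[]/eqP ->; rewrite ?f1 ?f2 !inE !eqxx ?orbT.
have : t \in F by rewrite inE tf ut.
by rewrite -E !inE => /orP[]/eqP ->; [left|right].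
Qed.

Lemma not_vertex_pos p u : ~ is_vertex p -> 0 < bary p u -> exists2 v, v != u & 0 < bary p v.
Proof.
move=> np pu; apply: contrapT => H; apply: np; exists u.
have H0 v : v != u -> bary p v = 0.
  move=> vu; apply/eqP; rewrite eq_le bary_ge0 andbT leNgt; apply/negP => pv.
  by apply: H; exists v.
apply/rowP => j; rewrite mxE eqxx /=; have [->|/H0//] := eqVneq j u.
by have := bary_sum p; rewrite (bigD1 u)//= big1 ?addr0.
Qed.

Lemma nonvertex_hinge p u : ~ is_vertex p -> 0 < bary p u ->
  exists v w w', hinge u v w w' /\ edge_star u v p.
Proof.
move=> np pu; have [v vu pv] := not_vertex_pos np pu.
have [t tf pt] := point_face p; have uv : u != v by rewrite eq_sym.
have [w [w' h]] := exists_hinge tf (bary_pos_in pt pu) (bary_pos_in pt pv) uv.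
by exists v, w, w'.
Qed.

Lemma vertex_bary x u : is_vertex x -> 0 < bary x u -> forall v, bary x v = (v == u)%:R.
Proof.
move=> [a xa]; have E v : bary x v = (v == a)%:R by rewrite /bary xa mxE eqxx.
by rewrite E; case: (eqVneq u a) => [-> _|]; [exact: E|rewrite ltxx].
Qed.

Lemma edge_star_not_vertex u v x : u != v -> edge_star u v x -> ~ is_vertex x.
Proof.
move=> uv [xu xv] vx.
by move: xv; rewrite (vertex_bary vx xu) eq_sym (negbTE uv) ltxx.
Qed.

End Surface.

(** * The flat metric near an edge *)

Section HingeChart.
Variables (R : realType) (X : flat_surface R).
Local Notation C := (CC R).
Local Notation S := (realization X).
Local Notation I := 'I_(nv X).
Implicit Types (x y p : S) (t : {set I}) (u v w : I).

(** Expand the squares on the right; all but the mixed terms are killed by the sum 0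
    of the weights. Applied to the two coordinates of the plane it is the formula
    behind [face_dist]. *)
Lemma bary_sum_sq (c : I -> R) (a : I -> R) : \sum_v c v = 0 ->
  (\sum_v c v * a v) ^+ 2 =
  - 2^-1 * \sum_u \sum_v c u * c v * (a u - a v) ^+ 2.
Proof.
move=> c0.
have -> : \sum_u \sum_v c u * c v * (a u - a v) ^+ 2 =
  \sum_u (c u * a u ^+ 2 * (\sum_v c v) + c u * (\sum_v c v * a v ^+ 2)
    - 2 * (c u * a u * \sum_v c v * a v)).
  apply: eq_bigr => u _; rewrite !mulr_sumr -big_split /= -sumrB.
  by apply: eq_bigr => v _; ring.
rewrite c0 sumrB big_split /= -mulr_sumr -!mulr_suml c0 mulr0 mul0r addr0 sub0r.
by rewrite expr2; field.
Qed.

Lemma nm_bary_sum (c : I -> R) (P : I -> C) : \sum_v c v = 0 ->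
  nm (\sum_v (c v)%:C%C * P v) ^+ 2 =
  - 2^-1 * \sum_u \sum_(v | v != u) c u * c v * nm (P u - P v) ^+ 2.
Proof.
move=> c0.
have -> : \sum_v (c v)%:C%C * P v =
    ((\sum_v c v * complex.Re (P v)) +i* (\sum_v c v * complex.Im (P v)))%C.
  elim/big_rec3: _ => [|i y1 y2 y3 _ ->]; first by [].
  case: (P i) => a b; apply/eqP; rewrite eq_complex /= !mul0r subr0 addr0.
  by rewrite !eqxx.
rewrite nm_sqr /= !bary_sum_sq// -mulrDr -big_split /=; congr (_ * _).
apply: eq_bigr => u _; rewrite -big_split /= (bigD1 u)//= !subrr expr0n !mulr0 addr0 add0r.
apply: eq_bigr => v _; rewrite nm_sqr; case: (P u) => a b; case: (P v) => a' b' /=.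
by ring.
Qed.

(** The formula for [face_dist] computes the Euclidean distance in every planar
    placement of the face. *)
Lemma face_dist_dev (P : I -> C) (k : R) t x y : 0 <= k ->
  (forall a b, a \in t -> b \in t -> a != b -> nm (P a - P b) = k * len a b) ->
  in_face t (val x) -> in_face t (val y) ->
  nm (dev P x - dev P y) = k * face_dist x y.
Proof.
move=> k0 HP /in_faceP xt /in_faceP yt.
have c0 : \sum_v (bary x v - bary y v) = 0 by rewrite sumrB !bary_sum subrr.
have -> : dev P x - dev P y = \sum_v (bary x v - bary y v)%:C%C * P v.
  by rewrite /dev -sumrB; apply: eq_bigr => v _; rewrite rmorphB mulrBl.
rewrite -[LHS]ger0_norm ?nm_ge0// -sqrtr_sqr nm_bary_sum// /face_dist.
rewrite -[X in X * Num.sqrt _]ger0_norm// -sqrtr_sqr -sqrtrM ?sqr_ge0//; congr Num.sqrt.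
rewrite mulrCA; congr (_ * _); rewrite mulr_sumr; apply: eq_bigr => u _.
rewrite mulr_sumr; apply: eq_bigr => v vu.
have [ut|ut] := boolP (u \in t); last by rewrite xt// yt// subrr !mul0r mulr0.
have [vt|vt] := boolP (v \in t); last by rewrite (xt v)// (yt v)// subrr mulr0 !mul0r mulr0.
by rewrite HP// 1?eq_sym// exprMn; ring.
Qed.

Lemma face_dist_ge0 x y : 0 <= face_dist x y.
Proof. exact: sqrtr_ge0. Qed.

Lemma chain_length_ge0 x (s : seq S) : 0 <= chain_length x s.
Proof. by elim: s x => //= y s IH x; rewrite addr_ge0// face_dist_ge0. Qed.

Lemma flat_dist_le x y (s : seq S) : path (@same_face R X) x s -> last x s = y ->
  flat_dist x y <= chain_length x s.
Proof.
move=> ps ls; apply: ge_inf; last by exists s.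
by exists 0 => _ [s' _ <-]; exact: chain_length_ge0.
Qed.

(** The chain [s0] guards against the default value of the infimum of an empty
    set. *)
Lemma flat_dist_ge x y (r : R) s0 : path (@same_face R X) x s0 -> last x s0 = y ->
  (forall s, path (@same_face R X) x s -> last x s = y -> r <= chain_length x s) ->
  r <= flat_dist x y.
Proof.
move=> p0 l0 H; apply: lb_le_inf; first by exists (chain_length x s0), s0.
by move=> _ [s [ps ls] <-]; exact: H.
Qed.

(** The vertices [P] lay the two faces of the hinge down in the plane, at the scale
    [k]. *)
Definition placed (k : R) (P : I -> C) u v w w' :=
  [/\ forall t a b, t \in face X -> u \in t -> v \in t -> a \in t -> b \in t ->
        a != b -> nm (P a - P b) = k * len a b,
      ccw (P u) (P v) (P w) & ccw (P v) (P u) (P w')].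

Section Kite.
Variables (u v w w' : I) (k : R) (P : I -> C).
Hypotheses (Hh : hinge u v w w') (k0 : 0 < k) (HP : placed k P u v w w').

Let f1 : [set u; v; w]%SET \in face X.
Proof. by case: Hh => _ _ /pos_face. Qed.
Let f2 : [set u; v; w']%SET \in face X.
Proof. by case: Hh => _ _ _ /pos_face; rewrite (finset.setUC [set v]%SET). Qed.
Let uv : u != v. Proof. by case: Hh. Qed.
Let vu : v != u. Proof. by rewrite eq_sym. Qed.
Let ww' : w != w'. Proof. by case: Hh. Qed.
Let w'w : w' != w. Proof. by rewrite eq_sym. Qed.
Let wu : w != u. Proof. by case: Hh => _ _ /pos_neq[]. Qed.
Let wv : w != v. Proof. by case: Hh => _ _ /pos_neq[_]; rewrite eq_sym. Qed.
Let w'u : w' != u. Proof. by case: Hh => _ _ _ /pos_neq[_]; rewrite eq_sym. Qed.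
Let w'v : w' != v. Proof. by case: Hh => _ _ _ /pos_neq[]. Qed.

Lemma sum_kite (V : nmodType) (F : I -> V) :
  (forall a, a != u -> a != v -> a != w -> a != w' -> F a = 0) ->
  \sum_a F a = F u + F v + F w + F w'.
Proof.
move=> H; rewrite (bigD1 u)//= (bigD1 v)//= (bigD1 w) ?wu//= (bigD1 w') ?w'u ?w'v//=.
rewrite big1 ?addr0 ?addrA// => a /andP[/andP[/andP[au av] aw] aw']; exact: H.
Qed.

Let d := P v - P u.
Let d0 : d != 0.
Proof.
apply/eqP => e; case: HP => _; rewrite /ccw -/d e invr0 mulr0 /=.
by rewrite ltxx.
Qed.
(* The similarity that sends [P u] to 0 and [P v] to 1: the common edge lies on the
    real axis, the face [uvw] above it and the other one below. *)
Let zeta (z : C) : C := (z - P u) / d.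
Let tau := zeta (P w).
Let tau' := zeta (P w').
Let T1 : 0 < complex.Im tau. Proof. by case: HP. Qed.
Let T2 : 0 < - complex.Im tau'.
Proof.
case: HP => _ _; rewrite /ccw.
have -> : (P w' - P v) / (P u - P v) = 1 - tau'.
  have h : - (P v - P u) != 0 by rewrite oppr_eq0.
  have -> : P u - P v = - (P v - P u) by ring.
  by rewrite /tau' /zeta /d; field.
by case: tau' => a b /=; rewrite sub0r.
Qed.

(* Barycentric coordinates of the point placed at [z]: the height gives the weight
    of [w] or of [w'], according to its sign, and then the abscissa gives the weight
    of [v]. *)
Let cw z := Num.max (complex.Im (zeta z)) 0 / complex.Im tau.
Let cw' z := Num.max (- complex.Im (zeta z)) 0 / (- complex.Im tau').
Let cv z := complex.Re (zeta z) - cw z * complex.Re tau - cw' z * complex.Re tau'.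
Let cu z := 1 - cv z - cw z - cw' z.

Let coord a z := if a == u then cu z else if a == v then cv z else
  if a == w then cw z else if a == w' then cw' z else 0.

(** This makes the inverse of the placement continuous. *)
Lemma coord_lipschitz : exists2 L : R, 0 < L &
  forall z z' a, `|coord a z - coord a z'| <= L * nm (z - z').
Proof.
pose D := nm d.
have D0 : 0 < D by rewrite nm_gt0.
have Zl z z' : nm (zeta z - zeta z') = nm (z - z') / D.
  by rewrite /zeta -mulrBl nmM nmV; congr (nm _ / _); ring.
have maxl (a b : R) : `|Num.max a 0 - Num.max b 0| <= `|a - b|.
  rewrite ler_norml; case: (leP a 0) => ha; case: (leP b 0) => hb;
  have := ler_norm (a - b); have := ler_norm (b - a); rewrite (distrC b a) => h1 h2;
  have := normr_ge0 (a - b); lra.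
have Wl z z' : `|cw z - cw z'| <= (complex.Im tau)^-1 / D * nm (z - z').
  rewrite /cw -mulrBl normrM [`|_^-1|]gtr0_norm ?invr_gt0// -mulrA mulrC ler_pM2l ?invr_gt0//.
  apply: le_trans (maxl _ _) _; rewrite mulrC -Zl.
  have -> : complex.Im (zeta z) - complex.Im (zeta z') = complex.Im (zeta z - zeta z').
    by case: (zeta z) => ? ?; case: (zeta z').
  exact: Im_le.
have Wl' z z' : `|cw' z - cw' z'| <= (- complex.Im tau')^-1 / D * nm (z - z').
  rewrite /cw' -mulrBl normrM [`|_^-1|]gtr0_norm ?invr_gt0// -mulrA mulrC ler_pM2l ?invr_gt0//.
  apply: le_trans (maxl _ _) _; rewrite mulrC -Zl.
  have -> : - complex.Im (zeta z) - - complex.Im (zeta z') = - complex.Im (zeta z - zeta z').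
    by case: (zeta z) => ? ?; case: (zeta z') => ? ? /=; ring.
  by rewrite normrN; exact: Im_le.
set A := _ / D in Wl; set B := _ / D in Wl'.
have A0 : 0 < A by rewrite divr_gt0 ?invr_gt0.
have B0 : 0 < B by rewrite divr_gt0 ?invr_gt0.
pose L1 := D^-1 + A * `|complex.Re tau| + B * `|complex.Re tau'|.
have Vl z z' : `|cv z - cv z'| <= L1 * nm (z - z').
  have -> : cv z - cv z' = complex.Re (zeta z - zeta z') - (cw z - cw z') * complex.Re tau
     - (cw' z - cw' z') * complex.Re tau'.
    rewrite /cv; have -> : complex.Re (zeta z - zeta z') = complex.Re (zeta z) - complex.Re (zeta z').
      by case: (zeta z) => ? ?; case: (zeta z').
    ring.
  apply: le_trans (ler_normB _ _) _; rewrite /L1 !mulrDl lerD//.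
    apply: le_trans (ler_normB _ _) _; rewrite lerD//.
      by rewrite mulrC -Zl Re_le.
    by rewrite -mulrDl normrM mulrAC ler_wpM2r.
  by rewrite -mulrDl normrM mulrAC ler_wpM2r.
have L10 : 0 < L1.
  by rewrite /L1 -addrA ltr_pwDl ?invr_gt0// addr_ge0// mulr_ge0// ltW.
clearbody L1.
have Ul z z' : `|cu z - cu z'| <= (L1 + A + B) * nm (z - z').
  have -> : cu z - cu z' = - ((cv z - cv z') + (cw z - cw z') + (cw' z - cw' z')) by rewrite /cu; ring.
  rewrite normrN !mulrDl; apply: le_trans (ler_normD _ _) _; rewrite lerD//.
  by apply: le_trans (ler_normD _ _) _; rewrite lerD.
exists (L1 + A + B); first by rewrite !addr_gt0.
move=> z z' a; rewrite /coord.
have n0 := nm_ge0 (z - z').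
case: eqP => _; first exact: Ul.
case: eqP => _; first by apply: le_trans (Vl _ _) _; rewrite ler_wpM2r//; lra.
case: eqP => _; first by apply: le_trans (Wl _ _) _; rewrite ler_wpM2r//; lra.
case: eqP => _; first by apply: le_trans (Wl' _ _) _; rewrite ler_wpM2r//; lra.
by rewrite subrr normr0 mulr_ge0//; lra.
Qed.

Let zeta_dev x : (forall a, a != u -> a != v -> a != w -> a != w' -> bary x a = 0) ->
  zeta (dev P x) = (bary x v)%:C%C + (bary x w)%:C%C * tau + (bary x w')%:C%C * tau'.
Proof.
move=> H; rewrite /dev sum_kite; last by move=> a *; rewrite H// mul0r.
have : \sum_a bary x a = 1 by exact: bary_sum.
rewrite sum_kite// => E.
have -> : bary x u = 1 - bary x v - bary x w - bary x w' by rewrite -E; ring.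
rewrite !rmorphB rmorph1 /tau /tau' /zeta /d.
by have := d0; rewrite /d => d0'; field.
Qed.

Lemma coordE x t : t \in face X -> u \in t -> v \in t -> in_face t (val x) ->
  forall a, bary x a = coord a (dev P x).
Proof.
move=> tf ut vt /in_faceP xt.
have Z : (forall a, a != u -> a != v -> a != w -> a != w' -> bary x a = 0) /\
   (bary x w = 0 \/ bary x w' = 0).
  have [e|e] := hinge_faces Hh tf ut vt; split.
  - by move=> a au av aw _; apply: xt; rewrite e !inE !negb_or au av aw.
  - by right; apply: xt; rewrite e !inE !negb_or w'u w'v w'w.
  - by move=> a au av _ aw; apply: xt; rewrite e !inE !negb_or au av aw.
  - by left; apply: xt; rewrite e !inE !negb_or wu wv ww'.
have [H W0] := Z.
have E := zeta_dev H.
have b0 := bary_ge0 x w; have b0' := bary_ge0 x w'.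
have EI : complex.Im (zeta (dev P x)) = bary x w * complex.Im tau + bary x w' * complex.Im tau'.
  by rewrite E; case: tau => a b; case: tau' => a' b' /=; rewrite !mul0r !addr0 add0r.
have ER : complex.Re (zeta (dev P x)) = bary x v + bary x w * complex.Re tau + bary x w' * complex.Re tau'.
  by rewrite E; case: tau => a b; case: tau' => a' b' /=; rewrite !mul0r !subr0.
have Ew : cw (dev P x) = bary x w.
  rewrite /cw EI; case: W0 => e; rewrite e mul0r.
    by rewrite add0r max_r ?mul0r//; move: T2 b0'; nra.
  by rewrite addr0 max_l ?mulfK ?gt_eqF// mulr_ge0// ltW.
have Ew' : cw' (dev P x) = bary x w'.
  rewrite /cw' EI; case: W0 => e; rewrite e mul0r.
    rewrite add0r -mulrN max_l ?mulfK ?gt_eqF// mulr_ge0// ltW//.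
  by rewrite addr0 max_r ?mul0r// oppr_le0 mulr_ge0// ltW.
have Ev : cv (dev P x) = bary x v by rewrite /cv Ew Ew' ER; ring.
have Eu : cu (dev P x) = bary x u.
  by have := bary_sum x; rewrite sum_kite// /cu Ev Ew Ew' => <-; ring.
move=> a; rewrite /coord; case: eqVneq => [->//|au]; case: eqVneq => [->//|av].
by case: eqVneq => [->//|aw]; case: eqVneq => [->//|aw']; exact: H.
Qed.

Lemma coord_point z : 0 < coord u z -> 0 < coord v z ->
  exists x, [/\ edge_star u v x, dev P x = z & forall a, bary x a = coord a z].
Proof.
have Eu : coord u z = cu z by rewrite /coord eqxx.
have Ev : coord v z = cv z by rewrite /coord (negbTE vu) eqxx.
have Ew : coord w z = cw z by rewrite /coord (negbTE wu) (negbTE wv) eqxx.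
have Ew' : coord w' z = cw' z by rewrite /coord (negbTE w'u) (negbTE w'v) (negbTE w'w) eqxx.
move=> u0 v0.
have cw0 : 0 <= cw z by rewrite divr_ge0 ?le_max ?lexx ?orbT// ltW.
have cw'0 : 0 <= cw' z by rewrite divr_ge0 ?le_max ?lexx ?orbT// ltW.
have c0 a : 0 <= coord a z.
  rewrite /coord; case: eqP => _; first by rewrite -Eu ltW.
  case: eqP => _; first by rewrite -Ev ltW.
  by case: eqP => // _; case: eqP.
have cout a : a != u -> a != v -> a != w -> a != w' -> coord a z = 0.
  by rewrite /coord => /negbTE -> /negbTE -> /negbTE -> /negbTE ->.
have c1 : \sum_a coord a z = 1.
  by rewrite sum_kite// Eu Ev Ew Ew' /cu; ring.
have [x xE] : exists x : S, bary x =1 coord^~ z.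
  have [Y|Y] := leP 0 (complex.Im (zeta z)).
    apply: (exists_point f1) => // a; rewrite !inE !negb_or => /andP[/andP[au av] aw].
    have [->|aw'] := eqVneq a w'; last exact: cout.
    by rewrite Ew' /cw' max_r ?mul0r// oppr_le0.
  apply: (exists_point f2) => // a; rewrite !inE !negb_or => /andP[/andP[au av] aw'].
  have [->|aw] := eqVneq a w; last exact: cout.
  by rewrite Ew /cw max_r ?mul0r// ltW.
exists x; split=> //; first by split; rewrite xE.
have : zeta (dev P x) = zeta z.
  rewrite zeta_dev; last by move=> a *; rewrite xE cout.
  rewrite !xE Ev Ew Ew'.
  have IE : cw z * complex.Im tau + cw' z * complex.Im tau' = complex.Im (zeta z).
    rewrite /cw /cw' divfK ?gt_eqF// invrN mulrN mulNr divfK; last by rewrite -oppr_eq0 gt_eqF.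
    by case: (leP (complex.Im (zeta z)) 0) => h; case: leP => h'; lra.
  have RE : cv z + cw z * complex.Re tau + cw' z * complex.Re tau' = complex.Re (zeta z).
    by rewrite /cv; ring.
  move: IE RE; case: tau => a b; case: tau' => a' b'; case: (zeta z) => p q /= IE RE.
  apply/eqP; rewrite eq_complex /= !mul0r !subr0 !addr0 add0r.
  by rewrite IE RE !eqxx.
rewrite /zeta => /(mulIf (invr_neq0 d0)) /addIr //.
Qed.

(* the image of [edge_star u v] in the plane *)
Let Omega z := 0 < coord u z /\ 0 < coord v z.

Let Omega_disc z : Omega z -> exists2 r : R, 0 < r & forall z', nm (z' - z) < r -> Omega z'.
Proof.
move=> [zu zv]; have [L L0 HL] := coord_lipschitz.
exists (Num.min (coord u z) (coord v z) / L).
  by rewrite divr_gt0// lt_min zu zv.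
move=> z'; rewrite ltr_pdivlMr// mulrC lt_min => /andP[h1 h2].
have := HL z' z u; have := HL z' z v; rewrite !ler_norml => /andP[g1 _] /andP[g2 _].
by split; lra.
Qed.

Let Omega_dev x : edge_star u v x -> Omega (dev P x).
Proof.
move=> [xu xv]; have [t tf xt] := point_face x.
by split; rewrite -(coordE tf (bary_pos_in xt xu) (bary_pos_in xt xv) xt).
Qed.

Lemma kite_inj x y : edge_star u v x -> edge_star u v y -> dev P x = dev P y -> x = y.
Proof.
move=> [xu xv] [yu yv] e.
have [t tf xt] := point_face x; have [t' tf' yt] := point_face y.
apply: bary_inj => a.
rewrite (coordE tf (bary_pos_in xt xu) (bary_pos_in xt xv) xt) e.
by rewrite -(coordE tf' (bary_pos_in yt yu) (bary_pos_in yt yv) yt).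
Qed.

Lemma kite_open_map (V : set S) : open V -> V `<=` edge_star u v -> open (dev P @` V).
Proof.
move=> oV Vs; apply/open_CP => _ [x Vx <-].
have [r r0 Hr] := Omega_disc (Omega_dev (Vs _ Vx)).
have [L L0 HL] := coord_lipschitz.
have [e e0 He] := proj1 (open_SP V) oV x Vx.
exists (Num.min r (e / L)); first by rewrite lt_min r0 divr_gt0.
move=> z; rewrite lt_min => /andP[zr ze].
have [zu zv] := Hr _ zr.
have [y [ys yz yE]] := coord_point zu zv.
exists y => //; apply: He => a; rewrite yE.
have [xu xv] := Vs _ Vx; have [t tf xt] := point_face x.
rewrite (coordE tf (bary_pos_in xt xu) (bary_pos_in xt xv) xt).
by apply: le_lt_trans (HL _ _ _) _; rewrite mulrC -ltr_pdivlMr.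
Qed.

Lemma kite_open_embedding : open_embedding (edge_star u v) (dev P).
Proof.
split.
- exact: open_edge_star.
- by move=> x y /set_mem xs /set_mem ys; exact: kite_inj.
- by move=> x _; exact: dev_continuous.
- exact: kite_open_map.
Qed.

Lemma kite_face_dist t x y : t \in face X -> u \in t -> v \in t ->
  in_face t (val x) -> in_face t (val y) -> nm (dev P x - dev P y) = k * face_dist x y.
Proof.
move=> tf ut vt; apply: face_dist_dev; first exact: ltW.
by move=> a b at_ bt; case: HP => H _ _; exact: (H t).
Qed.

(* A chain from [x] either stays in the disc of radius [r], where every step is
    realized in the placement, or crosses the boundary circle. *)
Let chain_ge p (r : R) : (forall z, nm (z - dev P p) < r -> Omega z) ->
  forall (s : seq S) x, edge_star u v x -> nm (dev P x - dev P p) < r ->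
    path (@same_face R X) x s ->
    Num.min (nm (dev P x - dev P (last x s))) (r - nm (dev P x - dev P p))
      <= k * chain_length x s.
Proof.
move=> Hr; elim=> [|y s IH] x xs xr /=.
  by move=> _; rewrite subrr nm0 mulr0 ge_min lexx.
move=> /andP[/existsP[t /andP[tf /andP[xt yt]]] ps].
have [xu xv] := xs.
have ut := bary_pos_in xt xu; have vt := bary_pos_in xt xv.
have E := kite_face_dist tf ut vt xt yt.
rewrite mulrDr -E.
have c0 : 0 <= k * chain_length y s by rewrite mulr_ge0 ?chain_length_ge0// ltW.
have h1 := nmBD (dev P x) (dev P y) (dev P p).
rewrite (nmBC (dev P y) (dev P x)) in h1.
have [yr|yr] := ltP (nm (dev P y - dev P p)) r; last first.
  by rewrite ge_min; apply/orP; right; lra.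
have ys : edge_star u v y.
  by have [yu yv] := Hr _ yr; split; rewrite (coordE tf ut vt yt).
have := IH y ys yr ps.
have h2 := nmBD (dev P y) (dev P x) (dev P (last y s)).
rewrite !ge_min => /orP[h|h]; apply/orP; [left|right]; lra.
Qed.

(* The segment from [dev P x] to [dev P y] comes from a chain: of one step inside a
    face, or of two steps that meet where the segment crosses the common edge. *)
Let chain_le x y : edge_star u v x -> edge_star u v y ->
  (forall s, 0 <= s <= 1 -> Omega (seg (dev P x) (dev P y) s)) ->
  exists s, [/\ path (@same_face R X) x s, last x s = y &
                k * chain_length x s = nm (dev P x - dev P y)].
Proof.
move=> xs ys Hs; have [xu xv] := xs; have [yu yv] := ys.
have [t tf xt] := point_face x; have [t' tf' yt] := point_face y.
have ut := bary_pos_in xt xu; have vt := bary_pos_in xt xv.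
have ut' := bary_pos_in yt yu; have vt' := bary_pos_in yt yv.
have one t0 : t0 \in face X -> in_face t0 (val x) -> in_face t0 (val y) ->
    exists s, [/\ path (@same_face R X) x s, last x s = y &
                k * chain_length x s = nm (dev P x - dev P y)].
  move=> t0f xt0 yt0; exists [:: y]; split=> //=.
    by rewrite andbT; apply/existsP; exists t0; rewrite t0f xt0.
  by rewrite addr0 (kite_face_dist t0f) //; exact: bary_pos_in xt0 _.
(* [m] is the point where the segment crosses the common edge *)
have two : forall m, edge_star u v m -> bary m w = 0 -> bary m w' = 0 ->
    (exists2 s, 0 <= s <= 1 & dev P m = seg (dev P x) (dev P y) s) ->
    exists s, [/\ path (@same_face R X) x s, last x s = y &
                k * chain_length x s = nm (dev P x - dev P y)].
  move=> m [mu mv] mw mw' [s s01 sE].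
  have minf t0 : t0 \in face X -> u \in t0 -> v \in t0 -> in_face t0 (val m).
    move=> t0f ut0 vt0; have [tm tmf mtm] := point_face m.
    apply/in_faceP => a at0.
    have au : a != u by apply: contraNneq at0 => ->.
    have av : a != v by apply: contraNneq at0 => ->.
    have [->//|aw] := eqVneq a w; have [->//|aw'] := eqVneq a w'.
    rewrite (coordE tmf (bary_pos_in mtm mu) (bary_pos_in mtm mv) mtm) /coord.
    by rewrite (negbTE au) (negbTE av) (negbTE aw) (negbTE aw').
  have mt := minf _ tf ut vt; have mt' := minf _ tf' ut' vt'.
  exists [:: m; y]; split=> //=.
    by rewrite andbT; apply/andP; split; apply/existsP;
      [exists t; rewrite tf xt mt|exists t'; rewrite tf' mt' yt].
  rewrite addr0 mulrDr -(kite_face_dist tf)// -(kite_face_dist tf')// sE.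
  have -> : dev P x - seg (dev P x) (dev P y) s = s%:C%C * (dev P x - dev P y).
    by rewrite /seg; ring.
  have -> : seg (dev P x) (dev P y) s - dev P y = (1 - s)%:C%C * (dev P x - dev P y).
    by rewrite /seg rmorphB rmorph1 /=; ring.
  case/andP: s01 => s0 s1; rewrite !nmM !nm_real !ger0_norm ?subr_ge0// -mulrDl.
  by rewrite addrC subrK mul1r.
have cross : forall z, Omega z -> complex.Im (zeta z) = 0 ->
   exists m, [/\ edge_star u v m, dev P m = z, bary m w = 0 & bary m w' = 0].
  move=> z [zu zv] z0; have [m [ms mz mE]] := coord_point zu zv.
  exists m; split=> //; rewrite mE /coord.
    by rewrite (negbTE wu) (negbTE wv) eqxx /cw z0 max_r ?mul0r.
  by rewrite (negbTE w'u) (negbTE w'v) (negbTE w'w) eqxx /cw' z0 oppr0 max_r ?mul0r.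
have [e|e] := eqVneq t t'; first by apply: (one t) => //; rewrite e.
pose a := complex.Im (zeta (dev P x)); pose b := complex.Im (zeta (dev P y)).
have ab : (0 <= a /\ b <= 0) \/ (a <= 0 /\ 0 <= b).
  have side x0 t0 : t0 \in face X -> u \in t0 -> v \in t0 -> in_face t0 (val x0) ->
      (t0 = [set u; v; w]%SET -> 0 <= complex.Im (zeta (dev P x0))) /\
      (t0 = [set u; v; w']%SET -> complex.Im (zeta (dev P x0)) <= 0).
    move=> t0f ut0 vt0 xt0; have cE := coordE t0f ut0 vt0 xt0.
    have nin a0 : a0 \notin t0 -> bary x0 a0 = 0 by move/in_faceP: xt0; apply.
    split=> e0.
      have : bary x0 w' = 0 by apply: nin; rewrite e0 !inE !negb_or w'u w'v w'w.
      rewrite cE /coord (negbTE w'u) (negbTE w'v) (negbTE w'w) eqxx /cw'.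
      move/eqP; rewrite mulf_eq0 invr_eq0 (gt_eqF T2) orbF => /eqP h.
      by rewrite -oppr_le0 -h le_max lexx.
    have : bary x0 w = 0 by apply: nin; rewrite e0 !inE !negb_or wu wv ww'.
    rewrite cE /coord (negbTE wu) (negbTE wv) eqxx /cw.
    move/eqP; rewrite mulf_eq0 invr_eq0 (gt_eqF T1) orbF => /eqP h.
    by rewrite -h le_max lexx.
  have [s1 s2] := side x t tf ut vt xt; have [s1' s2'] := side y t' tf' ut' vt' yt.
  have [E1|E1] := hinge_faces Hh tf ut vt; have [E2|E2] := hinge_faces Hh tf' ut' vt'.
  - by rewrite E1 E2 eqxx in e.
  - by left; rewrite s1// s2'.
  - by right; rewrite s2// s1'.
  - by rewrite E1 E2 eqxx in e.
have [D0|D0] := eqVneq (a - b) 0.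
  have a0 : a = 0 by case: ab; lra.
  have [m [h1 h2 h3 h4]] := cross (dev P x) (Omega_dev xs) a0.
  by apply: (two m) => //; exists 0; rewrite ?seg0 ?lexx ?ler01.
have s01 : 0 <= a / (a - b) <= 1.
  case: ab => -[h1 h2].
    have D : 0 < a - b by rewrite lt_neqAle eq_sym D0; lra.
    by rewrite divr_ge0 ?(ltW D)//= ler_pdivrMr// mul1r; lra.
  have D : 0 < b - a by rewrite lt_neqAle eq_sym subr_eq0 eq_sym -subr_eq0 D0; lra.
  have -> : a / (a - b) = (- a) / (b - a) by rewrite -(opprB a b) invrN mulrNN.
  by rewrite divr_ge0 ?(ltW D)//=; [rewrite ler_pdivrMr// mul1r; lra|lra].
have [||m [h1 h2 h3 h4]] := cross (seg (dev P x) (dev P y) (a / (a - b))).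
- exact: Hs.
- have -> : zeta (seg (dev P x) (dev P y) (a / (a - b))) =
     seg (zeta (dev P x)) (zeta (dev P y)) (a / (a - b)).
    by rewrite /seg /zeta; ring.
  move: D0; rewrite /a /b /seg; case: (zeta (dev P x)) => p q; case: (zeta (dev P y)) => p' q' /=.
  by move=> D0; rewrite mul0r addr0; field.
by apply: (two m) => //; exists (a / (a - b)).
Qed.

(** Chains are at least as long as the placement suggests, and the straight one is
    no longer. In the disc of a quarter of the radius [r], a chain that leaves the
    large disc is longer than the distance of any two points. *)
Lemma kite_isometry p : edge_star u v p -> exists2 r : R, 0 < r &
  forall x y, edge_star u v x -> edge_star u v y ->
    nm (dev P x - dev P p) < r -> nm (dev P y - dev P p) < r ->
    nm (dev P x - dev P y) = k * flat_dist x y.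
Proof.
move=> ps; have [r r0 Hr] := Omega_disc (Omega_dev ps).
exists (r / 4); first by rewrite divr_gt0.
move=> x y xs ys xr yr.
have [s [p_s ls Ls]] : exists s, [/\ path (@same_face R X) x s, last x s = y &
                k * chain_length x s = nm (dev P x - dev P y)].
  apply: chain_le => // s s01; apply: Hr; apply: seg_disc => //; lra.
apply/le_anti/andP; split.
  rewrite mulrC -ler_pdivrMr//; apply: (flat_dist_ge p_s ls) => s' ps' ls'.
  rewrite ler_pdivrMr// mulrC.
  have := chain_ge Hr xs _ ps'; rewrite ls' => /(_ ltac:(lra)).
  have := nmBD (dev P p) (dev P x) (dev P y); rewrite (nmBC (dev P p)).
  by rewrite ge_min => h /orP[|]; lra.
by rewrite -Ls ler_pM2l//; exact: flat_dist_le.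
Qed.

Lemma kite_isometry_near p : edge_star u v p ->
  \forall x & y \near p, nm (dev P x - dev P y) = k * flat_dist x y.
Proof.
move=> ps; have [r r0 H] := kite_isometry ps.
have N : \forall x \near p, edge_star u v x /\ nm (dev P x - dev P p) < r.
  apply: filterI; first by apply: open_nbhs_nbhs; split=> //; exact: open_edge_star.
  exact: (dev_continuous (e := P) (near_disc (dev P p) r0)).
near=> x y; apply: H.
- by have [] : edge_star u v x /\ nm (dev P x - dev P p) < r by near: x.
- by have [] : edge_star u v y /\ nm (dev P y - dev P p) < r by near: y.
- by have [] : edge_star u v x /\ nm (dev P x - dev P p) < r by near: x.
- by have [] : edge_star u v y /\ nm (dev P y - dev P p) < r by near: y.
Unshelve. all: by end_near. Qed.

End Kite.

Lemma ccw_affine (l m a b c : C) : l != 0 -> ccw a b c ->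
  ccw (l * a + m) (l * b + m) (l * c + m).
Proof.
rewrite /ccw => l0 H.
have ba : b - a != 0 by apply/eqP => e; move: H; rewrite e invr0 mulr0 /= ltxx.
suff -> : (l * c + m - (l * a + m)) / (l * b + m - (l * a + m)) = (c - a) / (b - a) by [].
have -> : l * c + m - (l * a + m) = l * (c - a) by ring.
have -> : l * b + m - (l * a + m) = l * (b - a) by ring.
by field; rewrite ba.
Qed.

Lemma ccw_rot (a b c : C) : ccw a b c -> ccw b c a.
Proof.
rewrite /ccw => H.
have ba : b - a != 0 by apply/eqP => e; move: H; rewrite e invr0 mulr0 /= ltxx.
have h1 : (c - a) / (b - a) - 1 = (c - b) / (b - a) by field.
set z := (c - a) / (b - a) in H h1.
have cb : c - b = (z - 1) * (b - a) by rewrite h1 divfK.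
have z1 : z - 1 != 0.
  by apply/eqP => e; move: H; rewrite (_ : z = 1) ?ltxx//; apply/eqP; rewrite -subr_eq0 e.
have -> : (a - b) / (c - b) = - (z - 1)^-1 by rewrite cb; field; rewrite ba z1.
move: H z1; case: z {h1 cb} => p q /= H _.
have -> : p - 1 = p - 1 by [].
rewrite /GRing.inv /= oppr0 addr0 opprK.
have : 0 < q / ((p - 1) ^+ 2 + q ^+ 2).
  by rewrite divr_gt0// ltr_wpDl ?sqr_ge0 ?exprn_gt0.
by [].
Qed.

Lemma pos_perm u v w a b c : [set a; b; c]%SET = [set u; v; w]%SET ->
  pos u v w -> pos a b c ->
  [\/ [/\ a = u, b = v & c = w], [/\ a = v, b = w & c = u] | [/\ a = w, b = u & c = v]].
Proof.
move=> E p1 p2.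
have [ab bc ca] := pos_neq p2; have [uv vw wu] := pos_neq p1.
have mem z : z \in [set a; b; c]%SET -> [|| z == u, z == v | z == w].
  by rewrite E !inE -orbA.
have ma := mem a; rewrite !inE eqxx /= in ma.
have mb := mem b; rewrite !inE eqxx orbT /= in mb.
have mc := mem c; rewrite !inE eqxx orbT /= in mc.
have f1 := pos_face p1.
have sw : pos v u w = false by move: (pos_swap f1); rewrite p1; case: (pos v u w).
case/or3P: (ma isT) => /eqP ea; case/or3P: (mb isT) => /eqP eb;
  case/or3P: (mc isT) => /eqP ec; subst a b c;
  rewrite ?eqxx// in ab bc ca.
- by constructor 1.
- by move: p2; rewrite pos_rot pos_rot sw.
- by move: p2; rewrite sw.
- by constructor 2.
- by constructor 3.
- by move: p2; rewrite pos_rot sw.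
Qed.

End HingeChart.

(** * Isometric charts *)

Section Charts.
Variables (R : realType) (X : flat_surface R).
Local Notation C := (CC R).
Local Notation S := (realization X).
Local Notation I := 'I_(nv X).
Implicit Types (x y p : S) (t : {set I}) (u v w : I).

Lemma sum_face3 (V : nmodType) (F : I -> V) u v w : u != v -> v != w -> w != u ->
  (forall a, a \notin [set u; v; w]%SET -> F a = 0) -> \sum_a F a = F u + F v + F w.
Proof.
move=> uv vw wu H; have vu : v != u by rewrite eq_sym.
have wv : w != v by rewrite eq_sym.
rewrite (bigD1 u)//= (bigD1 v)//= (bigD1 w) ?wu//= big1 ?addr0 ?addrA//.
by move=> a /andP[/andP[au av] aw]; apply: H; rewrite !inE !negb_or au av aw.
Qed.

Lemma dev_face3 (P : I -> C) u v w x : pos u v w -> in_face [set u; v; w]%SET (val x) ->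
  dev P x = (bary x u)%:C%C * P u + (bary x v)%:C%C * P v + (bary x w)%:C%C * P w.
Proof.
move=> /pos_neq[uv vw wu] /in_faceP xt; rewrite /dev (sum_face3 uv vw wu)//.
by move=> a /xt ->; rewrite mul0r.
Qed.

Lemma dev_affine (P : I -> C) (l m : C) x : dev (fun a => l * P a + m) x = l * dev P x + m.
Proof.
have E : m = \sum_v (bary x v)%:C%C * m.
  by rewrite -mulr_suml -rmorph_sum bary_sum mul1r.
rewrite [in RHS]E /dev mulr_sumr -big_split /=; apply: eq_bigr => v _; ring.
Qed.

Lemma dev_affine_continuous (P : I -> C) (l m : C) : continuous (fun x : S => l * dev P x + m).
Proof.
have -> : (fun x : S => l * dev P x + m) = dev (fun a => l * P a + m).
  by apply/funext => x; rewrite dev_affine.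
exact: dev_continuous.
Qed.

Lemma dev_conj (P : I -> C) x : dev (fun a => conjc (P a)) x = conjc (dev P x).
Proof.
rewrite /dev; elim/big_rec2 : _ => [|a y1 y2 _ ->]; first by rewrite conjc0.
by rewrite rmorphD rmorphM /= oppr0.
Qed.

Lemma dev_vertex (P : I -> C) a x : (forall v, bary x v = (v == a)%:R) -> dev P x = P a.
Proof.
move=> xE; rewrite /dev (bigD1 a)//= xE eqxx mul1r big1 ?addr0// => v /negbTE va.
by rewrite xE va mul0r.
Qed.

(** The segment from [p] towards a vertex of the face starts inside the given
    neighbourhood. *)
Lemma dev_face_ext (A B : I -> C) t p : t \in face X -> in_face t (val p) ->
  (\forall x \near p, in_face t (val x) -> dev A x = dev B x) ->
  forall a, a \in t -> A a = B a.
Proof.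
move=> tf pt /nbhs_SP[r r0 H] a at_.
have [y yE] := exists_vertex a.
have yt : in_face t (val y).
  by apply/in_faceP => v vt; rewrite yE; case: eqVneq => // va; rewrite va at_ in vt.
pose s := Num.min (r / 2) 1.
have s0 : 0 < s by rewrite lt_min ltr01 andbT divr_gt0.
have s01 : 0 <= s <= 1 by rewrite (ltW s0) ge_min lexx orbT.
have sr : s < r by rewrite gt_min; apply/orP; left; lra.
have : dev A (mix p y s) = dev B (mix p y s).
  apply: H; last exact: (mix_in_face tf).
  move=> v; rewrite (mixE tf)//.
  have -> : (1 - s) * bary p v + s * bary y v - bary p v = s * (bary y v - bary p v) by ring.
  rewrite normrM gtr0_norm//; apply: le_lt_trans sr; rewrite ger_pMr// ler_norml.
  by have := bary_ge0 p v; have := bary_ge0 y v; have := bary_le1 p v; have := bary_le1 y v; lra.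
rewrite !(dev_mix _ tf)// /seg !(dev_vertex _ yE).
have -> : dev A p = dev B p by apply: H => // v; rewrite subrr normr0.
move=> /addrI; have sC : s%:C%C != 0 :> C by rewrite -nm_eq0 nm_real normr_eq0 gt_eqF.
by move=> /(mulfI sC) /addIr.
Qed.

(** A triangle with base on the real axis and apex [x + i y]. *)
Lemma cosine_law (l a b : R) : 0 < l -> 0 < a -> 0 < b ->
  l < a + b -> a < l + b -> b < l + a ->
  exists x y : R, [/\ 0 < y, x ^+ 2 + y ^+ 2 = b ^+ 2 & (x - l) ^+ 2 + y ^+ 2 = a ^+ 2].
Proof.
move=> l0 a0 b0 h1 h2 h3.
pose x := (l ^+ 2 + b ^+ 2 - a ^+ 2) / (2 * l).
have xl : 2 * l * x = l ^+ 2 + b ^+ 2 - a ^+ 2 by rewrite /x; field; lra.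
have D : 0 < b ^+ 2 - x ^+ 2.
  have l2 : 0 < (2 * l) ^+ 2 by rewrite exprn_gt0// mulr_gt0.
  rewrite -(pmulr_rgt0 _ l2).
  have -> : (2 * l) ^+ 2 * (b ^+ 2 - x ^+ 2) = (2 * l * b) ^+ 2 - (2 * l * x) ^+ 2 by ring.
  rewrite xl.
  have -> : (2 * l * b) ^+ 2 - (l ^+ 2 + b ^+ 2 - a ^+ 2) ^+ 2 =
    ((a - (l - b)) * (a + (l - b))) * ((l + b - a) * (l + b + a)) by ring.
  by rewrite !mulr_gt0//; lra.
exists x, (Num.sqrt (b ^+ 2 - x ^+ 2)); split; first by rewrite sqrtr_gt0.
  by rewrite sqr_sqrtr ?ltW// addrC subrK.
rewrite sqr_sqrtr ?ltW//; have -> : (x - l) ^+ 2 + (b ^+ 2 - x ^+ 2) = l ^+ 2 + b ^+ 2 - 2 * l * x by ring.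
by rewrite xl; ring.
Qed.

Lemma placement_exists u v w w' : hinge u v w w' -> exists P : I -> C, placed 1 P u v w w'.
Proof.
move=> h; have [uv ww' p1 p2] := h.
have [_ vw wu] := pos_neq p1; have [vu uw' w'v] := pos_neq p2.
have f1 := pos_face p1; have := pos_face p2; rewrite (finset.setUC [set v]%SET) => f2.
have tri z : z != u -> z != v -> [set u; v; z]%SET \in face X ->
   exists x y : R, [/\ 0 < y, x ^+ 2 + y ^+ 2 = len u z ^+ 2 & (x - len u v) ^+ 2 + y ^+ 2 = len v z ^+ 2].
  move=> zu zv zf.
  have iu : u \in [set u; v; z]%SET by rewrite !inE eqxx.
  have iv : v \in [set u; v; z]%SET by rewrite !inE eqxx orbT.
  have iz : z \in [set u; v; z]%SET by rewrite !inE eqxx orbT.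
  apply: cosine_law.
  - exact: (len_gt0 zf).
  - by apply: (len_gt0 zf) => //; rewrite eq_sym.
  - by apply: (len_gt0 zf) => //; rewrite eq_sym.
  - by have := len_triangle zf; rewrite (len_sym z v); lra.
  - have -> : len u v = len v u by exact: len_sym.
    apply: len_triangle; have -> // : [set v; z; u]%SET = [set u; v; z]%SET.
    by apply/setP => q; rewrite !inE orbC orbA.
  - by apply: len_triangle; rewrite finset.setUAC.
have [|||x [y [y0 e1 e2]]] := tri w => //; first by rewrite eq_sym.
have [|||x' [y' [y'0 e1' e2']]] := tri w' => //; first by rewrite eq_sym.
have l0 : 0 < len u v by apply: (len_gt0 f1) => //; rewrite !inE eqxx ?orbT.
have wv : w != v by rewrite eq_sym.
have w'u : w' != u by rewrite eq_sym.
have w'w : w' != w by rewrite eq_sym.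
(* base on the real axis, the first apex above it, the second one below *)
pose P a : C := if a == u then 0 else if a == v then (len u v)%:C%C else
  if a == w then (x +i* y)%C else (x' -i* y')%C.
have Pu : P u = 0 by rewrite /P eqxx.
have Pv : P v = (len u v)%:C%C by rewrite /P (negbTE vu) eqxx.
have Pw : P w = (x +i* y)%C by rewrite /P (negbTE wu) (negbTE wv) eqxx.
have Pw' : P w' = (x' -i* y')%C by rewrite /P (negbTE w'u) (negbTE w'v) (negbTE w'w).
have Q1 : nm (P u - P v) = len u v by rewrite Pu Pv sub0r nmN nm_real gtr0_norm.
have sq (s : R) c : 0 < c -> s = c ^+ 2 -> Num.sqrt s = c.
  by move=> c0 ->; rewrite sqrtr_sqr gtr0_norm.
have lz z : z != u -> z != v -> [set u; v; z]%SET \in face X -> 0 < len u z /\ 0 < len v z.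
  by move=> zu zv zf; split; apply: (len_gt0 zf) => //; rewrite ?inE ?eqxx ?orbT// eq_sym.
have [lw lw2] := lz _ wu wv f1; have [lw' lw'2] := lz _ w'u w'v f2.
have Q2 : nm (P u - P w) = len u w by rewrite Pu Pw sub0r nmN /=; exact: sq.
have Q3 : nm (P v - P w) = len v w.
  by rewrite Pv Pw nmBC /= subr0; apply: sq.
have Q4 : nm (P u - P w') = len u w' by rewrite Pu Pw' sub0r nmN /=; apply: sq; rewrite // sqrrN.
have Q5 : nm (P v - P w') = len v w'.
  by rewrite Pv Pw' nmBC /= subr0; apply: sq; rewrite // sqrrN.
exists P; split.
- move=> t a b tf ut vt; rewrite mul1r.
  have sym a0 b0 : nm (P a0 - P b0) = len a0 b0 -> nm (P b0 - P a0) = len b0 a0.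
    by rewrite nmBC len_sym.
  have [->|->] := hinge_faces h tf ut vt; rewrite !inE => /orP[/orP[]|]/eqP -> /orP[/orP[]|]/eqP ->;
    rewrite ?eqxx// => _; try done; exact: sym.
- rewrite /ccw Pu Pv Pw !subr0.
  have -> : ((x +i* y) / (len u v)%:C)%C = ((x / len u v) +i* (y / len u v))%C :> C.
    apply: (mulIf (x := (len u v)%:C%C : C)).
      by rewrite -nm_eq0 nm_real normr_eq0 gt_eqF.
    rewrite divfK; last by rewrite -nm_eq0 nm_real normr_eq0 gt_eqF.
    apply/eqP; rewrite eq_complex /=; apply/andP; split; apply/eqP; field; exact: lt0r_neq0.
  by rewrite /= divr_gt0.
rewrite /ccw Pu Pv Pw' sub0r.
have -> : ((x' -i* y')%C - (len u v)%:C%C) / - (len u v)%:C%C =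
   (- (x' / len u v - 1) +i* (y' / len u v))%C :> C.
  apply: (mulIf (x := - (len u v)%:C%C : C)).
    by rewrite oppr_eq0 -nm_eq0 nm_real normr_eq0 gt_eqF.
  rewrite divfK; last by rewrite oppr_eq0 -nm_eq0 nm_real normr_eq0 gt_eqF.
  apply/eqP; rewrite eq_complex /=; apply/andP; split; apply/eqP; field; exact: lt0r_neq0.
by rewrite /= divr_gt0.
Qed.

Lemma placed_oriented k (P : I -> C) u v w w' p : hinge u v w w' -> placed k P u v w w' ->
  edge_star u v p ->
  forall a b c, pos a b c -> exists A B D : C, ccw A B D /\
    \forall x \near p, in_face [set a; b; c]%SET (val x) ->
      dev P x = (bary x a)%:C%C * A + (bary x b)%:C%C * B + (bary x c)%:C%C * D.
Proof.
move=> h [_ c1 c2] [pu pv] a b c pabc.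
have [pin|pout] := boolP (in_face [set a; b; c]%SET (val p)); last first.
  (* near [p] there are no points of the face, so any positive triangle will do *)
  exists 0, 1, (0 +i* 1)%C; split; first by rewrite /ccw !subr0 divr1 /=.
  by apply: filterS (near_in_face p) => x H xt; move: pout; rewrite H.
exists (P a), (P b), (P c); split; last first.
  by apply: filterE => x; exact: dev_face3.
have [_ _ p1 p2] := h.
have [e|e] := hinge_faces h (pos_face pabc) (bary_pos_in pin pu) (bary_pos_in pin pv).
  have [[-> -> ->]|[-> -> ->]|[-> -> ->]] := pos_perm e p1 pabc => //.
    exact: ccw_rot.
  by apply/ccw_rot/ccw_rot.
rewrite (finset.setUC [set u]%SET) in e.
have [[-> -> ->]|[-> -> ->]|[-> -> ->]] := pos_perm e p2 pabc => //.
  exact: ccw_rot.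
by apply/ccw_rot/ccw_rot.
Qed.

Lemma hinge_chart u v w w' (P : I -> C) : hinge u v w w' -> placed 1 P u v w w' ->
  isometric_chart (edge_star u v) (dev P).
Proof.
move=> h hP; split; first exact: (kite_open_embedding h hP).
move=> p ps; split; last exact: placed_oriented h hP ps.
have [[A B] /= [pA pB] H] := kite_isometry_near h ltr01 hP ps.
by exists (A, B) => //= -[x y] xy; rewrite H// mul1r.
Qed.

Lemma nonvertex_edge p : ~ is_vertex p -> exists u v w w', hinge u v w w' /\ edge_star u v p.
Proof.
move=> np; have [u pu] := exists_bary_pos p.
by have [v [w [w' h]]] := nonvertex_hinge np pu; exists u, v, w, w'.
Qed.

Lemma open_embedding_disc (U : set S) (w : S -> C) p (N : set S) :
  open_embedding U w -> U p -> nbhs p N ->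
  exists2 r : R, 0 < r & forall z, nm (z - w p) < r -> exists x, [/\ U x, N x & w x = z].
Proof.
move=> [oU _ _ om] Up; rewrite nbhsE => -[V [oV Vp] VN].
have oW : open (w @` (U `&` V)) by apply: om; [exact: openI | move=> x []].
have [|r r0 H] := proj1 (open_CP _) oW (w p); first by exists p.
by exists r => // z /H[x [Ux Vx] <-]; exists x; split=> //; exact: VN.
Qed.

(** Both charts are isometric, so the change of charts is a similarity of a disc. A
    reflection is ruled out on a face that contains [p], where both charts are
    affine and preserve the orientation. *)
Lemma isometric_unique k u v w w' (P : I -> C) (phi : S -> C) p :
  hinge u v w w' -> 0 < k -> placed k P u v w w' -> edge_star u v p -> isometric_at p phi ->
  exists l m, nm l = k^-1 /\ \forall x \near p, phi x = l * dev P x + m.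
Proof.
move=> h k0 hP ps [iso ori].
have oe := kite_open_embedding h hP.
have [[A B] /= [pA pB] HAB] := iso.
have [r0 r00 Hr0] := kite_isometry h k0 hP ps.
have NN : nbhs p (A `&` B `&` [set x | nm (dev P x - dev P p) < r0]).
  apply: filterI; first exact: filterI.
  exact: (dev_continuous (e := P) (near_disc (dev P p) r00)).
have [r rp Hr] := open_embedding_disc oe ps NN.
pose good x := edge_star u v x /\ (A `&` B `&` [set x | nm (dev P x - dev P p) < r0]) x.
(* the change of charts *)
pose T z := phi (xget p [set x | good x /\ dev P x = z]).
have TE x : good x -> T (dev P x) = phi x.
  move=> gx; rewrite /T; congr phi; case: xgetP => [y _ [[ys _] e]|/(_ x)].
    by case: gx => xs _; apply: (kite_inj h hP).
  by case.
have gz z : nm (z - dev P p) < r -> exists2 x, good x & dev P x = z.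
  by move=> /Hr[x [xs xN xz]]; exists x.
have Tiso z z' : nm (z - dev P p) < r -> nm (z' - dev P p) < r ->
   nm (T z - T z') = k^-1 * nm (z - z').
  move=> /gz[x gx <-] /gz[y gy <-]; rewrite !TE//.
  case: gx gy => xs [[xA xB] xr] [ys [[yA yB] yr]].
  rewrite (Hr0 x y)// mulKf ?gt_eqF//; exact: (HAB (x, y)).
have ki : 0 < k^-1 by rewrite invr_gt0.
have [l [m [nl lm]]] := disc_similarity rp ki Tiso.
exists l, m; split=> //.
have ngood : \forall x \near p, good x /\ nm (dev P x - dev P p) < r.
  apply: filterI; first apply: filterI => //.
    by apply: open_nbhs_nbhs; split=> //; exact: open_edge_star.
  exact: (dev_continuous (e := P) (near_disc (dev P p) rp)).
case: lm => [H|H].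
  by apply: filterS ngood => x [gx xr]; rewrite -TE// H.
exfalso.
have E : \forall x \near p, phi x = dev (fun a => l * conjc (P a) + m) x.
  by apply: filterS ngood => x [gx xr]; rewrite -TE// H// dev_affine dev_conj.
have l0 : l != 0 by rewrite -nm_eq0 nl gt_eqF.
have noccw (A0 B0 D0 : C) : ccw A0 B0 D0 ->
    ~ ccw (l * conjc A0 + m) (l * conjc B0 + m) (l * conjc D0 + m).
  rewrite /ccw => c0.
  have d0 : conjc B0 - conjc A0 != 0.
    rewrite -rmorphB conjc_eq0; apply/eqP => e; move: c0; rewrite e invr0 mulr0 /=.
    by rewrite ltxx.
  have -> : (l * conjc D0 + m - (l * conjc A0 + m)) / (l * conjc B0 + m - (l * conjc A0 + m)) =
     (conjc D0 - conjc A0) / (conjc B0 - conjc A0).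
    have -> : l * conjc D0 + m - (l * conjc A0 + m) = l * (conjc D0 - conjc A0) by ring.
    have -> : l * conjc B0 + m - (l * conjc A0 + m) = l * (conjc B0 - conjc A0) by ring.
    by field; rewrite d0.
  rewrite -!rmorphB -fmorphV -rmorphM /=; case: (_ / _) c0 => q q' /=; lra.
have [t tf pt] := point_face p.
have [pu pv] := ps; have ut := bary_pos_in pt pu; have vt := bary_pos_in pt pv.
have [uv ww' p1 p2] := h; have [_ c1 c2] := hP.
have fin a b c : t = [set a; b; c]%SET -> pos a b c -> ccw (P a) (P b) (P c) -> False.
  move=> e pabc cc; have [A0 [B0 [D0 [cABD nABD]]]] := ori _ _ _ pabc.
  have [ab bc ca] := pos_neq pabc.
  pose Q z := if z == a then A0 else if z == b then B0 else D0.
  have EQ : forall z, z \in t -> Q z = l * conjc (P z) + m.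
    apply: (dev_face_ext tf pt); apply: filterS (filterI E nABD) => x [xE xF] xt.
    rewrite -xE; rewrite -e in xF; rewrite xF// (dev_face3 _ pabc) -?e//.
    by rewrite /Q !eqxx (eq_sym b a) (negbTE ab) (negbTE ca) (eq_sym c b) (negbTE bc).
  apply: (noccw _ _ _ cc).
  rewrite -!EQ ?e ?inE ?eqxx ?orbT// /Q !eqxx (eq_sym b a) (negbTE ab) (negbTE ca).
  by rewrite (eq_sym c b) (negbTE bc).
have [e|e] := hinge_faces h tf ut vt; first exact: fin e p1 c1.
by rewrite (finset.setUC [set u]%SET) in e; exact: fin e p2 c2.
Qed.

End Charts.

(** * Developing the surface by integrating the form *)

Section Derive.
Variable R : realType.
Local Notation C := (CC R).

Lemma is_derive_power (z l m : C) n :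
  is_derive z 1 (fun y : C => l * y ^+ n + m) (l * (n%:R * z ^+ n.-1)).
Proof.
have h1 : is_derive z 1 (fun y : C => y ^+ n) (n%:R * z ^+ n.-1).
  have := @is_deriveX _ _ id n z 1 1 (is_derive_id _ _).
  rewrite /GRing.scale /= mulr1.
  have -> // : (id : C -> C) ^+ n = (fun y : C => y ^+ n).
  by apply/funext => y; elim: n => [//|n IH]; rewrite !exprS -IH.
have h2 := is_deriveZ l h1.
have h3 := is_deriveD h2 (is_derive_cst m z 1).
by rewrite addr0 in h3.
Qed.

Lemma is_derive_linear (z l m : C) : is_derive z 1 (fun y : C => l * y + m) l.
Proof. by have := is_derive_power z l m 1; rewrite /= expr0 !mulr1. Qed.

Lemma is_derive_near (T T' : C -> C) (z l : C) :
  (\forall y \near z, T y = T' y) -> is_derive z 1 T l -> is_derive z 1 T' l.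
Proof.
move=> /nbhs_CP[r r0 H] /is_deriveC D; apply/is_deriveC => e e0.
have [d d0 Hd] := D e e0; exists (Num.min r d); first by rewrite lt_min r0.
move=> z'; rewrite lt_min => /andP[zr zd].
by rewrite -!H ?subrr ?nm0//; exact: Hd.
Qed.

Lemma is_derive_cont (T : C -> C) (z l : C) : is_derive z 1 T l -> {for z, continuous T}.
Proof.
move=> /is_deriveC D A /nbhs_CP[r r0 H].
have [d d0 Hd] := D 1 ltr01.
have L : 0 < 1 + nm l by rewrite ltr_wpDr// nm_ge0.
apply/nbhs_CP; exists (Num.min d (r / (1 + nm l))); first by rewrite lt_min d0 divr_gt0.
move=> z'; rewrite lt_min => /andP[zd]; rewrite ltr_pdivlMr// => zr; apply: H.
have -> : T z' - T z = (T z' - T z - l * (z' - z)) + l * (z' - z) by ring.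
apply: le_lt_trans (nmD _ _) _; rewrite nmM.
have := Hd _ zd; lra.
Qed.

Lemma derivable_cont (T : C -> C) (z : C) : derivable T z 1 -> {for z, continuous T}.
Proof. by move=> /derivable_is_derive[l]; exact: is_derive_cont. Qed.

End Derive.

Lemma near_near (T : topologicalType) (p : T) (Q : set T) :
  (\forall x \near p, Q x) -> \forall x \near p, \forall y \near x, Q y.
Proof.
exact: nbhs_interior.
Qed.

Lemma open_near (T : topologicalType) (U : set T) (p : T) : open U -> U p ->
  \forall x \near p, U x.
Proof. by move=> oU Up; apply: open_nbhs_nbhs. Qed.

Lemma nbhs_and (T : topologicalType) (p : T) (A B : set T) :
  nbhs p A -> nbhs p B -> nbhs p (A `&` B).
Proof. exact: filterI. Qed.

Section Form.
Variables (R : realType) (X : flat_surface R).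
Local Notation C := (CC R).
Local Notation S := (realization X).
Local Notation I := 'I_(nv X).
Implicit Types (x y p : S) (t : {set I}) (u v w : I).
Variable dz : one_form X.
Hypothesis Hdz : compatible_form dz.

Let dz_derivable U (w : S -> C) p : complex_chart U w -> U p ->
  derivable (dz U w : C -> C) (w p) 1.
Proof. by move=> h Up; apply: (proj1 (proj1 Hdz)). Qed.

Let dz_change (U : set S) (w : S -> C) (U' : set S) (w' : S -> C) p (T : C -> C) (l : C) : complex_chart U w ->
  complex_chart U' w' -> U p -> U' p -> (\forall x \near p, w' x = T (w x)) ->
  is_derive (w p) 1 T l -> dz U w (w p) = dz U' w' (w' p) * l.
Proof. exact: (proj2 (proj1 Hdz)). Qed.

Lemma complex_chart_embedding (U : set S) (w : S -> C) : complex_chart U w -> open_embedding U w.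
Proof. by case=> [[]//|[p [n [_ _ _ []]]]]. Qed.

Lemma hinge_complex_chart u v w w' (P : I -> C) : hinge u v w w' -> placed 1 P u v w w' ->
  complex_chart (edge_star u v) (dev P).
Proof. by move=> h hP; left; exact: hinge_chart h hP. Qed.

Let locally_const u v w w' (P : I -> C) p : hinge u v w w' -> placed 1 P u v w w' ->
  edge_star u v p -> exists a, \forall x \near p, dz (edge_star u v) (dev P) (dev P x) = a.
Proof.
move=> h hP ps.
have ich := hinge_chart h hP.
have [|U' [phi [a [ic U'p ca]]]] := proj2 Hdz p; first by exists (edge_star u v), (dev P).
have [l [m [nl H]]] := isometric_unique h ltr01 hP ps (proj2 ic _ U'p).
exists (a * l).
have oU' : open U' by case: ic => -[].
apply: filterS (filterI (open_near oU' U'p)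
  (filterI (open_near (@open_edge_star _ _ u v) ps) (near_near H))) => x [U'x [xs Hx]].
rewrite -(ca x U'x); apply: (dz_change (T := fun z => l * z + m)) => //.
- by left.
- by left.
- exact: is_derive_linear.
Qed.

(** Locally constant by compatibility, and the kite is star-shaped around the
    midpoint of its edge. *)
Lemma form_const u v w w' (P : I -> C) : hinge u v w w' -> placed 1 P u v w w' ->
  exists a, forall x, edge_star u v x -> dz (edge_star u v) (dev P) (dev P x) = a.
Proof.
move=> h hP; have [uv _ p1 _] := h; have f1 := pos_face p1.
have [|m [[mu mv] Hm]] := exists_midpoint uv.
  by exists [set u; v; w]%SET; rewrite // !inE !eqxx orbT.
exists (dz (edge_star u v) (dev P) (dev P m)) => x xs.
have [xu xv] := xs; have [t tf xt] := point_face x.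
have ut := bary_pos_in xt xu; have vt := bary_pos_in xt xv.
have mt := Hm t ut vt.
pose Q s := dz (edge_star u v) (dev P) (dev P (mix x m s)) = dz (edge_star u v) (dev P) (dev P x).
suff : Q 1 by rewrite /Q (mix1 tf xt mt).
apply: (locally_constant_itv (a := 0) (b := 1)) => //; last by rewrite /Q (mix0 tf xt mt).
move=> c c01.
have cs : edge_star u v (mix x m c) by split; exact: (mix_pos tf).
have [a Ha] := locally_const h hP cs.
have [d d0 Hd] := proj1 (path_continuousP _) (mix_path tf xt mt) c c01 _ Ha.
exists d => // s s01 sc.
have Ec := nbhs_singleton Ha; rewrite /= in Ec.
have Es := Hd s s01 sc; rewrite /= in Es.
by rewrite /Q Es Ec.
Qed.

Definition form_value u v (P : I -> C) (a : C) :=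
  forall x, edge_star u v x -> dz (edge_star u v) (dev P) (dev P x) = a.

(** At the barycentre of the face the two placements differ by [z -> l z + m], and
    the coefficient of the form changes by the factor [l]; being affine, the
    identity extends to the whole face. *)
Lemma form_consistent t u v w w' P a u1 v1 w1 w1' Q b :
  hinge u v w w' -> placed 1 P u v w w' -> form_value u v P a ->
  hinge u1 v1 w1 w1' -> placed 1 Q u1 v1 w1 w1' -> form_value u1 v1 Q b ->
  t \in face X -> u \in t -> v \in t -> u1 \in t -> v1 \in t ->
  nm a = nm b /\ forall c d, c \in t -> d \in t -> a * (P d - P c) = b * (Q d - Q c).
Proof.
move=> h hP ha h1 hQ hb tf ut vt ut1 vt1.
have [p pE] := exists_barycenter tf.
have pt := barycenter_in_face pE.
have ps : edge_star u v p by split; rewrite pE ?ut ?vt divr_gt0.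
have ps1 : edge_star u1 v1 p by split; rewrite pE ?ut1 ?vt1 divr_gt0.
have [l [m [nl H]]] := isometric_unique h ltr01 hP ps (proj2 (hinge_chart h1 hQ) _ ps1).
have ab : a = b * l.
  rewrite -(ha p ps) -(hb p ps1).
  apply: (dz_change (T := fun z => l * z + m)) => //.
  - exact: hinge_complex_chart h hP.
  - exact: hinge_complex_chart h1 hQ.
  - exact: is_derive_linear.
split; first by rewrite ab nmM nl invr1 mulr1.
have E : forall c, c \in t -> b * Q c + 0 = a * P c + b * m.
  apply: (dev_face_ext tf pt (A := fun c => b * Q c + 0) (B := fun c => a * P c + b * m)).
  apply: filterS H => x xE _; rewrite !dev_affine xE ab; ring.
move=> c d ct dt; have := E c ct; have := E d dt; rewrite !addr0 => Ed Ec.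
by rewrite !mulrBr Ed Ec; ring.
Qed.

Definition edge_value u v (z : C) := exists w w' P a,
  [/\ hinge u v w w', placed 1 P u v w w', form_value u v P a & z = a * (P v - P u)].

(** The integral of the form along the edge from [u] to [v], and 0 if there is no
    such edge. *)
Definition edge_vector u v : C := xget 0 (edge_value u v).

Lemma edge_vectorE t u v w w' P a : hinge u v w w' -> placed 1 P u v w w' ->
  form_value u v P a -> t \in face X -> u \in t -> v \in t ->
  forall c d, c \in t -> d \in t -> edge_vector c d = a * (P d - P c).
Proof.
move=> h hP ha tf ut vt c d ct dt; rewrite /edge_vector.
have [<-|cd] := eqVneq c d.
  rewrite xgetPN ?subrr ?mulr0// => z [w1 [w1' [Q [b [[]]]]]]; by rewrite eqxx.
case: xgetP => [z -> [w1 [w1' [Q [b [h1 hQ hb ->]]]]]|none].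
  have [_ E] := form_consistent h hP ha h1 hQ hb tf ut vt ct dt; by rewrite E.
have [w1 [w1' h1]] := exists_hinge tf ct dt cd.
have [Q hQ] := placement_exists h1; have [b hb] := form_const h1 hQ.
by case: (none (b * (Q d - Q c))); exists w1, w1', Q, b.
Qed.

Lemma edge_vector_cocycle t (x y z : I) : t \in face X -> x \in t -> y \in t -> z \in t ->
  edge_vector x y + edge_vector y z = edge_vector x z.
Proof.
move=> tf xt yt zt.
have [u [v [ut vt uv]]] := face_two_vertices tf.
have [w [w' h]] := exists_hinge tf ut vt uv.
have [P hP] := placement_exists h; have [a ha] := form_const h hP.
rewrite !(edge_vectorE h hP ha tf ut vt)//; ring.
Qed.

Lemma edge_vector_dev u v w w' P a x : hinge u v w w' -> placed 1 P u v w w' ->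
  form_value u v P a -> edge_star u v x ->
  dev (edge_vector u) x = a * dev P x + (- (a * P u)).
Proof.
move=> h hP ha [xu xv]; rewrite -dev_affine; have [t tf xt] := point_face x.
apply: eq_bigr => c _; have [ct|ct] := boolP (c \in t); last first.
  by move/in_faceP/(_ _ ct): xt => ->; rewrite !mul0r.
have ut := bary_pos_in xt xu; have vt := bary_pos_in xt xv.
by rewrite (edge_vectorE h hP ha tf ut vt)//; congr (_ * _); ring.
Qed.

Let chart_change U (w : S -> C) p u v w1 w1' P a : complex_chart U w -> U p ->
  hinge u v w1 w1' -> placed 1 P u v w1 w1' -> form_value u v P a -> edge_star u v p ->
  exists T l, [/\ \forall x \near p, dev P x = T (w x), is_derive (w p) 1 T l &
                 dz U w (w p) = a * l].
Proof.
move=> cw Up h hP ha ps.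
(* [n] is 1 in an isometric chart and the multiplicity of the cone in a cone
    chart *)
suff [l [m [n [l0 E]]]] : exists l m n, l != 0 /\ \forall x \near p, w x ^+ n = l * dev P x + m.
  exists (fun z => l^-1 * z ^+ n + (- (l^-1 * m))), (l^-1 * (n%:R * w p ^+ n.-1)).
  have E2 : \forall x \near p, dev P x = l^-1 * w x ^+ n + (- (l^-1 * m)).
    by apply: filterS E => x ->; field.
  split; [exact: E2|exact: is_derive_power|].
  rewrite -(ha p ps); exact: (dz_change cw (hinge_complex_chart h hP) Up ps
    (T := fun z => l^-1 * z ^+ n + (- (l^-1 * m))) E2 (is_derive_power _ _ _ _)).
case: cw => [[_ iso]|[q [n [vq Uq n0 _ iso]]]].
  have [l [m [nl E]]] := isometric_unique h ltr01 hP ps (iso _ Up).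
  exists l, m, 1%N; split; first by rewrite -nm_eq0 nl invr1 oner_eq0.
  by apply: filterS E => x <-.
have pq : p <> q.
  by move=> e; rewrite e in ps; case: h => uv _ _ _; exact: (edge_star_not_vertex uv ps).
have [l [m [nl E]]] := isometric_unique h ltr01 hP ps (iso _ Up pq).
by exists l, m, n; split=> //; rewrite -nm_eq0 nl invr1 oner_eq0.
Qed.

Let normal_form_nonvertex U (w : S -> C) p u : complex_chart U w -> U p ->
  ~ is_vertex p -> 0 < bary p u ->
  exists T, (\forall x \near p, dev (edge_vector u) x = T (w x)) /\
            is_derive (w p) 1 T (dz U w (w p)).
Proof.
move=> cw Up np pu; have [v [w1 [w1' [h ps]]]] := nonvertex_hinge np pu.
have [P hP] := placement_exists h; have [a ha] := form_const h hP.
have [T [l [E D ->]]] := chart_change cw Up h hP ha ps.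
exists (fun z => a * T z + (- (a * P u))); split.
  apply: filterS (filterI E (open_near (@open_edge_star _ _ u v) ps)) => x [xE xs].
  by rewrite (edge_vector_dev h hP ha xs) xE.
have h2 := is_deriveZ a D.
have h3 := is_deriveD h2 (is_derive_cst (- (a * P u)) (w p) 1).
by rewrite addr0 in h3.
Qed.

(** The map [dev (edge_vector u)] is a primitive of the form in every complex chart
    [w]. Off the vertices this is a change of charts; at a vertex, where [w] is a
    root of a flat coordinate, it is a removable singularity. *)
Lemma normal_form U (w : S -> C) p u : complex_chart U w -> U p -> 0 < bary p u ->
  exists T, (\forall x \near p, dev (edge_vector u) x = T (w x)) /\
            \forall x \near p, is_derive (w x) 1 T (dz U w (w x)).
Proof.
move=> cw Up pu; have oe := complex_chart_embedding cw; have [oU iU _ _] := oe.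
pose T z := dev (edge_vector u) (xget p [set x | U x /\ w x = z]).
have TE x : U x -> T (w x) = dev (edge_vector u) x.
  move=> Ux; rewrite /T; congr dev; case: xgetP => [y _ [Uy e]|/(_ x)]; last by case.
  by apply: iU => //; apply: mem_set.
exists T; split; first by apply: filterS (open_near oU Up) => x /TE.
have DT x : U x -> 0 < bary x u -> ~ is_vertex x -> is_derive (w x) 1 T (dz U w (w x)).
  move=> Ux xu nx; have [T1 [E1 D1]] := normal_form_nonvertex cw Ux nx xu.
  apply: is_derive_near D1.
  have [r r0 Hr] := open_embedding_disc oe Ux E1.
  by apply/nbhs_CP; exists r => // z /Hr[y [Uy yE <-]]; rewrite TE.
apply: filterS (filterI (open_near oU Up) (near_star pu)) => x [Ux xu].
have [vx|] := pselect (is_vertex x); last exact: DT.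
have xu1 : forall y, is_vertex y -> 0 < bary y u -> y = x.
  by move=> y vy yu; apply: bary_inj => v; rewrite (vertex_bary vy yu) (vertex_bary vx xu).
have [r r0 Hr] := open_embedding_disc oe Ux (near_star xu).
apply: (derive_punctured r0).
- move=> A; rewrite TE// => /(dev_continuous (e := edge_vector u)) nA.
  have [r1 r10 Hr1] := open_embedding_disc oe Ux nA.
  by apply/nbhs_CP; exists r1 => // z /Hr1[y [Uy Ay <-]]; rewrite /= TE.
- exact/derivable_cont/dz_derivable.
move=> z zx /Hr[y [Uy yu yz]]; rewrite -yz; apply: DT => // vy.
by move: zx; rewrite -yz (xu1 y)// eqxx.
Qed.

Lemma near_nonvertex_mix p (N : set S) : nbhs p N ->
  exists q t, [/\ t \in face X, in_face t (val p), in_face t (val q), ~ is_vertex q &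
                  forall s, 0 <= s <= 1 -> N (mix p q s)].
Proof.
move=> /nbhs_SP[r r0 H]; have [t tf pt] := point_face p.
have [b bE] := exists_barycenter tf; have bt := barycenter_in_face bE.
pose s := Num.min (r / 2) 1.
have s0 : 0 < s by rewrite lt_min ltr01 andbT divr_gt0.
have s01 : 0 <= s <= 1 by rewrite (ltW s0) ge_min lexx orbT.
have sr : s < r by rewrite gt_min; apply/orP; left; lra.
have qt := mix_in_face tf pt bt s01.
exists (mix p b s), t; split=> //.
  have [u [v [ut vt uv]]] := face_two_vertices tf.
  have pos_ a : a \in t -> 0 < bary (mix p b s) a.
    move=> at_; have b0 : 0 < bary b a by rewrite bE at_ divr_gt0.
    have /andP[_ s1] := s01.
    by rewrite (mixE tf)// ltr_wpDl ?mulr_gt0// mulr_ge0 ?bary_ge0// subr_ge0.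
  apply: (edge_star_not_vertex uv); split; exact: pos_.
move=> c /andP[c0 c1]; apply: H => v; rewrite !(mixE tf)//; last by rewrite c0.
have -> : (1 - c) * bary p v + c * ((1 - s) * bary p v + s * bary b v) - bary p v =
  c * (s * (bary b v - bary p v)) by ring.
rewrite !normrM ger0_norm// gtr0_norm//; apply: (@le_lt_trans _ _ s) => //.
apply: (@le_trans _ _ (1 * (s * `|bary b v - bary p v|))).
  by rewrite ler_wpM2r// mulr_ge0// ltW.
rewrite mul1r ger_pMr// ler_norml.
by have := bary_ge0 p v; have := bary_ge0 b v; have := bary_le1 p v; have := bary_le1 b v; lra.
Qed.

Lemma near_nonvertex p (N : set S) : nbhs p N -> exists2 q, N q & ~ is_vertex q.
Proof.
move=> /near_nonvertex_mix[q [t [tf pt qt nq H]]]; exists q => //.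
by rewrite -(mix1 tf pt qt); apply: H; rewrite ler01 lexx.
Qed.

Hypothesis Hconn : connected [set: S].
Hypothesis Hnz : nonzero_form dz.

(** The modulus of the form is the same in two faces with a common edge, and
    [face_connected] propagates it. It is not 0, as the form is nonzero at some
    point and then at nearby points that are not vertices. *)
Lemma form_scale : exists2 k : R, 0 < k &
  forall u v w w' P a, hinge u v w w' -> placed 1 P u v w w' -> form_value u v P a -> nm a = k.
Proof.
have [U [w [p0 [cw Up0 nz]]]] := Hnz.
have oU : open U by case: (complex_chart_embedding cw).
have wc : {for p0, continuous w} by case: (complex_chart_embedding cw) => _ _ h _; exact: h.
have dc : {for w p0, continuous (dz U w)} by exact/derivable_cont/dz_derivable.
have N1 : \forall x \near p0, dz U w (w x) != 0.
  have : \forall z \near w p0, dz U w z != 0.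
    have n0 : 0 < nm (dz U w (w p0)) by rewrite nm_gt0; exact/eqP.
    have H : \forall z \near w p0, nm (dz U w z - dz U w (w p0)) < nm (dz U w (w p0)).
      exact: (dc _ (near_disc _ n0)).
    apply: filterS H => z.
    by move=> h; apply/eqP => e; move: h; rewrite e sub0r nmN ltxx.
  exact: wc.
have [p [Up /eqP nzp] np] := near_nonvertex (filterI (open_near oU Up0) N1).
have [u0 [v0 [w0 [w0' [h0 ps0]]]]] := nonvertex_edge np.
have [P0 hP0] := placement_exists h0; have [a0 ha0] := form_const h0 hP0.
have [T [l [_ _ E]]] := chart_change cw Up h0 hP0 ha0 ps0.
exists (nm a0).
  by rewrite nm_gt0; apply/eqP => e; apply: nzp; rewrite E e mul0r.
pose Q t := forall u v w w' P a, u \in t -> v \in t -> hinge u v w w' ->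
  placed 1 P u v w w' -> form_value u v P a -> nm a = nm a0.
have HQ : forall s t, s \in face X -> t \in face X -> #|s :&: t| = 2%N -> Q s -> Q t.
  move=> s t sf tf st Qs u v w1 w1' P a ut vt h hP ha.
  have /eqP/cards2P[x [y [xy xyE]]] := st.
  have : x \in s :&: t by rewrite xyE !inE eqxx.
  have : y \in s :&: t by rewrite xyE !inE eqxx orbT.
  rewrite !inE => /andP[ys yt] /andP[xs xt].
  have [z [z' h1]] := exists_hinge sf xs ys xy.
  have [P1 hP1] := placement_exists h1; have [a1 ha1] := form_const h1 hP1.
  rewrite -(Qs _ _ _ _ _ _ xs ys h1 hP1 ha1).
  by have [] := form_consistent h hP ha h1 hP1 ha1 tf ut vt xt yt.
have [_ _ p1 _] := h0; have f0 := pos_face p1.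
have Q0 : Q [set u0; v0; w0]%SET.
  move=> u v w1 w1' P a ut vt h hP ha.
  have [] := form_consistent h hP ha h0 hP0 ha0 f0 ut vt => //; by rewrite !inE eqxx ?orbT.
move=> u v w1 w1' P a h hP ha; have [_ _ p2 _] := h.
have Qt := face_connected Hconn HQ f0 (pos_face p2) Q0.
by apply: (Qt u v w1 w1' P a) => //; rewrite !inE eqxx ?orbT.
Qed.

End Form.

(** The vector [e u v] stands for the integral of [dz] along the edge from [u] to
    [v], so that [dev (e u)] develops the star of [u] in the plane; [k] is the
    modulus of [dz] in isometric charts. *)
Record development (R : realType) (X : flat_surface R) (dz : one_form X)
    (e : 'I_(nv X) -> 'I_(nv X) -> CC R) (k : R) : Prop := Development {
  dev_scale : 0 < k;
  dev_cocycle : forall t x y z, t \in face X -> x \in t -> y \in t -> z \in t ->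
    e x y + e y z = e x z;
  dev_placed : forall u v w w', hinge u v w w' -> placed k (e u) u v w w';
  dev_primitive : forall U w p u, complex_chart U w -> U p -> 0 < bary p u ->
    exists T, (\forall x \near p, dev (e u) x = T (w x)) /\
              \forall x \near p, is_derive (w x) 1 T (dz U w (w x)) }.

Lemma development_exists (R : realType) (X : flat_surface R) (dz : one_form X) :
  connected [set: realization X] -> compatible_form dz -> nonzero_form dz ->
  exists e k, development dz e k.
Proof.
move=> hc hz hn; have [k k0 hk] := form_scale hz hc hn.
exists (edge_vector dz), k; split=> //.
- exact: edge_vector_cocycle.
- move=> u v w w' h; have [P hP] := placement_exists h; have [a ha] := form_const hz h hP.
  have ak := hk _ _ _ _ _ _ h hP ha.
  have [uv ww' p1 p2] := h; have f1 := pos_face p1; have f2 := pos_face p2.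
  have [h1 h2 h3] := hP.
  have a0 : a != 0 by rewrite -nm_eq0 ak gt_eqF.
  have E t b : t \in face X -> u \in t -> v \in t -> b \in t ->
      edge_vector dz u b = a * P b - a * P u.
    by move=> tf ut vt bt; rewrite (edge_vectorE hz h hP ha tf ut vt)// mulrBr.
  split.
  + move=> t b c tf ut vt bt ct bc; rewrite !(E t)//.
    have -> : a * P b - a * P u - (a * P c - a * P u) = a * (P b - P c) by ring.
    by rewrite nmM ak (h1 t)// mul1r.
  + by rewrite !(E _ _ f1) ?inE ?eqxx ?orbT//; exact: ccw_affine.
  + by rewrite !(E _ _ f2) ?inE ?eqxx ?orbT//; exact: ccw_affine.
- by move=> U w p u; exact: normal_form.
Qed.

(** * Lattices and tori *)

Section Lattice.
Variables (R : realType) (w1 w2 : CC R).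
Local Notation C := (CC R).
Local Notation Gamma := (lattice w1 w2).
Local Notation T := (torus w1 w2).
Local Notation proj := (@torus_proj R w1 w2).

Lemma latticeN z : Gamma z -> Gamma (- z).
Proof. by move=> [m [n ->]]; exists (- m), (- n); rewrite !mulrNz -opprD. Qed.

Lemma latticeD z z' : Gamma z -> Gamma z' -> Gamma (z + z').
Proof.
by move=> [m [n ->]] [m' [n' ->]]; exists (m + m'), (n + n'); rewrite !mulrzDr addrACA.
Qed.

Lemma latticeB z z' : Gamma z -> Gamma z' -> Gamma (z - z').
Proof. by move=> h /latticeN; exact: latticeD. Qed.

Lemma projP z z' : proj z = proj z' <-> Gamma (z - z').
Proof.
split=> [/eqquotP/asboolP//|h].
by apply/eqquotP/asboolP.
Qed.

Lemma proj_surj (y : T) : exists z, proj z = y.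
Proof. by exists (repr y)%qT; rewrite /torus_proj reprK. Qed.

Lemma torus_proj_continuous : continuous proj.
Proof. exact: pi_continuous. Qed.

Lemma proj_open_map (A : set C) : open A -> open (proj @` A).
Proof.
move=> oA; have -> : open (proj @` A) = open (proj @^-1` (proj @` A)) by [].
apply/open_CP => z [z0 Az0 /esym/projP g].
have [r r0 H] := proj1 (open_CP _) oA z0 Az0.
exists r => // z' zz'; exists (z' - (z - z0)).
  apply: H; have -> // : z' - (z - z0) - z0 = z' - z by ring.
by apply/projP; have -> : z' - (z - z0) - z' = - (z - z0); [ring|exact: latticeN].
Qed.

Hypothesis indep : independent w1 w2.

Definition cross (z w : C) : R := complex.Re z * complex.Im w - complex.Im z * complex.Re w.

Lemma cross_le z w : `|cross z w| <= 2 * nm z * nm w.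
Proof.
apply: le_trans (ler_normB _ _) _; rewrite !normrM.
have := Re_le z; have := Im_le z; have := Re_le w; have := Im_le w.
have := normr_ge0 (complex.Re z); have := normr_ge0 (complex.Re w).
have := normr_ge0 (complex.Im z); have := normr_ge0 (complex.Im w).
by move=> ? ? ? ? ? ? ? ?; nra.
Qed.

Lemma cross_neq0 : cross w1 w2 != 0.
Proof.
apply/eqP => D0.
have Z : (complex.Im w2)%:C%C * w1 + (- complex.Im w1)%:C%C * w2 = 0.
  move: D0; rewrite /cross; case: w1 => a b; case: w2 => c d /= h.
  apply/eqP; rewrite eq_complex /=; apply/andP; split; apply/eqP; last by ring.
  by rewrite -[RHS]h; ring.
have [i2 /eqP] := indep Z; rewrite oppr_eq0 => /eqP i1.
have Z' : (complex.Re w2)%:C%C * w1 + (- complex.Re w1)%:C%C * w2 = 0.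
  move: i1 i2; case: w1 => a b; case: w2 => c d /= -> ->.
  by apply/eqP; rewrite eq_complex /=; apply/andP; split; apply/eqP; ring.
have [r2 _] := indep Z'.
have w20 : w2 = 0 by move: i2 r2; case: w2 => c d /= -> ->.
have : (0 : R)%:C%C * w1 + (1 : R)%:C%C * w2 = 0 by rewrite w20 mulr0 mul0r addr0.
by move=> /indep[_ /eqP]; rewrite oner_eq0.
Qed.

(** Cramer's rule; [cross] is the determinant. *)
Lemma independent_coord : exists2 L : R, 0 < L &
  forall a b : R, `|a| <= L * nm (a%:C%C * w1 + b%:C%C * w2) /\
                  `|b| <= L * nm (a%:C%C * w1 + b%:C%C * w2).
Proof.
have D0 : 0 < `|cross w1 w2| by rewrite normr_gt0 cross_neq0.
pose L := (2 * nm w2 + 2 * nm w1 + 1) / `|cross w1 w2|.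
have n1 := nm_ge0 w1; have n2 := nm_ge0 w2.
exists L; first by rewrite divr_gt0//; lra.
move=> a b; set z := _ + _.
have nz := nm_ge0 z.
have EL : L * nm z = (2 * nm w2 + 2 * nm w1 + 1) * nm z / `|cross w1 w2| by rewrite /L mulrAC.
have E1 : cross z w2 = a * cross w1 w2.
  by rewrite /z /cross; case: w1 => p q; case: w2 => p' q' /=; ring.
have E2 : cross w1 z = b * cross w1 w2.
  by rewrite /z /cross; case: w1 => p q; case: w2 => p' q' /=; ring.
split.
  have := cross_le z w2; rewrite E1 normrM -ler_pdivlMr// => /le_trans; apply.
  by rewrite EL ler_pM2r ?invr_gt0//; nra.
have := cross_le w1 z; rewrite E2 normrM -ler_pdivlMr// => /le_trans; apply.
by rewrite EL ler_pM2r ?invr_gt0//; nra.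
Qed.

Lemma independent_span z : exists a b : R, z = a%:C%C * w1 + b%:C%C * w2.
Proof.
have D0 := cross_neq0.
exists (cross z w2 / cross w1 w2), (cross w1 z / cross w1 w2).
move: D0; rewrite /cross; case: w1 => p q; case: w2 => p' q'; case: z => x y /= D0.
by apply/eqP; rewrite eq_complex /=; apply/andP; split; apply/eqP; field.
Qed.

Lemma mulrz_complex (z : C) (m : int) : z *~ m = (m%:~R : R)%:C%C * z.
Proof. by rewrite rmorph_int mulrzl. Qed.

Lemma lattice_coord (a b : R) : Gamma (a%:C%C * w1 + b%:C%C * w2) ->
  exists m n : int, a = m%:~R /\ b = n%:~R.
Proof.
move=> [m [n]]; rewrite !mulrz_complex => E; exists m, n.
have : (a - m%:~R)%:C%C * w1 + (b - n%:~R)%:C%C * w2 = 0.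
  by rewrite !rmorphB /= !mulrBl addrACA E -opprD subrr.
by move=> /indep[/eqP + /eqP]; rewrite !subr_eq0 => /eqP -> /eqP ->.
Qed.

Lemma lattice_gap : exists2 d : R, 0 < d & forall z, Gamma z -> nm z < d -> z = 0.
Proof.
have [L L0 H] := independent_coord; exists L^-1; first by rewrite invr_gt0.
move=> _ [m [n ->]]; rewrite !mulrz_complex => hz.
have [h1 h2] := H m%:~R n%:~R.
have small (i : int) : `|i%:~R : R| < 1 -> i = 0.
  by rewrite -intr_norm -[ltRHS]/(1%:~R) ltr_int => h; lia.
have L1 : L * nm ((m%:~R : R)%:C%C * w1 + (n%:~R : R)%:C%C * w2) < 1.
  by rewrite mulrC -ltr_pdivlMr// mul1r.
have m0 : m = 0 by apply: small; exact: le_lt_trans h1 L1.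
have n0 : n = 0 by apply: small; exact: le_lt_trans h2 L1.
by rewrite m0 n0 !mulr0z !mul0r addr0.
Qed.

Lemma lattice_finite (r : R) : exists s : seq C, forall z, Gamma z -> nm z < r -> z \in s.
Proof.
have [L L0 H] := independent_coord.
pose N := Num.bound (L * `|r|).
have hN : L * `|r| < N%:R by rewrite archi_boundP// mulr_ge0// ltW.
pose ints : seq int := [seq (i%:Z - N%:Z) | i <- iota 0 (N + N).+1].
exists [seq w1 *~ m + w2 *~ n | m <- ints, n <- ints].
move=> _ [m [n ->]]; rewrite !mulrz_complex => hz.
have [h1 h2] := H m%:~R n%:~R.
have small (i : int) : `|i%:~R : R| <= L * nm ((m%:~R : R)%:C%C * w1 + (n%:~R : R)%:C%C * w2) ->
    i \in ints.
  move=> h; have hi : `|i%:~R : R| < N%:R.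
    apply: le_lt_trans h _; apply: le_lt_trans hN; rewrite ler_pM2l//.
    by apply/ltW/(lt_le_trans hz); exact: ler_norm.
  move: hi; rewrite -intr_norm -[ltRHS]/(N%:Z%:~R) ltr_int => hi.
  apply/mapP; exists (absz (i + N%:Z)); last lia.
  rewrite mem_iota; lia.
rewrite -!mulrz_complex; apply/allpairsP; exists (m, n); split=> //=; exact: small.
Qed.

(** At most one lattice point is nearer to [z] than half the gap. *)
Lemma lattice_closed z : ~ Gamma z -> exists2 d : R, 0 < d & forall y, Gamma y -> d <= nm (z - y).
Proof.
move=> nz; have [d d0 Hd] := lattice_gap.
have [[y [Gy yz]]|none] := pselect (exists y, Gamma y /\ nm (z - y) < d / 2); last first.
  exists (d / 2); first by rewrite divr_gt0.
  move=> y Gy; rewrite leNgt; apply/negP => h; apply: none; by exists y.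
have zy0 : 0 < nm (z - y).
  by rewrite nm_gt0 subr_eq0; apply/eqP => e; apply: nz; rewrite e.
exists (nm (z - y)) => // y' Gy'; rewrite leNgt; apply/negP => h.
have : y - y' = 0.
  apply: Hd; first exact: latticeB.
  by have := nmBD z y y'; rewrite (nmBC y z); lra.
by move/eqP; rewrite subr_eq0 => /eqP e; rewrite e ltxx in h.
Qed.

Lemma proj_disc_inj (d : R) c z z' : (forall y, Gamma y -> nm y < d -> y = 0) ->
  nm (z - c) < d / 2 -> nm (z' - c) < d / 2 -> proj z = proj z' -> z = z'.
Proof.
move=> Hd h h' /projP g; apply/eqP; rewrite -subr_eq0; apply/eqP/Hd => //.
by have := nmBD c z z'; rewrite (nmBC c z'); lra.
Qed.

Lemma torus_chart_exists z0 : exists W (s : T -> C),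
  [/\ torus_chart W s, W (proj z0) & s (proj z0) = z0].
Proof.
have [d d0 Hd] := lattice_gap.
pose B := [set z : C | nm (z - z0) < d / 2].
have oB : open B by exact: open_disc.
have d2 : 0 < d / 2 by rewrite divr_gt0.
have Bz0 : B z0 by rewrite /B /= subrr nm0.
pose s (a : T) : C := xget z0 [set z | B z /\ proj z = a].
have sE z : B z -> s (proj z) = z.
  move=> Bz; rewrite /s; case: xgetP => [y _ [By e]|/(_ z)]; last by case.
  exact: (proj_disc_inj Hd By Bz).
exists (proj @` B), s; split; [|by exists z0|exact: sE].
split; last by move=> _ [z Bz <-]; rewrite sE.
split.
- exact: proj_open_map.
- by move=> a b /set_mem[z Bz <-] /set_mem[z' Bz' <-]; rewrite !sE// => ->.
- move=> _ [z Bz <-] A; rewrite sE// => /nbhs_CP[r r0 HA].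
  pose D := B `&` [set z' | nm (z' - z) < r].
  have oD : open D by apply: openI => //; exact: open_disc.
  have nD : nbhs (proj z) (proj @` D).
    apply: open_nbhs_nbhs; split; first exact: proj_open_map.
    by exists z => //; split=> //=; rewrite subrr nm0.
  by apply: filterS nD => _ [y [By yr] <-]; rewrite /= sE//; exact: HA.
move=> V oV VW.
have -> : s @` V = B `&` proj @^-1` V.
  apply/seteqP; split=> [_ [a Va <-]|z [Bz Vz]].
    by have [z Bz za] := VW _ Va; rewrite -za sE//; split=> //=; rewrite za.
  by exists (proj z) => //; exact: sE.
by apply: openI.
Qed.

(** Both sides lift [f], so they differ by a lattice vector, and this vector varies
    continuously. *)
Lemma torus_chart_local W (s : T -> C) (Y : topologicalType) (f : Y -> T) (L : Y -> C) p :
  torus_chart W s -> {for p, continuous f} -> {for p, continuous L} -> W (f p) ->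
  (\forall x \near p, f x = proj (L x)) ->
  \forall x \near p, s (f x) = L x + (s (f p) - L p).
Proof.
move=> [[oW _ sc _] sK] fc Lc Wp fL.
have [d d0 Hd] := lattice_gap.
have d2 : 0 < d / 2 by rewrite divr_gt0.
have Wx : \forall x \near p, W (f x) by apply: fc; exact: open_nbhs_nbhs.
have sx : \forall x \near p, nm (s (f x) - s (f p)) < d / 2.
  exact: (fc _ (sc _ Wp _ (near_disc _ d2))).
have Lx : \forall x \near p, nm (L x - L p) < d / 2 by exact: (Lc _ (near_disc _ d2)).
have fLp := nbhs_singleton fL.
have FF : Filter (nbhs p) by exact: nbhs_filter.
near=> x.
have Wfx : W (f x) by near: x.
have fLx : f x = proj (L x) by near: x.
have h1 : nm (s (f x) - s (f p)) < d / 2 by near: x.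
have h2 : nm (L x - L p) < d / 2 by near: x.
have g1 : Gamma (s (f x) - L x) by apply/projP; rewrite sK.
have g2 : Gamma (s (f p) - L p) by apply/projP; rewrite sK.
have : (s (f x) - L x) - (s (f p) - L p) = 0.
  apply: Hd; first exact: latticeB.
  have -> : s (f x) - L x - (s (f p) - L p) = (s (f x) - s (f p)) - (L x - L p) by ring.
  by apply: le_lt_trans (nmD _ _) _; rewrite nmN; lra.
by move/eqP; rewrite subr_eq0 => /eqP <-; ring.
Unshelve. all: by end_near. Qed.

(** Changing the lifts changes their difference by a lattice vector, and a nonzero
    one makes it longer. *)
Lemma torus_dist_local (k : R) (d : R) z z' : 0 < k ->
  (forall y, Gamma y -> nm y < d -> y = 0) -> nm (z - z') < d / 2 ->
  torus_dist k (proj z) (proj z') = k * nm (z - z').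
Proof.
move=> k0 Hd zz'; apply/le_anti/andP; split.
  apply: ge_inf; last by exists z, z'.
  by exists 0 => _ [y [y' [_ _ ->]]]; rewrite mulr_ge0 ?nm_ge0// ltW.
apply: lb_le_inf; first by exists (k * nm (z - z')), z, z'.
move=> _ [y [y' [/projP gy /projP gy' ->]]]; rewrite ler_pM2l//.
have g : Gamma ((y - y') - (z - z')).
  have -> : (y - y') - (z - z') = (y - z) - (y' - z') by ring.
  exact: latticeB.
rewrite leNgt; apply/negP => h.
have : (y - y') - (z - z') = 0.
  by apply: Hd => //; apply: le_lt_trans (nmD _ _) _; rewrite nmN; lra.
by move/eqP; rewrite subr_eq0 => /eqP e; rewrite e ltxx in h.
Qed.

End Lattice.

(** * Integrals along paths *)

Section Paths.
Variables (R : realType) (X : flat_surface R) (dz : one_form X).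
Local Notation C := (CC R).
Local Notation S := (realization X).
Local Notation I := 'I_(nv X).
Implicit Types (x y p : S) (t : {set I}) (u v w : I).

Definition travels x y (z : C) := exists g : R -> S,
  [/\ {within `[0, 1], continuous g}, g 0 = x, g 1 = y & path_integral dz g z].

Lemma travels_closed x z : travels x x z -> exists g, closed_path g /\ path_integral dz g z.
Proof. by move=> [g [gc g0 g1 gi]]; exists g; split=> //; split=> //; rewrite g0 g1. Qed.

Lemma closed_travels g z : closed_path g -> path_integral dz g z -> travels (g 0) (g 0) z.
Proof. by move=> [gc g01] gi; exists g; rewrite g01. Qed.

Lemma travels_chart (U : set S) (w : S -> C) (F : C -> C) t x y :
  complex_chart U w -> (forall q, U q -> is_derive (w q) 1 F (dz U w (w q))) ->
  t \in face X -> in_face t (val x) -> in_face t (val y) ->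
  (forall s, 0 <= s <= 1 -> U (mix x y s)) ->
  travels x y (F (w y) - F (w x)).
Proof.
move=> cw HF tf xt yt Us; exists (mix x y); split.
- exact: (mix_path tf).
- exact: (mix0 tf).
- exact: (mix1 tf).
exists 1%N, (fun i => i%:R), (fun=> U), (fun=> w), (fun=> F); split.
- by split=> // i _; rewrite ltr_nat.
- move=> i; rewrite ltnS leqn0 => /eqP -> /=; split=> // s s01; exact: Us.
- by move=> i q _; exact: HF.
- by rewrite big_ord1 /= (mix0 tf)// (mix1 tf).
Qed.

Lemma subdivision_mono n (tau : nat -> R) : subdivision n tau ->
  forall i j, (i <= j)%N -> (j <= n)%N -> tau i <= tau j.
Proof.
move=> [_ _ H] i; elim=> [|j IH]; first by rewrite leqn0 => /eqP ->.
rewrite leq_eqVlt => /orP[/eqP ->//|ij] jn.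
by apply: le_trans (IH ij (ltnW jn)) _; exact/ltW/H.
Qed.

Lemma subdivision_in n (tau : nat -> R) i : subdivision n tau -> (i <= n)%N -> 0 <= tau i <= 1.
Proof.
move=> st i_n; have [s0 s1 _] := st.
by rewrite -s0 -s1 !(subdivision_mono st).
Qed.

(** Run through both paths at double speed. *)
Lemma travels_cat x y p z z' : travels x y z -> travels y p z' -> travels x p (z + z').
Proof.
move=> [g1 [c1 g10 g11 [n1 [t1 [U1 [w1 [F1 [st1 H1 D1 E1]]]]]]]].
move=> [g2 [c2 g20 g21 [n2 [t2 [U2 [w2 [F2 [st2 H2 D2 E2]]]]]]]].
have [s10 s11 s1m] := st1; have [s20 s21 s2m] := st2.
pose g s := if s <= 1 / 2 then g1 (2 * s) else g2 (2 * s - 1).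
have gl s : s <= 1 / 2 -> g s = g1 (2 * s) by move=> h; rewrite /g h.
have gr s : 1 / 2 <= s -> g s = g2 (2 * s - 1).
  rewrite le_eqVlt => /orP[/eqP <-|h]; last by rewrite /g leNgt h.
  rewrite gl// (_ : 2 * (1 / 2) = 1); last by field.
  by rewrite subrr g11 g20.
exists g; split.
- apply/path_continuousP => c c01 A nA.
  have L : c <= 1 / 2 -> exists2 d : R, 0 < d & forall s, 0 <= s -> s <= 1 / 2 -> `|s - c| < d -> A (g s).
    move=> c2'; rewrite gl// in nA.
    have [|d d0 Hd] := proj1 (path_continuousP _) c1 (2 * c) _ _ nA; first by move/andP: c01; lra.
    exists (d / 2); first by rewrite divr_gt0.
    move=> s s0 s2 sc; rewrite gl//; apply: Hd; first lra.
    by rewrite -mulrBr normrM ger0_norm//; lra.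
  have Rr : 1 / 2 <= c -> exists2 d : R, 0 < d & forall s, 1 / 2 <= s -> s <= 1 -> `|s - c| < d -> A (g s).
    move=> c2'; rewrite gr// in nA.
    have [|d d0 Hd] := proj1 (path_continuousP _) c2 (2 * c - 1) _ _ nA; first by move/andP: c01; lra.
    exists (d / 2); first by rewrite divr_gt0.
    move=> s s0 s2 sc; rewrite gr//; apply: Hd; first lra.
    have -> : 2 * s - 1 - (2 * c - 1) = 2 * (s - c) by ring.
    by rewrite normrM ger0_norm//; lra.
  have [ch|ch|ch] := ltgtP c (1 / 2).
  + have [d d0 Hd] := L (ltW ch); exists (Num.min d (1 / 2 - c)); first by rewrite lt_min d0 subr_gt0.
    move=> s /andP[s0 s1]; rewrite lt_min => /andP[sd sc]; apply: Hd => //.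
    by have := ler_norm (s - c); lra.
  + have [d d0 Hd] := Rr (ltW ch); exists (Num.min d (c - 1 / 2)); first by rewrite lt_min d0 subr_gt0.
    move=> s /andP[s0 s1]; rewrite lt_min => /andP[sd sc]; apply: Hd => //.
    by have := ler_norm (c - s); rewrite distrC; lra.
  + have [|d d0 Hd] := L; first by rewrite ch.
    have [|d' d'0 Hd'] := Rr; first by rewrite ch.
    exists (Num.min d d'); first by rewrite lt_min d0.
    move=> s /andP[s0 s1]; rewrite lt_min => /andP[sd sd'].
    by have [h|/ltW h] := leP s (1 / 2); [exact: Hd|exact: Hd'].
- by rewrite gl ?mulr0// divr_ge0.
- have -> : g 1 = g2 (2 * 1 - 1) by apply: gr; lra.
  by have -> : 2 * 1 - 1 = 1 :> R by ring.
exists (n1 + n2)%N.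
pose tau i := if (i <= n1)%N then t1 i / 2 else (1 + t2 (i - n1)%N) / 2.
have tr i : (n1 <= i)%N -> tau i = (1 + t2 (i - n1)%N) / 2.
  rewrite leq_eqVlt => /orP[/eqP <-|h]; last by rewrite /tau leqNgt h.
  by rewrite /tau leqnn subnn s20 s11 addr0.
have tl i : (i <= n1)%N -> tau i = t1 i / 2 by move=> h; rewrite /tau h.
have in1 i : (i <= n1)%N -> 0 <= t1 i <= 1 by exact: subdivision_in.
have in2 i : (i <= n2)%N -> 0 <= t2 i <= 1 by exact: subdivision_in.
exists tau, (fun i => if (i < n1)%N then U1 i else U2 (i - n1)%N),
  (fun i => if (i < n1)%N then w1 i else w2 (i - n1)%N),
  (fun i => if (i < n1)%N then F1 i else F2 (i - n1)%N); split.
- split.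
  + by rewrite tl// s10 mul0r.
  + by rewrite tr ?leq_addr// addKn s21; field.
  + move=> i ilt; have [h|h] := ltnP i n1.
      by rewrite !tl ?(ltnW h)// ltr_pM2r ?invr_gt0//; exact: s1m.
    rewrite !tr ?(leqW h)// subSn// ltr_pM2r ?invr_gt0// ltrD2l; apply: s2m.
    by rewrite ltn_subLR.
- move=> i ilt; have [h|h] := ltnP i n1.
    have [cw Hs] := H1 i h; split=> // s; rewrite !tl ?(ltnW h)// => /andP[sa sb].
    have := in1 i.+1 h => /andP[_ t11].
    rewrite gl; last lra.
    by apply: Hs; lra.
  have i2 : (i - n1 < n2)%N by rewrite ltn_subLR.
  have [cw Hs] := H2 _ i2; split=> // s; rewrite !tr ?(leqW h)// subSn// => /andP[sa sb].
  have := in2 _ (ltnW i2) => /andP[t20 _].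
  rewrite gr; last lra.
  by apply: Hs; lra.
- move=> i q ilt; have [h|h] := ltnP i n1; first exact: D1.
  by apply: D2; rewrite ltn_subLR.
rewrite E1 E2 big_split_ord /=; congr (_ + _); apply: eq_bigr => i _ /=.
  have := in1 i.+1 (ltn_ord i) => /andP[_ a1].
  have := in1 i (ltnW (ltn_ord i)) => /andP[_ a2].
  rewrite ltn_ord !tl ?(ltnW (ltn_ord i))// !gl; [|lra|lra].
  by rewrite !(mulrC 2) !divfK.
have := in2 i.+1 (ltn_ord i) => /andP[a1 _].
have := in2 i (ltnW (ltn_ord i)) => /andP[a2 _].
rewrite ltnNge leq_addr /= addKn !tr ?leq_addr ?(leqW (leq_addr _ _))//.
rewrite subSn ?leq_addr// addKn !gr; [|lra|lra].
have e (a : R) : 2 * ((1 + a) / 2) - 1 = a by field.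
by rewrite !e.
Qed.

Lemma travels_rev x y z : travels x y z -> travels y x (- z).
Proof.
move=> [g [c g0 g1 [n [t [U [w [F [[s0 s1 sm] H D E]]]]]]]].
exists (fun s => g (1 - s)); split.
- apply/path_continuousP => s s01 A nA.
  have [|d d0 Hd] := proj1 (path_continuousP _) c (1 - s) _ _ nA; first by move/andP: s01; lra.
  exists d => // s' s'01 ss'; apply: Hd; first by move/andP: s'01; lra.
  have -> : 1 - s' - (1 - s) = - (s' - s) by ring.
  by rewrite normrN.
- by rewrite subr0.
- by rewrite subrr.
exists n, (fun i => 1 - t (n - i)%N), (fun i => U (n - i.+1)%N),
  (fun i => w (n - i.+1)%N), (fun i => F (n - i.+1)%N).
have idx i : (i < n)%N -> (n - i)%N = (n - i.+1).+1.
  by move=> h; rewrite subnSK.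
have lt_ i : (i < n)%N -> (n - i.+1 < n)%N.
  by move=> h; rewrite ltn_subrL (leq_ltn_trans _ h).
split.
- split.
  + by rewrite subn0 s1 subrr.
  + by rewrite subnn s0 subr0.
  + by move=> i h; rewrite ltrD2l ltrN2 (idx i h); apply: sm; exact: lt_.
- move=> i h; have [cw Hs] := H _ (lt_ i h); split=> // s /andP[sa sb]; apply: Hs.
  by move: sa sb; rewrite (idx i h); lra.
- by move=> i q h; exact/D/lt_.
rewrite E -sumrN (reindex_inj rev_ord_inj) /=; apply: eq_bigr => i _.
have sK (a : R) : 1 - (1 - a) = a by ring.
by rewrite !sK (idx i (ltn_ord i)) opprB.
Qed.

Section Dev.
Variables (e : I -> I -> C) (k : R).
Hypothesis De : development dz e k.

Let k0 : 0 < k. Proof. exact: dev_scale De. Qed.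
Let kC : k%:C%C != 0 :> C. Proof. by rewrite -nm_eq0 nm_real normr_eq0 gt_eqF. Qed.

Lemma dev_base_face t u v x : t \in face X -> in_face t (val x) -> u \in t -> v \in t ->
  dev (e v) x = e v u + dev (e u) x.
Proof.
move=> tf xt ut vt.
have -> : e v u + dev (e u) x = dev (fun b => 1 * e u b + e v u) x.
  by rewrite dev_affine mul1r addrC.
apply: eq_bigr => b _; have [bt|bt] := boolP (b \in t); last first.
  by move/in_faceP/(_ _ bt): xt => ->; rewrite !mul0r.
by rewrite mul1r addrC (dev_cocycle De tf).
Qed.

(** The factor [k^-1] makes the development isometric. The summand 0 gives the
    values at the vertices the shape of [dev_affine]. *)
Definition edge_chart u : S -> C := dev (fun b => (k^-1)%:C%C * e u b + 0).

Lemma edge_chartE u x : edge_chart u x = (k^-1)%:C%C * dev (e u) x.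
Proof. by rewrite /edge_chart dev_affine addr0. Qed.

Lemma edge_chart_dev u x : dev (e u) x = k%:C%C * edge_chart u x.
Proof. by rewrite edge_chartE mulrA -rmorphM divff ?gt_eqF// mul1r. Qed.

Lemma edge_chart_isometric u v w w' : hinge u v w w' ->
  isometric_chart (edge_star u v) (edge_chart u).
Proof.
move=> h; apply: (hinge_chart h).
have [h1 h2 h3] := dev_placed De h.
have ki : (k^-1)%:C%C != 0 :> C by rewrite -nm_eq0 nm_real normr_eq0 gt_eqF ?invr_gt0.
split; [|exact: ccw_affine|exact: ccw_affine].
move=> t a b tf ut vt at_ bt ab.
have -> : (k^-1)%:C%C * e u a + 0 - ((k^-1)%:C%C * e u b + 0) = (k^-1)%:C%C * (e u a - e u b) :> C by ring.
rewrite nmM nm_real gtr0_norm ?invr_gt0// (h1 t)// mul1r mulKf// gt_eqF//.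
Qed.

Lemma edge_chart_primitive u v w w' x : hinge u v w w' -> edge_star u v x ->
  is_derive (edge_chart u x) 1 (fun z : C => k%:C%C * z + 0 : C)
    (dz (edge_star u v) (edge_chart u) (edge_chart u x)).
Proof.
move=> h xs; have ic := edge_chart_isometric h.
have [T [E D]] := dev_primitive De (or_introl ic) xs (proj1 xs).
have /= D1 := nbhs_singleton D.
apply: is_derive_near D1.
have [r r0 Hr] := open_embedding_disc (proj1 ic) xs E.
apply/nbhs_CP; exists r => // z /Hr[y [ys yE <-]].
by rewrite -yE edge_chart_dev addr0.
Qed.

Lemma travels_edge u v w w' t x y : hinge u v w w' -> t \in face X ->
  in_face t (val x) -> in_face t (val y) -> edge_star u v x -> edge_star u v y ->
  travels x y (dev (e u) y - dev (e u) x).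
Proof.
move=> h tf xt yt [xu xv] [yu yv].
have -> : dev (e u) y - dev (e u) x =
  (k%:C%C * edge_chart u y + 0) - (k%:C%C * edge_chart u x + 0).
  by rewrite !edge_chart_dev !addr0.
have cc : complex_chart (edge_star u v) (edge_chart u).
  by left; exact: edge_chart_isometric h.
have pp q := @edge_chart_primitive u v w w' q h.
have sg s : 0 <= s <= 1 -> edge_star u v (mix x y s).
  by move=> s01; split; exact: (mix_pos tf).
exact: (travels_chart cc pp tf xt yt sg).
Qed.

(** Through the midpoint of a common edge. *)
Lemma travels_adjacent s t u v x y : s \in face X -> t \in face X -> u != v ->
  u \in s -> v \in s -> u \in t -> v \in t -> is_barycenter s x -> is_barycenter t y ->
  travels x y (dev (e u) y - dev (e u) x).
Proof.
move=> sf tf uv us vs ut vt xb yb.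
have [w [w' h]] := exists_hinge sf us vs uv.
have [|m [ms mt]] := exists_midpoint uv; first by exists s; rewrite // us.
have xs : edge_star u v x by split; exact: barycenter_pos xb _.
have ys : edge_star u v y by split; exact: barycenter_pos yb _.
have -> : dev (e u) y - dev (e u) x =
  (dev (e u) m - dev (e u) x) + (dev (e u) y - dev (e u) m) by ring.
apply: (travels_cat (y := m)).
  by apply: (travels_edge h sf); [exact: barycenter_in_face|exact: mt| |].
by apply: (travels_edge h tf); [exact: mt|exact: barycenter_in_face| |].
Qed.

Lemma travels_barycenter x : ~ is_vertex x ->
  exists t b z, [/\ t \in face X, is_barycenter t b & travels x b z].
Proof.
move=> /nonvertex_edge[u [v [w [w' [h xs]]]]].
have [t tf xt] := point_face x; have [b bE] := exists_barycenter tf.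
exists t, b, (dev (e u) b - dev (e u) x); split=> //.
have [xu xv] := xs.
apply: (travels_edge h tf) => //; first exact: barycenter_in_face.
by split; apply: (barycenter_pos bE); exact: bary_pos_in xt _.
Qed.

Hypothesis Hconn : connected [set: S].

(** From each point to the barycentre of its face, and from barycentre to barycentre
    across the edges. *)
Lemma travels_nonvertex x y : ~ is_vertex x -> ~ is_vertex y -> exists z, travels x y z.
Proof.
move=> /travels_barycenter[s [b [z [sf bs xb]]]] /travels_barycenter[t [b' [z' [tf bt yb]]]].
pose P t := forall b1, is_barycenter t b1 -> exists z, travels b b1 z.
have adj : forall s t, s \in face X -> t \in face X -> #|s :&: t| = 2%N -> P s -> P t.
  move=> s1 t1 s1f t1f /eqP/cards2P[u [v [uv st]]] Ps b1 b1t.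
  have : u \in s1 :&: t1 by rewrite st !inE eqxx.
  have : v \in s1 :&: t1 by rewrite st !inE eqxx orbT.
  rewrite !inE => /andP[vs vt] /andP[us ut].
  have [b2 b2s] := exists_barycenter s1f; have [z2 h2] := Ps _ b2s.
  eexists; apply: travels_cat h2 _.
  exact: (travels_adjacent s1f t1f uv us vs ut vt b2s b1t).
have Ps : P s.
  move=> b1 b1s; have -> : b1 = b by apply: bary_inj => v; rewrite b1s bs.
  have [u [v [us vs uv]]] := face_two_vertices sf.
  eexists; exact: (travels_adjacent sf sf uv us vs us vs bs bs).
have Pt : P t := face_connected Hconn adj sf tf Ps.
have [z1 h1] := Pt _ bt.
exists (z + z1 + - z'); apply: travels_cat (travels_rev yb).
exact: travels_cat xb h1.
Qed.

End Dev.
End Paths.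

(** * A covering of a torus is affine in the development *)

Section PuncturedDisc.
Variable R : realType.
Local Notation C := (CC R).

(** The segment between two points avoids the centre unless they lie on opposite
    radii; then it is replaced by two segments through a point [q] of the orthogonal
    diameter. *)
Lemma punctured_disc_constant (h : C -> C) z0 (r : R) :
  (forall z : C, z != z0 -> nm (z - z0) < r ->
     exists2 d : R, 0 < d & forall z', nm (z' - z) < d -> h z' = h z) ->
  forall z z' : C, z != z0 -> z' != z0 -> nm (z - z0) < r -> nm (z' - z0) < r -> h z = h z'.
Proof.
move=> Hloc.
have one z z' : nm (z - z0) < r -> nm (z' - z0) < r ->
    (forall s, 0 <= s <= 1 -> seg z z' s != z0) -> h z = h z'.
  move=> zr zr' nz.
  pose P s := h (seg z z' s) = h z.
  suff : P 1 by rewrite /P seg1.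
  apply: (locally_constant_itv (a := 0) (b := 1)); rewrite ?ler01//; last by rewrite /P seg0.
  move=> c c01; have [d d0 Hd] := Hloc _ (nz c c01) (seg_disc c01 zr zr').
  have D : 0 < 1 + nm (z' - z) by rewrite ltr_wpDr// nm_ge0.
  exists (d / (1 + nm (z' - z))); first by rewrite divr_gt0.
  move=> s s01; rewrite ltr_pdivlMr// => sd; rewrite /P Hd// segB nmM nm_real.
  by have := normr_ge0 (s - c); lra.
move=> z z' zn zn' zr zr'.
have [[s s01 sz]|none] := pselect (exists2 s, 0 <= s <= 1 & seg z z' s = z0); last first.
  by apply: one => // s s01; apply/eqP => e; apply: none; exists s.
pose a := z - z0; have a0 : a != 0 by rewrite subr_eq0.
have /andP[s0 s1] := s01.
have s_lt1 : s != 1 by apply: contraNneq zn' => e; rewrite -sz e seg1.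
have s_gt0 : s != 0 by apply: contraNneq zn => e; rewrite -sz e seg0.
have sC : s%:C%C != 0 :> C by rewrite -nm_eq0 nm_real normr_eq0.
pose t := (1 - s) / s.
have t0 : t != 0 by rewrite mulf_neq0 ?invr_eq0// subr_eq0 eq_sym.
have z'E : z' - z0 = - t%:C%C * a.
  have ts : s%:C%C * t%:C%C = (1 - s)%:C%C :> C by rewrite -rmorphM /t mulrC divfK.
  apply: (mulfI sC); rewrite mulNr mulrN mulrA ts.
  move/eqP: sz; rewrite /seg -subr_eq0 => /eqP E.
  apply/eqP; rewrite -subr_eq0 opprK; apply/eqP; rewrite -[RHS]E /a rmorphB rmorph1 /=; ring.
pose i : C := (0 +i* 1)%C.
have ni : nm i = 1 by rewrite /= expr0n expr1n add0r sqrtr1.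
pose q := z0 + i * a.
have qr : nm (q - z0) < r by rewrite addrC addKr nmM ni mul1r.
have cplx_neq0 (x y : R) : (x != 0) || (y != 0) -> (x +i* y)%C * a != 0.
  by move=> h0; rewrite mulf_neq0// eq_complex /= negb_and.
transitivity (h q); apply: one => // b /andP[b0 b1]; rewrite -subr_eq0.
  have -> : seg z q b - z0 = ((1 - b) +i* b)%C * a.
    have -> : seg z q b - z0 = (1 - b)%:C%C * a + b%:C%C * i * a.
      by rewrite /seg /q /a rmorphB rmorph1 /=; ring.
    rewrite -mulrDl; congr (_ * _); apply/eqP; rewrite eq_complex /=.
    by apply/andP; split; apply/eqP; ring.
  apply: cplx_neq0; rewrite subr_eq0; have [->|bn] := eqVneq b 0; last by rewrite orbT.
  by rewrite oner_eq0.
have -> : seg q z' b - z0 = ((- (b * t)) +i* (1 - b))%C * a.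
  have -> : seg q z' b - z0 = (1 - b)%:C%C * i * a + b%:C%C * (z' - z0).
    by rewrite /seg /q rmorphB rmorph1 /=; ring.
  rewrite z'E mulrA -mulrDl; congr (_ * _); apply/eqP; rewrite eq_complex /=.
  by apply/andP; split; apply/eqP; ring.
apply: cplx_neq0; rewrite oppr_eq0 mulf_eq0 (negbTE t0) orbF subr_eq0.
by have [->|//] := eqVneq b 0; rewrite oner_eq0 orbT.
Qed.

(** The derivative is locally constant off the centre, hence constant there, and the
    centre is a removable singularity. *)
Lemma affine_punctured (G : C -> C) z0 (r : R) : 0 < r ->
  (forall z : C, nm (z - z0) < r -> derivable G z 1) ->
  (forall z : C, z != z0 -> nm (z - z0) < r -> exists l m,
     \forall y \near z, G y = l * y + m) ->
  exists l m, forall z : C, nm (z - z0) < r -> G z = l * z + m.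
Proof.
move=> r0 DG HG.
have D z : nm (z - z0) < r -> is_derive z 1 G ('D_1 G z) by move=> /DG d; split.
have loc z : z != z0 -> nm (z - z0) < r ->
    exists2 d : R, 0 < d & forall z', nm (z' - z) < d -> 'D_1 G z' = 'D_1 G z.
  move=> zn zr; have [l [m H]] := HG z zn zr.
  have : \forall y \near z, 'D_1 G y = l.
    apply: filterS (near_near H) => y Hy; apply: derive_val.
    apply: is_derive_near (is_derive_linear y l m).
    by apply: filterS Hy => x ->.
  move=> /[dup] /nbhs_singleton /= E /nbhs_CP[d d0 Hd].
  exists d; first exact: d0.
  by move=> z' z'd; exact: (etrans (Hd z' z'd) (esym E)).
pose z1 := z0 + (r / 2)%:C%C.
have r2 : 0 < r / 2 by rewrite divr_gt0.
have z1r : nm (z1 - z0) < r by rewrite addrC addKr nm_real gtr0_norm//; lra.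
have z1n : z1 != z0 by rewrite -subr_eq0 addrC addKr -nm_eq0 nm_real gtr0_norm// gt_eqF.
pose l := 'D_1 G z1.
have Dl z : z != z0 -> nm (z - z0) < r -> is_derive z 1 G l.
  by move=> zn zr; rewrite /l -(punctured_disc_constant loc zn z1n zr z1r); exact: D.
have D0 : is_derive z0 1 G l.
  apply: (derive_punctured (g := fun=> l) r0) => //; last exact: cst_continuous.
  by apply/derivable_cont/DG; rewrite subrr nm0.
exists l, (G z0 - l * z0) => z zr.
have h1 y : nm (y - z0) < r -> is_derive y 1 G l.
  by move=> yr; have [->//|yn] := eqVneq y z0; exact: Dl.
have h2 y : nm (y - z0) < r -> is_derive y 1 (fun x : C => l * x + 0) l.
  by move=> _; exact: is_derive_linear.
have := primitive_unique h1 h2 zr; rewrite !addr0 => /eqP; rewrite subr_eq => /eqP ->.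
by ring.
Qed.

End PuncturedDisc.

Section Slopes.
Variables (R : realType) (X : flat_surface R) (dz : one_form X).
Local Notation C := (CC R).
Local Notation S := (realization X).
Local Notation I := 'I_(nv X).
Implicit Types (x y p : S) (t : {set I}).
Variables (e : I -> I -> C) (k : R).
Hypothesis De : development dz e k.
Variables (w1 w2 : C).
Hypothesis indep : independent w1 w2.
Local Notation T := (torus w1 w2).
Local Notation proj := (@torus_proj R w1 w2).
Local Notation Gamma := (lattice w1 w2).

Let k0 : 0 < k. Proof. exact: dev_scale De. Qed.

Lemma dev_base_change (u v : I) x : 0 < bary x u -> 0 < bary x v ->
  dev (e v) x = e v u + dev (e u) x.
Proof.
move=> xu xv; have [t tf xt] := point_face x.
exact: (dev_base_face De tf xt (bary_pos_in xt xu) (bary_pos_in xt xv)).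
Qed.

Lemma near_dev (u : I) p (r : R) : 0 < r -> \forall x \near p, nm (dev (e u) x - dev (e u) p) < r.
Proof. by move=> r0; exact: (dev_continuous (e := e u) (near_disc _ r0)). Qed.

Variable f : S -> T.
Hypothesis fc : continuous f.

(** [l] is the linear part of a lift of [f] read in the development. *)
Definition slope_at (u : I) p (l : C) := exists m, \forall x \near p, f x = proj (l * dev (e u) x + m).

Definition slope p (l : C) := exists u, 0 < bary p u /\ slope_at u p l.

Lemma slope_at_change (u v : I) p l : 0 < bary p u -> 0 < bary p v ->
  slope_at u p l -> slope_at v p l.
Proof.
move=> pu pv [m H]; exists (m - l * e v u).
apply: filterS (filterI H (filterI (near_star pu) (near_star pv))) => x [-> [xu xv]].
by rewrite (dev_base_change xu xv); congr proj; ring.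
Qed.

Lemma slope_at_any (u : I) p l : 0 < bary p u -> slope p l -> slope_at u p l.
Proof. by move=> pu [v [pv H]]; exact: slope_at_change pv pu H. Qed.

Lemma slope_near p l : slope p l -> \forall x \near p, slope x l.
Proof.
move=> [u [pu [m H]]]; apply: filterS (filterI (near_star pu) (near_near H)) => x [xu Hx].
by exists u; split=> //; exists m.
Qed.

(** The development takes other values arbitrarily close to [p], so the germ at [p]
    of an affine function of it determines the linear part. *)
Lemma dev_moves p (u : I) (N : set S) : ~ is_vertex p -> 0 < bary p u -> nbhs p N ->
  exists x (s : R), [/\ N x, 0 < s & dev (e u) x - dev (e u) p = s%:C%C].
Proof.
move=> np pu nN; have [v [w [w' [h ps]]]] := nonvertex_hinge np pu.
have oe := kite_open_embedding h (dev_placed De h).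
have [r r0 Hr] := open_embedding_disc oe ps nN.
have r2 : 0 < r / 2 by rewrite divr_gt0.
have [|x [_ Nx xE]] := Hr (dev (e u) p + (r / 2)%:C%C).
  by rewrite addrC addKr nm_real gtr0_norm//; lra.
by exists x, (r / 2); split=> //; rewrite xE addrC addKr.
Qed.

(** The difference of two affine lifts is continuous with values in the lattice,
    hence constant near [p]. *)
Lemma slope_unique p l l' : ~ is_vertex p -> slope p l -> slope p l' -> l = l'.
Proof.
move=> np [u [pu [m H]]] /(slope_at_any pu)[m' H'].
have [d d0 Hd] := lattice_gap indep.
pose D := 1 + nm (l - l'); have D0 : 0 < D by rewrite ltr_wpDr// nm_ge0.
have dD : 0 < d / D by rewrite divr_gt0.
have [x [s [[xH [xH' xd]] s0 xE]]] :=
  dev_moves np pu (filterI H (filterI H' (near_dev u p dD))).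
have pH := nbhs_singleton H; have pH' := nbhs_singleton H'.
have g1 : Gamma (l * dev (e u) x + m - (l' * dev (e u) x + m')) by apply/projP; rewrite -xH -xH'.
have g2 : Gamma (l * dev (e u) p + m - (l' * dev (e u) p + m')) by apply/projP; rewrite -pH -pH'.
have : (l - l') * (dev (e u) x - dev (e u) p) = 0.
  apply: Hd.
    have -> : (l - l') * (dev (e u) x - dev (e u) p) =
      l * dev (e u) x + m - (l' * dev (e u) x + m') - (l * dev (e u) p + m - (l' * dev (e u) p + m')) by ring.
    exact: latticeB.
  rewrite nmM; move: xd; rewrite /= ltr_pdivlMr// /D.
  by have := nm_ge0 (dev (e u) x - dev (e u) p); lra.
move/eqP; rewrite mulf_eq0 xE => /orP[|/eqP e0]; first by rewrite subr_eq0 => /eqP.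
by have := nm_real s; rewrite e0 nm0 gtr0_norm// => e1; rewrite e1 ltxx in s0.
Qed.

(** [G] is the lift [s \o f] read in the edge chart of [u]. The last clause records
    that this chart maps neighbourhoods of [p] to neighbourhoods, without naming the
    second vertex of the edge. *)
Lemma local_lift (hf : holomorphic_map f) p (u : I) : ~ is_vertex p -> 0 < bary p u ->
  exists (W : set T) (s : T -> C) (r : R) (G : C -> C), [/\ torus_chart W s /\ W (f p), 0 < r,
    (forall z : C, nm (z - edge_chart e k u p) < r -> derivable G z 1),
    (\forall x \near p, s (f x) = G (edge_chart e k u x)) &
    (\forall x \near p, W (f x)) /\
    (forall N, nbhs p N -> exists2 r' : R, 0 < r' & forall z : C, nm (z - edge_chart e k u p) < r' ->
       exists x, N x /\ edge_chart e k u x = z)].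
Proof.
move=> np pu; have [v [w [w' [h ps]]]] := nonvertex_hinge np pu.
have ic := edge_chart_isometric De h; have oe := proj1 ic.
have [z0 z0E] := proj_surj (f p).
have [W [s [tc Wp _]]] := torus_chart_exists indep z0; rewrite z0E in Wp.
have oW : open W by case: tc => -[].
have nW : \forall x \near p, W (f x) by exact: (fc (open_near oW Wp)).
have [r r0 Hr] := open_embedding_disc oe ps nW.
have [oE iE _ _] := oe.
pose G z := s (f (xget p [set x | edge_star u v x /\ edge_chart e k u x = z])).
have GE x : edge_star u v x -> G (edge_chart e k u x) = s (f x).
  move=> xs; rewrite /G; congr (s (f _)); case: xgetP => [y _ [ys ye]|/(_ x)]; last by case.
  by apply: iE => //; apply: mem_set.
exists W, s, r, G; split=> //.
- move=> z /Hr[x [xs Wx <-]].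
  have [g [gE Dg]] := proj2 hf _ _ _ _ x (or_introl ic) tc xs Wx.
  have [l Dl] := derivable_is_derive Dg.
  suff : is_derive (edge_chart e k u x) 1 G l by case.
  apply: is_derive_near Dl.
  have [r' r'0 Hr'] := open_embedding_disc oe xs gE.
  by apply/nbhs_CP; exists r' => // z' /Hr'[y [ys yE <-]]; rewrite GE.
- by apply: filterS (open_near oE ps) => x /GE.
split=> // N nN; have [r' r'0 Hr'] := open_embedding_disc oe ps nN.
by exists r' => // z /Hr'[x [_ Nx xz]]; exists x.
Qed.

Variable kk : R.
Hypothesis kk0 : 0 < kk.
Hypothesis fhol : holomorphic_map f.
Hypothesis fcov : finite_ramified_covering f.
Hypothesis fiso : forall p, nonsingular p -> ~ ramification_pt f p -> local_isometry_at kk f p.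

Lemma nonvertex_nonsingular p : ~ is_vertex p -> nonsingular p.
Proof.
move=> /nonvertex_edge[u [v [w [w' [h ps]]]]].
by exists (edge_star u v), (edge_chart e k u); split=> //; exact: (edge_chart_isometric De h).
Qed.

Let chart_slope p (u : I) l m : 0 < bary p u ->
  (\forall x \near p, f x = proj (l * edge_chart e k u x + m)) -> slope_at u p (l * (k^-1)%:C%C).
Proof.
by move=> pu H; exists m; apply: filterS H => x ->; rewrite edge_chartE mulrA.
Qed.

(* The lift is a similarity because [f] is a local isometry, and not a reflection
    because it is holomorphic. *)
Let slope_unramified p (u : I) : ~ is_vertex p -> 0 < bary p u -> ~ ramification_pt f p ->
  exists2 l, l != 0 & slope_at u p l.
Proof.
move=> np pu nr.
have [W [s [r [G [[tc Wp] r0 DG GE [nW chart]]]]]] := local_lift fhol np pu.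
have [U [oU Up _ iso]] := fiso (nonvertex_nonsingular np) nr.
have [v [w [w' [h ps]]]] := nonvertex_hinge np pu.
have [dist _] := proj2 (edge_chart_isometric De h) p ps.
have [[A B] /= [pA pB] HAB] := dist.
have [d d0 Hd] := lattice_gap indep.
have d4 : 0 < d / 4 by rewrite divr_gt0.
have [[_ _ sc _] sK] := tc.
have ns : \forall x \near p, nm (s (f x) - s (f p)) < d / 4.
  exact: (fc (sc _ Wp _ (near_disc _ d4))).
have NN := nbhs_and pA (nbhs_and pB (nbhs_and (open_near oU Up) (nbhs_and ns (nbhs_and GE nW)))).
have [r' r'0 Hr'] := chart _ NN.
pose r1 := Num.min r r'; have r10 : 0 < r1 by rewrite lt_min r0.
have kki : 0 < kk^-1 by rewrite invr_gt0.
have sim z z' : nm (z - edge_chart e k u p) < r1 -> nm (z' - edge_chart e k u p) < r1 ->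
    nm (G z - G z') = kk^-1 * nm (z - z').
  rewrite !lt_min => /andP[_ /Hr'[x [[xA [xB [xU [xs [xG xW]]]]] <-]]].
  move=> /andP[_ /Hr'[y [[yA [yB [yU [ys [yG yW]]]]] <-]]].
  rewrite -xG -yG (HAB (x, y))//= -(iso x y)//.
  rewrite -(sK _ xW) -(sK _ yW) (torus_dist_local kk0 Hd) ?sK ?mulKf ?gt_eqF//.
  have := nmBD (s (f p)) (s (f x)) (s (f y)); rewrite (nmBC (s (f p))).
  by move: xs ys; rewrite /=; lra.
have [l [m [nl lm]]] := disc_similarity r10 kki sim.
have l0 : l != 0 by rewrite -nm_eq0 nl gt_eqF.
have k1 : (k^-1)%:C%C != 0 :> C by rewrite -nm_eq0 nm_real normr_eq0 gt_eqF ?invr_gt0.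
exists (l * (k^-1)%:C%C); first by rewrite mulf_neq0.
case: lm => H; last first.
  exfalso; move/eqP: l0; apply; apply: (conj_not_derivable r10 H); apply: DG.
  by rewrite subrr nm0.
have cr : \forall x \near p, nm (edge_chart e k u x - edge_chart e k u p) < r1.
  exact: (dev_continuous (near_disc _ r10)).
apply: (chart_slope (m := m)) => //.
apply: filterS (filterI GE (filterI nW cr)) => x [xG [xW xr]].
by rewrite -(sK _ xW) xG H.
Qed.

(** Ramification points lie over the finite exceptional set, and the fibres are
    finite. *)
Lemma ramification_finite : exists2 A : set S, finite_set A & forall p, ramification_pt f p -> A p.
Proof.
have [_ ffin [B fB HB]] := fcov.
exists (f @^-1` B).
  have -> : f @^-1` B = \bigcup_(b in B) f @^-1` [set b].
    by apply/seteqP; split=> [x Bx|x [b Bb /= ->]//]; exists (f x).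
  by apply: bigcup_finite => // b _; exact: ffin.
move=> p rp; apply: contrapT => nB; apply: rp.
have [W [oW Wp [n [U [_ fW HU]]]]] := HB _ nB.
have : (f @^-1` W) p by [].
rewrite fW => -[i _ Uip]; exists (U i); have [[oU iU _ _] _] := HU i => //.
Qed.

Let near_unramified p : \forall x \near p, x <> p -> ~ ramification_pt f x.
Proof.
have [A fA HA] := ramification_finite.
have [s sE] : exists s : seq S, [set` s] = A `\ p.
  have /finite_seqP[s sE] : finite_set (A `\ p) by exact: finite_setD.
  by exists s.
suff : \forall x \near p, forall y, y \in s -> x <> y.
  apply: filterS => x H xp /HA Ax; apply: (H x) => //.
  by have : [set` s] x by rewrite sE.
have sp y : y \in s -> y <> p by move=> ys; have : [set` s] y by []; rewrite sE => -[].
elim: s {sE} sp => [|y s IH] sp.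
  by apply: filterE => x y.
have [v yv] : exists v, bary y v != bary p v.
  apply: contrapT => H; apply: (sp y); first by rewrite inE eqxx.
  apply: bary_inj => v; apply/eqP; apply: contrapT => /negP h; apply: H; by exists v.
have N1 : \forall x \near p, x <> y.
  apply/nbhs_SP; exists `|bary y v - bary p v|; first by rewrite normr_gt0 subr_eq0.
  by move=> x /(_ v) + xy; rewrite xy ltxx.
have N2 : \forall x \near p, forall y, y \in s -> x <> y.
  by apply: IH => y' y's; apply: sp; rewrite inE y's orbT.
apply: filterS (filterI N1 N2) => x [h1 h2] y'.
by rewrite inE => /orP[/eqP ->|/h2].
Qed.

(** Ramification points are isolated, and around one of them the lift is
    differentiable and locally affine off the centre. *)
Lemma slope_exists p : ~ is_vertex p -> exists l, slope p l.
Proof.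
move=> np; have [u pu] := exists_bary_pos p.
have [W [s [r [G [[tc Wp] r0 DG GE [nW chart]]]]]] := local_lift fhol np pu.
have [v [w [w' [h ps]]]] := nonvertex_hinge np pu.
have uv : u != v by case: h.
have oE := open_near (@open_edge_star _ _ u v) ps.
have [_ sK] := tc.
have NN := nbhs_and oE (nbhs_and (near_unramified p) (nbhs_and (near_near GE) nW)).
have [r' r'0 Hr'] := chart _ NN.
pose r1 := Num.min r r'; have r10 : 0 < r1 by rewrite lt_min r0.
have [|z zp zr|l [m H]] := affine_punctured (G := G) (z0 := edge_chart e k u p) r10.
- by move=> z; rewrite lt_min => /andP[/DG].
- move: zr; rewrite lt_min => /andP[_ /Hr'[x [[xs [xram [xG xW]]] xz]]].
  have xp : x <> p by move=> xp; rewrite -xz xp eqxx in zp.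
  have nx := edge_star_not_vertex uv xs; have [xu xv] := xs.
  have [l _ [m Hm]] := slope_unramified nx xu (xram xp).
  have kC : (k^-1)%:C%C != 0 :> C by rewrite -nm_eq0 nm_real normr_eq0 gt_eqF ?invr_gt0.
  have dc : {for x, continuous (fun y => l * dev (e u) y + m)} by exact: dev_affine_continuous.
  have L := torus_chart_local indep tc (fc (x:=x)) dc xW Hm.
  exists (l * k%:C%C), (m + (s (f x) - (l * dev (e u) x + m))).
  have [r2 r20 Hr2] := open_embedding_disc (proj1 (edge_chart_isometric De h)) xs (filterI L xG).
  apply/nbhs_CP; exists r2 => // z1; rewrite -xz => /Hr2[y [ys [yL yG] <-]].
  rewrite -yG yL (edge_chart_dev De); ring.
exists (l * (k^-1)%:C%C), u; split=> //.
have cr : \forall x \near p, nm (edge_chart e k u x - edge_chart e k u p) < r1.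
  exact: (dev_continuous (near_disc _ r10)).
apply: (chart_slope (m := m)) => //.
apply: filterS (filterI GE (filterI nW cr)) => x [xG [xW xr]].
by rewrite -(sK _ xW) xG H.
Qed.

Lemma mix_nonvertex t x y (s : R) : t \in face X -> in_face t (val x) -> in_face t (val y) ->
  ~ is_vertex x -> ~ is_vertex y -> 0 <= s <= 1 -> ~ is_vertex (mix x y s).
Proof.
move=> tf xt yt nx ny s01; have /andP[s0 s1] := s01.
have [s1'|s1'] := eqVneq s 1; first by rewrite s1' (mix1 tf).
have [u xu] := exists_bary_pos x; have [v vu xv] := not_vertex_pos nx xu.
apply: (edge_star_not_vertex vu).
have sp : 0 < 1 - s by rewrite subr_gt0 lt_neqAle s1'.
by split; rewrite (mixE tf)// ltr_pwDl ?mulr_gt0// mulr_ge0 ?bary_ge0.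
Qed.

(** The slope is locally constant along the segment from [x] to [y], which misses
    the vertices. *)
Lemma slope_face t x y l : t \in face X -> in_face t (val x) -> in_face t (val y) ->
  ~ is_vertex x -> ~ is_vertex y -> slope x l -> slope y l.
Proof.
move=> tf xt yt nx ny sx.
pose P s := slope (mix x y s) l.
suff : P 1 by rewrite /P (mix1 tf).
apply: (locally_constant_itv (a := 0) (b := 1)); rewrite ?ler01//; last by rewrite /P (mix0 tf).
move=> c c01; have nc := mix_nonvertex tf xt yt nx ny c01.
have [lc Hc] := slope_exists nc.
have [d d0 Hd] := proj1 (path_continuousP _) (mix_path tf xt yt) c c01 _ (slope_near Hc).
exists d => // s s01 sc; have Hs : slope (mix x y s) lc := Hd s s01 sc.
have ns := mix_nonvertex tf xt yt nx ny s01.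
split=> H.
  by rewrite /P -(slope_unique ns Hs H).
by rewrite /P -(slope_unique nc Hc H).
Qed.

Hypothesis Hconn : connected [set: S].
Hypothesis Hne : [set: S] !=set0.

(** Two faces with a common edge share a point that is not a vertex, the midpoint of
    the edge. *)
Lemma slope_global : exists2 l, l != 0 & forall p, ~ is_vertex p -> slope p l.
Proof.
have [p0 _] := Hne.
have [p nr np] : exists2 p, ~ ramification_pt f p & ~ is_vertex p.
  have [q _ nq] := near_nonvertex (p := p0) filterT.
  have [u qu] := exists_bary_pos q.
  have [v [_ [_ [[uv _ _ _] qs]]]] := nonvertex_hinge nq qu.
  have oE := open_near (@open_edge_star _ _ u v) qs.
  have [x [s [[xE xr] s0 xs]]] := dev_moves nq qu (nbhs_and oE (near_unramified q)).
  exists x; last exact: (edge_star_not_vertex uv xE).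
  apply: xr => xq; rewrite xq subrr in xs.
  by have := nm_real s; rewrite -xs nm0 gtr0_norm// => e1; rewrite e1 ltxx in s0.
have [u pu] := exists_bary_pos p.
have [l l0 sl] := slope_unramified np pu nr.
exists l => // q nq.
have [t tf pt] := point_face p; have [t' t'f qt'] := point_face q.
pose P t := forall x, ~ is_vertex x -> in_face t (val x) -> slope x l.
have adj : forall s t, s \in face X -> t \in face X -> #|s :&: t| = 2%N -> P s -> P t.
  move=> s1 t1 s1f t1f /eqP/cards2P[a [b [ab st]]] Ps x nx xt.
  have : a \in s1 :&: t1 by rewrite st !inE eqxx.
  have : b \in s1 :&: t1 by rewrite st !inE eqxx orbT.
  rewrite !inE => /andP[bs bt] /andP[as_ at_].
  have [|m [ms mt]] := @exists_midpoint _ X a b ab; first by exists s1; rewrite // as_.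
  have nm_ := edge_star_not_vertex ab ms.
  apply: (slope_face t1f (mt _ at_ bt) xt nm_ nx).
  exact: (Ps _ nm_ (mt _ as_ bs)).
have Pt : P t.
  by move=> x nx xt; apply: (slope_face tf pt xt np nx); exists u.
by have Pt' : P t' := face_connected Hconn adj tf t'f Pt; exact: Pt'.
Qed.

(** At a vertex [p] the function [D] below is locally constant on the segment from
    [x] to [p], except perhaps at [p], and it is continuous there. *)
Lemma slope_everywhere : exists2 l, l != 0 & forall p u, 0 < bary p u -> slope_at u p l.
Proof.
have [l l0 Hl] := slope_global; exists l => // p u pu.
have [vp|np] := pselect (is_vertex p); last exact: slope_at_any (Hl _ np).
have pE := vertex_bary vp pu.
have [z0 z0E] := proj_surj (f p).
have [W [s [tc Wp sp]]] := torus_chart_exists indep z0; rewrite z0E in Wp sp.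
have [[oW _ sc _] sK] := tc.
pose D x := s (f x) - l * dev (e u) x.
have nW : \forall x \near p, W (f x) by exact: (fc (open_near oW Wp)).
have nD (n : R) : 0 < n -> \forall x \near p, nm (D x - D p) < n.
  move=> n0; have n2 : 0 < n / 2 by rewrite divr_gt0.
  have L0 : 0 < 1 + nm l by rewrite ltr_wpDr// nm_ge0.
  have n3 : 0 < n / 2 / (1 + nm l) by rewrite divr_gt0.
  have h1 : \forall x \near p, nm (s (f x) - s (f p)) < n / 2.
    exact: (fc (sc _ Wp _ (near_disc _ n2))).
  apply: filterS (filterI h1 (near_dev u p n3)) => x [a1]; rewrite ltr_pdivlMr// => a2.
  have -> : D x - D p = (s (f x) - s (f p)) - l * (dev (e u) x - dev (e u) p) by rewrite /D; ring.
  apply: le_lt_trans (nmD _ _) _; rewrite nmN nmM.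
  by have := nm_ge0 (dev (e u) x - dev (e u) p); move: a1; rewrite /=; lra.
have [r r0 Hr] := proj1 (nbhs_SP _ _) (filterI nW (near_star pu)).
exists (D p); apply/nbhs_SP; exists r => // x xr.
have [Wx xu] := Hr x xr.
suff DE : D x = D p by rewrite -DE -(sK _ Wx) /D addrC subrK sK.
have [t tf xt] := point_face x.
have ut := bary_pos_in xt xu.
have pt : in_face t (val p).
  by apply/in_faceP => v vt; rewrite pE; case: eqVneq => // vu; rewrite vu ut in vt.
have [xp|xp] := pselect (x = p); first by rewrite xp.
have mE c : 0 <= c <= 1 -> forall v, bary (mix x p c) v - bary p v = (1 - c) * (bary x v - bary p v).
  by move=> c01 v; rewrite (mixE tf)//; ring.
have nx : ~ is_vertex x.
  by move=> vx; apply: xp; apply: bary_inj => v; rewrite pE (vertex_bary vx xu).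
have nmix c : 0 <= c < 1 -> ~ is_vertex (mix x p c).
  move=> /andP[c0 c1]; have [v vu xv] := not_vertex_pos nx xu.
  apply: (edge_star_not_vertex vu).
  have sp' : 0 < 1 - c by rewrite subr_gt0.
  have c01 : 0 <= c <= 1 by rewrite c0 ltW.
  by split; rewrite (mixE tf)// ltr_pwDl ?mulr_gt0// mulr_ge0 ?bary_ge0.
have inr c : 0 <= c <= 1 -> W (f (mix x p c)) /\ 0 < bary (mix x p c) u.
  move=> c01; apply: Hr => v; rewrite mE// normrM; apply: le_lt_trans (xr v).
  by case/andP: c01 => c0 c1; rewrite ler_piMl// ger0_norm ?subr_ge0//; lra.
have const b : 0 <= b < 1 -> D (mix x p b) = D x.
  move=> /andP[b0 b1]; pose P c := D (mix x p c) = D x.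
  apply: (locally_constant_itv (P := P) b0); last by rewrite /P (mix0 tf).
  move=> c /andP[c0 cb].
  have c01 : 0 <= c <= 1 by rewrite c0 (le_trans cb)// ltW.
  have [Wc cu] := inr c c01.
  have nc : ~ is_vertex (mix x p c) by apply: nmix; rewrite c0 (le_lt_trans cb).
  have [m Hm] := slope_at_any cu (Hl _ nc).
  have dc : {for mix x p c, continuous (fun y => l * dev (e u) y + m)} by exact: dev_affine_continuous.
  have L := torus_chart_local indep tc (fc (x:=mix x p c)) dc Wc Hm.
  have [d d0 Hd] := proj1 (path_continuousP _) (mix_path tf xt pt) c c01 _ L.
  exists d => // c' /andP[c'0 c'b] c'c.
  have /= E := Hd c' ltac:(lra) c'c.
  have DD : D (mix x p c') = D (mix x p c) by rewrite /D E; ring.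
  by rewrite /P DD.
apply/eqP; rewrite -subr_eq0 -nm_eq0 eq_le nm_ge0 andbT; apply/ler_addgt0Pr => n n0; rewrite add0r.
have [r' r'0 Hr'] := proj1 (nbhs_SP _ _) (nD n n0).
pose c := 1 - Num.min (r' / 2) 1.
have c0 : 0 < Num.min (r' / 2) 1 by rewrite lt_min ltr01 andbT divr_gt0.
have c1 : Num.min (r' / 2) 1 <= 1 by rewrite ge_min lexx orbT.
have c2 : Num.min (r' / 2) 1 < r' by rewrite gt_min; apply/orP; left; lra.
have c01 : 0 <= c < 1 by rewrite /c; lra.
rewrite -(const c c01); apply/ltW/Hr' => v; rewrite mE; last by case/andP: c01 => -> /ltW.
rewrite {1}/c subKr normrM gtr0_norm//; apply: le_lt_trans c2; rewrite ger_pMr// ler_norml.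
by have := bary_ge0 p v; have := bary_ge0 x v; have := bary_le1 p v; have := bary_le1 x v; lra.
Qed.

End Slopes.

(** * The periods of a covering *)

Section Periods.
Variables (R : realType) (X : flat_surface R) (dz : one_form X).
Local Notation C := (CC R).
Local Notation S := (realization X).
Local Notation I := 'I_(nv X).
Implicit Types (x y p : S) (t : {set I}).
Variables (e : I -> I -> C) (k : R).
Hypothesis De : development dz e k.

(** Both [F] and the development are primitives of the form in the chart [w]. *)
Lemma primitive_dev (U : set S) (w : S -> C) (F : C -> C) p (u : I) :
  complex_chart U w -> (forall q, U q -> is_derive (w q) 1 F (dz U w (w q))) ->
  U p -> 0 < bary p u -> exists m, \forall x \near p, F (w x) = dev (e u) x + m.
Proof.
move=> cw HF Up pu; have [T [E D]] := dev_primitive De cw Up pu.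
have oe := complex_chart_embedding cw; have [oU _ wc _] := oe.
have [r r0 Hr] := open_embedding_disc oe Up D.
have HF' z : nm (z - w p) < r -> is_derive z 1 F (dz U w z).
  by move=> /Hr[x [Ux _ <-]]; exact: HF.
have HT z : nm (z - w p) < r -> is_derive z 1 T (dz U w z).
  by move=> /Hr[x [_ Dx <-]].
exists (F (w p) - T (w p)).
have wr : \forall x \near p, nm (w x - w p) < r by exact: (wc p Up _ (near_disc _ r0)).
apply: filterS (filterI E wr) => x [-> xr].
have := primitive_unique HF' HT xr => <-; ring.
Qed.

Section Covered.
Variables (w1 w2 : C).
Hypothesis indep : independent w1 w2.
Local Notation T := (torus w1 w2).
Local Notation proj := (@torus_proj R w1 w2).
Local Notation Gamma := (lattice w1 w2).
Variables (f : S -> T) (l : C).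
Hypothesis Hl : forall p u, 0 < bary p u -> slope_at e f u p l.

(** Along [g] both [l * F] and [f] are [l] times the development up to constants,
    the latter modulo the lattice. *)
Lemma period_step (U : set S) (w : S -> C) (F : C -> C) (g : R -> S) (a b : R) (c : C) :
  {within `[0, 1], continuous g} -> 0 <= a -> a <= b -> b <= 1 ->
  complex_chart U w -> (forall q, U q -> is_derive (w q) 1 F (dz U w (w q))) ->
  (forall s, a <= s <= b -> U (g s)) ->
  proj (l * F (w (g a)) + c) = f (g a) -> proj (l * F (w (g b)) + c) = f (g b).
Proof.
move=> gc a0 ab b1 cw HF Ug.
pose P s := proj (l * F (w (g s)) + c) = f (g s).
apply: (locally_constant_itv (P := P) ab) => s sab.
have [u su] := exists_bary_pos (g s).
have [m Hm] := primitive_dev cw HF (Ug s sab) su.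
have [m' Hm'] := Hl su.
have s01 : 0 <= s <= 1 by case/andP: sab => h1 h2; rewrite (le_trans a0 h1) (le_trans h2 b1).
have [d d0 Hd] := proj1 (path_continuousP _) gc s s01 _ (nbhs_and Hm Hm').
exists d => // s' s'ab s's.
have s'01 : 0 <= s' <= 1 by case/andP: s'ab => h1 h2; rewrite (le_trans a0 h1) (le_trans h2 b1).
have key r : 0 <= r <= 1 -> `|r - s| < d -> (P r <-> Gamma (l * m + c - m')).
  move=> r01 rs; have [E E'] := Hd r r01 rs; rewrite /P E E' projP.
  by have -> : l * (dev (e u) (g r) + m) + c - (l * dev (e u) (g r) + m') = l * m + c - m' by ring.
by rewrite key// key// subrr normr0.
Qed.

(** Continued along [g], the primitive of [l * dz] lifts [f]; back at the start, it
    has moved by a lattice vector. *)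
Lemma closed_period (g : R -> S) z : closed_path g -> path_integral dz g z -> Gamma (l * z).
Proof.
move=> [gc g01] [n [tau [U [w [F [st HU HF ->]]]]]].
have [s0 s1 sm] := st.
have [z0 z0E] := proj_surj (f (g 0)).
have key j : (j <= n)%N ->
   proj (l * (\sum_(i < j) (F i (w i (g (tau i.+1))) - F i (w i (g (tau i))))) + z0) = f (g (tau j)).
  elim: j => [|j IH] jn; first by rewrite big_ord0 mulr0 add0r s0.
  have [cw Ug] := HU j jn.
  have /andP[a0 _] := subdivision_in st (ltnW jn); have /andP[_ b1] := subdivision_in st jn.
  set A := \sum_(i < j) _ in IH.
  have := period_step (c := l * A + z0 - l * F j (w j (g (tau j)))) gc a0 (ltW (sm j jn)) b1 cw
    (fun q => HF j q jn) Ug.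
  rewrite big_ord_recr /= -/A => <-; first by congr proj; ring.
  rewrite -(IH (ltnW jn)); congr proj; ring.
have := key n (leqnn n); rewrite s1 -g01 -z0E => /projP.
by rewrite addrK.
Qed.

End Covered.

Lemma integer_discrete (A : set R) : A 0 -> (forall a b, A a -> A b -> A (a - b)) ->
  (forall a, A a -> exists m : int, a = m%:~R) -> discrete_subgroup A.
Proof.
move=> A0 AB Az; split=> // a Aa; split; first exact: mem_set.
exists (ball a 1); first exact: nbhsx_ballx.
apply/seteqP; split=> [b [ab Ab]|_ ->]; last by split=> //; exact: ballxx.
have [m am] := Az _ Aa; have [n bn] := Az _ Ab.
move: ab; rewrite -ball_normE /ball_ /= am bn -rmorphB /= -intr_norm -[ltRHS]/(1%:~R) ltr_int => h.
congr (_%:~R); lia.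
Qed.

Hypothesis Hconn : connected [set: S].
Hypothesis Hne : [set: S] !=set0.

(** Loops at different points are joined by [travels_nonvertex], which needs end
    points that are not vertices; inside its first chart, the loop is left towards
    such a point. *)
Lemma base_nonvertex (g : R -> S) z : path_integral dz g z ->
  exists q z', ~ is_vertex q /\ travels dz (g 0) q z'.
Proof.
move=> [n [tau [U [w [F [st HU HF _]]]]]]; have [s0 s1 sm] := st.
have n0 : (0 < n)%N.
  by case: n st s1 {HU HF sm} => // _; rewrite s0 => /eqP; rewrite eq_sym oner_eq0.
have [cw Ug] := HU 0%N n0.
have Up : U 0%N (g 0) by rewrite -s0; apply: Ug; rewrite lexx ltW// sm.
have [oU _ _ _] := complex_chart_embedding cw.
have [q [t [tf pt qt nq Hmix]]] := near_nonvertex_mix (open_near oU Up).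
exists q; eexists; split=> //.
exact: (travels_chart cw (fun q => HF 0%N q n0) tf pt qt Hmix).
Qed.

(** Follow one loop, then a path to the other one, that loop backwards, and the path
    back: the contributions of the connecting path cancel. *)
Lemma periods_subgroup (h v : C) :
  H_periods dz h v 0 /\ forall a b, H_periods dz h v a -> H_periods dz h v b ->
    H_periods dz h v (a - b).
Proof.
split.
  have [p0 _] := Hne; have [p _ np] := near_nonvertex (p := p0) filterT.
  have [z pz] := travels_nonvertex De Hconn np np.
  have [g [cg ig]] := travels_closed (travels_cat pz (travels_rev pz)).
  exists g, 0; split=> //; by rewrite !mul0r addr0 -(subrr z).
move=> a a' [g [b [cg ig]]] [g' [b' [cg' ig']]].
have [q [z [nq gq]]] := base_nonvertex ig.
have [q' [z' [nq' gq']]] := base_nonvertex ig'.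
have [z1 qq'] := travels_nonvertex De Hconn nq nq'.
have c1 := closed_travels cg ig; have c2 := closed_travels cg' ig'.
have go := travels_cat gq (travels_cat qq' (travels_rev gq')).
have [g2 [cg2 ig2]] := travels_closed
  (travels_cat c1 (travels_cat go (travels_cat (travels_rev c2) (travels_rev go)))).
exists g2, (b - b'); split=> //.
move: ig2; congr path_integral; rewrite !rmorphB /=; ring.
Qed.

Lemma V_periodsE (h v : C) : V_periods dz h v = H_periods dz v h.
Proof.
by apply/seteqP; split=> b [g [a [cg ig]]]; exists g, a; rewrite addrC.
Qed.

Lemma independent_sym (h v : C) : independent h v -> independent v h.
Proof. by move=> H a b; rewrite addrC => /H[]. Qed.

Lemma H_periods_discrete (h v : C) : independent h v ->
  (forall g z, closed_path g -> path_integral dz g z -> lattice h v z) ->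
  discrete_subgroup (H_periods dz h v).
Proof.
move=> ind Hz; have [P0 PB] := periods_subgroup h v.
apply: integer_discrete => // a [g [b [cg ig]]].
by have [m [n [-> _]]] := lattice_coord ind (Hz _ _ cg ig); exists m.
Qed.

(** Every period lies in the lattice spanned by [w1 / l] and [w2 / l], so its
    coordinates in these two directions are integers. *)
Lemma covering_periods : ramified_covering_of_torus X ->
  exists h v : C, [/\ independent h v,
    discrete_subgroup (V_periods dz h v) & discrete_subgroup (H_periods dz h v)].
Proof.
move=> [w1 [w2 [f [kk [indep kk0 fhol fcov fiso]]]]].
have [l l0 Hl] := slope_everywhere De indep (proj1 fhol) kk0 fhol fcov fiso Hconn Hne.
have ind : independent (w1 / l) (w2 / l).
  move=> a b E; apply: indep; apply: (mulIf (invr_neq0 l0)).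
  by rewrite mul0r mulrDl -!mulrA.
have per g z : closed_path g -> path_integral dz g z -> lattice (w1 / l) (w2 / l) z.
  move=> cg ig; have [m [n E]] := closed_period Hl cg ig; exists m, n.
  apply: (mulfI l0); rewrite E mulrDr !mulrz_complex.
  by field.
exists (w1 / l), (w2 / l); split=> //; last exact: H_periods_discrete.
rewrite V_periodsE; apply: H_periods_discrete; first exact: independent_sym.
move=> g z cg ig; have [m [n ->]] := per _ _ cg ig; exists n, m; exact: addrC.
Qed.

End Periods.

(** * Integration modulo a lattice of periods *)

Section Discrete.
Variable R : realType.

(** The least positive element is a generator. It exists because elements closer
    than [ep] are equal: among the intervals of length [ep / 2], the first one that
    meets the positive elements contains just one of them. *)
Lemma discrete_cyclic (A : set R) : discrete_subgroup A ->
  exists2 a : R, 0 < a & forall x, A x -> exists m : int, x = m%:~R * a.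
Proof.
move=> [A0 AB Ai].
have [_ [V nV VA]] := Ai 0 A0.
have /nbhs_ballP[ep ep0 Hep] := nV.
have gap x : A x -> `|x| < ep -> x = 0.
  move=> Ax xe; have : (V `&` A) x.
    by split=> //; apply: Hep; rewrite -ball_normE /ball_ /= sub0r normrN.
  by rewrite VA.
have AN x : A x -> A (- x) by move=> Ax; rewrite -sub0r; exact: AB.
have [[x0 [Ax0 x00]]|none] := pselect (exists x, A x /\ 0 < x); last first.
  exists 1 => // x Ax; exists 0; rewrite mulr0z mul0r.
  have [x0|x0|//] := ltgtP x 0; exfalso; apply: none.
    by exists (- x); split; [exact: AN|rewrite oppr_gt0].
  by exists x.
have ep2 : 0 < ep / 2 by rewrite divr_gt0.
pose P n := `[< exists x, [/\ A x, 0 < x & x <= n%:R * (ep / 2)] >].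
have exP : exists n, P n.
  exists (Num.bound (x0 / (ep / 2))); apply/asboolP; exists x0; split=> //.
  by rewrite -ler_pdivrMr// ltW// archi_boundP// divr_ge0// ltW.
have [n /asboolP[x [Ax xp xn]] nmin] := ex_minnP exP.
have xmin y : A y -> 0 < y -> x <= y.
  move=> Ay y0; rewrite leNgt; apply/negP => yx.
  have : x - y = 0.
    apply: gap; first exact: AB.
    rewrite gtr0_norm ?subr_gt0//.
    have n0 : (0 < n)%N by case: n xn {nmin} => //; rewrite mul0r; lra.
    have ny : (n.-1)%:R * (ep / 2) < y.
      rewrite ltNge; apply/negP => h.
      have : P n.-1 by apply/asboolP; exists y.
      by move/nmin; rewrite leqNgt prednK ?leqnn.
    have : n%:R = (n.-1)%:R + 1 :> R by rewrite natr1 prednK.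
    move=> nE; move: xn; rewrite nE; lra.
  by move/eqP; rewrite subr_eq0 => /eqP e; rewrite e ltxx in yx.
exists x => // z Az; exists (Num.floor (z / x)).
have Am (m : nat) : A (m%:R * x).
  elim: m => [|m IH]; first by rewrite mul0r.
  by rewrite -natr1 mulrDl mul1r -[x in _ + x]opprK; apply: AB => //; exact: AN.
have Az' (m : int) : A (m%:~R * x).
  case: m => m; first exact: Am.
  by rewrite NegzE rmorphN /= mulNr; apply: AN; exact: Am.
have /andP[f1 f2] := floor_itv (z / x).
have x0' : x != 0 by rewrite gt_eqF.
have h1 : 0 <= z - (Num.floor (z / x))%:~R * x.
  by rewrite subr_ge0 -ler_pdivlMr.
have h2 : z - (Num.floor (z / x))%:~R * x < x.
  by move: f2; rewrite ltr_pdivrMr// rmorphD /= mulrDl mul1r; lra.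
apply/eqP; rewrite -subr_eq0; apply/eqP/le_anti; rewrite h1 andbT leNgt; apply/negP => h3.
by have := xmin _ (AB _ _ Az (Az' _)) h3; lra.
Qed.

Local Notation C := (CC R).

Lemma cross_rotate (a b : C) (t : R) :
  cross (a + t%:C%C * ((0 +i* 1)%C * b)) b = cross a b - t * nm b ^+ 2.
Proof. by rewrite nm_sqr /cross; case: a => p q; case: b => x y /=; ring. Qed.

(** Move the centre of the disc off one line after the other; being off a line is an
    open condition. *)
Lemma avoid_lines (F : seq C) (c : C) (r : R) : 0 < r -> (forall q, q \in F -> q != 0) ->
  exists (c' : C) (r' : R), [/\ 0 < r', forall z, nm (z - c') < r' -> nm (z - c) < r &
    forall z q, nm (z - c') < r' -> q \in F -> cross z q != 0].
Proof.
move=> r0; elim: F => [|q F IH] HF; first by exists c, r.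
have [|c1 [r1 [r10 sub1 H1]]] := IH; first by move=> q' q'F; apply: HF; rewrite inE q'F orbT.
have q0 : q != 0 by apply: HF; rewrite inE eqxx.
have nq : 0 < nm q by rewrite nm_gt0.
have [c2 [c2r c2q]] : exists c2, nm (c2 - c1) < r1 /\ cross c2 q != 0.
  have [e|] := eqVneq (cross c1 q) 0; last by exists c1; rewrite subrr nm0.
  pose t := r1 / 2 / nm q; have t0 : 0 < t by rewrite !divr_gt0.
  (* if [c1] lies on the line through [q], step aside orthogonally *)
  exists (c1 + t%:C%C * ((0 +i* 1)%C * q)); split.
    rewrite addrC addKr !nmM nm_real gtr0_norm// /t.
    have -> : nm (0 +i* 1)%C = 1 :> R by rewrite /= expr0n expr1n add0r sqrtr1.
    by rewrite mul1r divfK ?gt_eqF//; lra.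
  by rewrite cross_rotate e sub0r oppr_eq0 gt_eqF// mulr_gt0// exprn_gt0.
pose r2 := Num.min (r1 - nm (c2 - c1)) (`|cross c2 q| / (2 * nm q)).
have r20 : 0 < r2.
  by rewrite lt_min subr_gt0 c2r divr_gt0 ?normr_gt0// mulr_gt0.
have in1 z : nm (z - c2) < r2 -> nm (z - c1) < r1.
  by rewrite lt_min => /andP[h _]; have := nmBD c2 z c1; lra.
exists c2, r2; split=> //; first by move=> z /in1/sub1.
move=> z q' zr; rewrite inE => /orP[/eqP ->|]; last exact/H1/in1.
apply/eqP => e; move: zr; rewrite lt_min => /andP[_]; apply/negP; rewrite -leNgt.
rewrite ler_pdivrMr ?mulr_gt0//.
have -> : cross c2 q = - cross (z - c2) q.
  have -> : cross (z - c2) q = cross z q - cross c2 q.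
    by rewrite /cross; case: (z) => ? ?; case: (c2) => ? ?; case: (q) => ? ? /=; ring.
  by rewrite e sub0r opprK.
rewrite normrN; have := cross_le (z - c2) q; lra.
Qed.

Lemma open_affine (A : set C) (a m : C) : a != 0 -> open A ->
  open ((fun z => a * z + m) @` A).
Proof.
move=> a0 oA; apply/open_CP => _ [z Az <-].
have [r r0 H] := proj1 (open_CP _) oA z Az.
have na : 0 < nm a by rewrite nm_gt0.
exists (nm a * r); first by rewrite mulr_gt0.
move=> y yr; exists ((y - m) / a); last by field.
apply: H; have -> : (y - m) / a - z = (y - (a * z + m)) / a by field.
by rewrite nmM nmV ltr_pdivrMr// (mulrC r).
Qed.

End Discrete.

Section Covering.
Variables (R : realType) (X : flat_surface R) (dz : one_form X).
Local Notation C := (CC R).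
Local Notation S := (realization X).
Local Notation I := 'I_(nv X).
Implicit Types (x y p : S) (t : {set I}).
Variables (e : I -> I -> C) (k : R).
Hypothesis De : development dz e k.
Hypothesis Hconn : connected [set: S].
Hypothesis Hne : [set: S] !=set0.
Variables (w1 w2 : C).
Hypothesis indep : independent w1 w2.
Local Notation T := (torus w1 w2).
Local Notation proj := (@torus_proj R w1 w2).
Local Notation Gamma := (lattice w1 w2).
Hypothesis Hper : forall g z, closed_path g -> path_integral dz g z -> Gamma z.

Let k0 : 0 < k. Proof. exact: dev_scale De. Qed.

Lemma edge0 u : e u u = 0.
Proof.
have [t tf ut] := face_cover u; have := dev_cocycle De tf ut ut ut.
by move/eqP; rewrite -subr_eq0 addrK => /eqP.
Qed.

Lemma edge_sym t u v : t \in face X -> u \in t -> v \in t -> e v u = - e u v.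
Proof.
move=> tf ut vt; have := dev_cocycle De tf ut vt ut.
by rewrite edge0 addrC => /eqP; rewrite addr_eq0 => /eqP.
Qed.

(** Turn around [u] through faces that share an edge at [u]; [dev (e u)] is a
    primitive on all of them. *)
Lemma travels_around s t u b c : s \in face X -> t \in face X -> u \in s -> u \in t ->
  is_barycenter s b -> is_barycenter t c -> travels dz b c (dev (e u) c - dev (e u) b).
Proof.
move=> sf tf us ut bs ct.
have /connectP[q] := face_link sf tf us ut.
elim: q s sf us b bs => [|a q IH] s sf us b bs /=.
  move=> _ ts; rewrite -ts in bs.
  have -> : c = b by apply: bary_inj => v; rewrite ct bs.
  have : (1 < #|t|)%N by rewrite (face_card tf).
  rewrite (cardsD1 u) ut /= => /card_gt0P[v]; rewrite !inE => /andP[vu vt].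
  by apply: (travels_adjacent De tf tf (u := u) (v := v)) => //; rewrite eq_sym.
move=> /andP[/and5P[_ af _ ua /eqP sa] pq] tl.
have [b' b'a] := exists_barycenter af.
have : (1 < #|s :&: a|)%N by rewrite sa.
rewrite (cardsD1 u) !inE us ua /= => /card_gt0P[v]; rewrite !inE => /and3P[vu vs va].
have uv : u != v by rewrite eq_sym.
have st1 := travels_adjacent De sf af uv us vs ua va bs b'a.
have st2 := IH a af ua b' b'a pq tl.
have -> : dev (e u) c - dev (e u) b = (dev (e u) b' - dev (e u) b) + (dev (e u) c - dev (e u) b') by ring.
exact: travels_cat st1 st2.
Qed.

(** [Q v] is the integral of [dz] from a base point to [v]: along a path that ends
    at the barycentre of a face at [v], and on to [v] in the development. The choice
    of the path matters only up to the lattice of periods. *)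
Lemma vertex_positions : exists Q : I -> C, forall t u v, t \in face X -> u \in t -> v \in t ->
  Gamma (Q v - Q u - e u v).
Proof.
have [p0 _] := Hne; have [t0 t0f _] := point_face p0; have [b0 b0E] := exists_barycenter t0f.
pose reach u z := exists t b, [/\ t \in face X, u \in t, is_barycenter t b &
  travels dz b0 b (z + dev (e u) b)].
have bnv t b : t \in face X -> is_barycenter t b -> ~ is_vertex b.
  move=> tf bt; have [u [v [ut vt uv]]] := face_two_vertices tf.
  by apply: (edge_star_not_vertex uv); split; exact: barycenter_pos bt _.
have ex u : exists z, reach u z.
  have [t tf ut] := face_cover u.
  have [b bt] := exists_barycenter tf.
  have [z bz] := travels_nonvertex De Hconn (bnv _ _ t0f b0E) (bnv _ _ tf bt).
  by exists (z - dev (e u) b), t, b; split=> //; rewrite subrK.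
have [Q HQ] := choice ex; exists Q => s u v sf us vs.
have [c cs] := exists_barycenter sf.
have to_c w : w \in s -> travels dz b0 c (Q w + dev (e w) c).
  move=> ws; have [t [b [tf wt bt tb]]] := HQ w.
  have := travels_cat tb (travels_around tf sf wt ws bt cs).
  by congr travels; ring.
have [g [cg ig]] := travels_closed (travels_cat (to_c v vs) (travels_rev (to_c u us))).
have := Hper cg ig; congr (Gamma _).
rewrite (dev_base_face De sf (barycenter_in_face cs) us vs) (edge_sym sf us vs); ring.
Qed.

Section Map.
Variable Q : I -> C.
Hypothesis HQ : forall t u v, t \in face X -> u \in t -> v \in t -> Gamma (Q v - Q u - e u v).

(** Integration of [dz] from the base point to [x], modulo the lattice; [dev_mapE]
    frees it from the choice of a vertex near [x]. *)
Definition dev_map x : T := let u := xchoose (exists_bary_pos x) in proj (Q u + dev (e u) x).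

Lemma dev_mapE t u x : t \in face X -> in_face t (val x) -> u \in t ->
  dev_map x = proj (Q u + dev (e u) x).
Proof.
move=> tf xt ut; rewrite /dev_map; set v := xchoose _.
have xv : 0 < bary x v by exact: (xchooseP (exists_bary_pos x)).
have vt := bary_pos_in xt xv.
apply/projP; rewrite (dev_base_face De tf xt ut vt) (edge_sym tf ut vt).
have -> : Q v + (- e u v + dev (e u) x) - (Q u + dev (e u) x) = Q v - Q u - e u v by ring.
exact: HQ tf ut vt.
Qed.

Lemma dev_map_star u x : 0 < bary x u -> dev_map x = proj (Q u + dev (e u) x).
Proof.
move=> xu; have [t tf xt] := point_face x.
exact: dev_mapE tf xt (bary_pos_in xt xu).
Qed.

Lemma dev_translate_continuous u : continuous (fun x => Q u + dev (e u) x).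
Proof.
have -> : (fun x => Q u + dev (e u) x) = dev (fun b => 1 * e u b + Q u).
  by apply/funext => x; rewrite dev_affine mul1r addrC.
exact: dev_continuous.
Qed.

Lemma dev_map_continuous : continuous dev_map.
Proof.
move=> p A; have [u pu] := exists_bary_pos p; rewrite (dev_map_star pu) => nA.
have := @torus_proj_continuous R w1 w2 _ _ nA => nA1.
have nA2 := @dev_translate_continuous u p _ nA1.
by apply: filterS (nbhs_and nA2 (near_star pu)) => x [/= Ax xu]; rewrite /= (dev_map_star xu).
Qed.

(** In a complex chart, [dev_map] is a primitive of [dz] followed by the
    projection. *)
Lemma dev_map_holomorphic : holomorphic_map dev_map.
Proof.
split; first exact: dev_map_continuous.
move=> U w W s p cw tc Up Wp; have [u pu] := exists_bary_pos p.
have [F [E D]] := dev_primitive De cw Up pu.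
have nE : \forall x \near p, dev_map x = proj (Q u + dev (e u) x).
  by apply: filterS (near_star pu) => x; exact: dev_map_star.
have L := torus_chart_local indep tc (dev_map_continuous (x:=p))
  (@dev_translate_continuous u p) Wp nE.
set c := s (dev_map p) - (Q u + dev (e u) p) in L.
exists (fun z => F z + (Q u + c)); split.
  by apply: filterS (nbhs_and L E) => x [-> ->]; ring.
have /= D1 := nbhs_singleton D.
have D2 := is_deriveD D1 (is_derive_cst (Q u + c) (w p) 1).
by case: D2.
Qed.

(** By compactness: near every point of the surface, the map stays away from a disc
    around [z]. *)
Lemma dev_map_closed z : (forall x, dev_map x <> proj z) ->
  exists2 r : R, 0 < r & forall z', nm (z' - z) < r -> forall x, dev_map x <> proj z'.
Proof.
move=> Hz.
have /compact_near_coveringP cov := @compactS R X.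
have FF : Filter (0^'+ : set_system R) by exact: at_right_proper_filter.
have : \forall r \near 0^'+, [set: S] `<=` (fun x => forall z', nm (z' - z) < r -> dev_map x <> proj z').
  apply: (cov _ _ (fun r x => forall z', nm (z' - z) < r -> dev_map x <> proj z')) => x _.
  have [u xu] := exists_bary_pos x.
  have nG : ~ Gamma (Q u + dev (e u) x - z).
    by move=> /projP; rewrite -(dev_map_star xu); exact: Hz.
  have [d d0 Hd] := lattice_closed indep nG.
  have d2 : 0 < d / 2 by rewrite divr_gt0.
  have N1 := nbhs_and (near_star xu) (near_dev e u x d2).
  exists ([set y | 0 < bary y u] `&` [set y | nm (dev (e u) y - dev (e u) x) < d / 2],
          [set r | r < d / 2]); first by split=> //; exact: nbhs_right_lt.
  move=> [y r] /= [[yu yx] rd] z' z'r; rewrite (dev_map_star yu) => /projP g.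
  have := Hd _ g.
  have -> : Q u + dev (e u) x - z - (Q u + dev (e u) y - z') =
     (z' - z) - (dev (e u) y - dev (e u) x) by ring.
  by have := nmD (z' - z) (- (dev (e u) y - dev (e u) x)); rewrite nmN; lra.
move=> H; have [r [r0 Hr]] := filter_ex (filterI (nbhs_right_gt (0 : R)) H).
by exists r => // z' z'r x; exact: (Hr x Logic.I z').
Qed.

Lemma edge_star_embedding u v w w' : hinge u v w w' ->
  open_embedding (edge_star u v) (fun x => Q u + dev (e u) x).
Proof.
move=> h; have [h1 h2 h3 h4] := kite_open_embedding h (dev_placed De h).
split.
- exact: h1.
- by move=> x y xs ys /addrI; exact: h2.
- by move=> x _; exact: dev_translate_continuous.
move=> V oV Vs.
have -> : (fun x => Q u + dev (e u) x) @` V = (fun z => 1 * z + Q u) @` (dev (e u) @` V).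
  rewrite image_comp; congr (_ @` _); apply/funext => x /=; by rewrite mul1r addrC.
by apply: open_affine; [exact: oner_neq0|exact: h4].
Qed.

Lemma dev_map_open p z : ~ is_vertex p -> dev_map p = proj z ->
  exists2 r : R, 0 < r & forall z', nm (z' - z) < r -> exists x, dev_map x = proj z'.
Proof.
move=> /nonvertex_edge[u [v [w [w' [h ps]]]]] pz.
have oe := edge_star_embedding h.
have [r r0 Hr] := open_embedding_disc (p := p) oe ps (filterT : nbhs p setT).
exists r => // z' z'r.
have [|x [[xu xv] _ xz]] := Hr (Q u + dev (e u) p + (z' - z)); first by rewrite addrC addKr.
exists x; rewrite (dev_map_star xu) xz; apply/projP.
move: pz; rewrite (dev_map_star (proj1 ps)) => /projP.
by congr Gamma; ring.
Qed.

Lemma dev_map_vertex p : is_vertex p -> exists v, dev_map p = proj (Q v).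
Proof.
move=> [v pv]; exists v; have pE a : bary p a = (a == v)%:R by rewrite /bary pv mxE eqxx.
have pv0 : 0 < bary p v by rewrite pE eqxx.
by rewrite (dev_map_star pv0) (dev_vertex _ pE) edge0 addr0.
Qed.

Lemma vertex_point v : exists p, is_vertex p /\ dev_map p = proj (Q v).
Proof.
have [p pE] := exists_vertex v; exists p.
have vp : is_vertex p.
  by exists v; apply/rowP => j; rewrite mxE eqxx /=; exact: pE.
split=> //; have pv0 : 0 < bary p v by rewrite pE eqxx.
by rewrite (dev_map_star pv0) (dev_vertex _ pE) edge0 addr0.
Qed.

Lemma vertex_lifts z0 (r : R) : exists F : seq C, forall v z, nm (z - z0) < r ->
  Gamma (z - Q v) -> z \in F.
Proof.
pose M := \sum_v nm (z0 - Q v) + r.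
have [s Hs] := lattice_finite indep M.
exists [seq Q v + g | v <- enum I, g <- s] => v z zr g.
apply/allpairsP; exists (v, z - Q v); split=> /=; first by rewrite mem_enum.
  apply: Hs => //; apply: le_lt_trans (nmBD z0 _ _) _; rewrite /M addrC.
  rewrite (bigD1 v)//=; have : 0 <= \sum_(i | i != v) nm (z0 - Q i).
    by apply: sumr_ge0 => i _; exact: nm_ge0.
  lra.
by rewrite addrC subrK.
Qed.

(** On a segment in the plane that avoids all lifts of the images of the vertices,
    the values of [dev_map] form a set that is open, by [dev_map_open], and closed.
    Such a segment leads from the value at some point to any [z] that is not such a
    lift itself: only finitely many lifts are in the way, and moving the start of
    the segment a little makes it miss them. *)
Lemma dev_map_surjective : dev_map @` setT = setT.
Proof.
apply/seteqP; split=> // y _; have [z zy] := proj_surj y.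
have [[v Gv]|nv] := pselect (exists v, Gamma (z - Q v)).
  have [p [_ pv]] := vertex_point v; exists p => //; rewrite pv -zy; apply/projP.
  by rewrite -opprB; exact: latticeN.
have [p0 _] := Hne; have [p _ np] := near_nonvertex (p := p0) filterT.
have [c cE] := proj_surj (dev_map p).
have [r r0 Hr] := dev_map_open np (esym cE).
have [F HF] := vertex_lifts z (nm (c - z) + r).
have [|c' [r' [r'0 sub H]]] := avoid_lines (F := [seq q - z | q <- F & q != z]) (c - z) r0.
  by move=> q /mapP[q' ]; rewrite mem_filter => /andP[q'z _] ->; rewrite subr_eq0.
pose z0 := c' + z.
have c'r : nm (c' - (c - z)) < r by apply: sub; rewrite subrr nm0.
have z0c : nm (z0 - c) < r.
  by have -> : z0 - c = c' - (c - z) by rewrite /z0; ring.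
have z0z : nm (z0 - z) < nm (c - z) + r by have := nmBD c z0 z; lra.
have zz : nm (z - z) < nm (c - z) + r by rewrite subrr nm0 ltr_wpDl// nm_ge0.
have avoid s v : 0 <= s <= 1 -> ~ Gamma (seg z0 z s - Q v).
  move=> s01 g; have sF := HF _ _ (seg_disc s01 z0z zz) g.
  have [sz|sz] := eqVneq (seg z0 z s) z.
    by apply: nv; exists v; rewrite -sz.
  have mem : seg z0 z s - z \in [seq q - z | q <- F & q != z].
    by apply/mapP; exists (seg z0 z s) => //; rewrite mem_filter sz.
  have := H c' _ _ mem; rewrite subrr nm0 => /(_ r'0)/eqP; apply.
  have -> : seg z0 z s - z = (1 - s)%:C%C * c'.
    by rewrite /seg /z0 rmorphB rmorph1 /=; ring.
  by rewrite /cross; case: (c') => a b /=; ring.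
pose P s := exists x, dev_map x = proj (seg z0 z s).
suff : P 1 by rewrite /P seg1 => -[x xz]; exists x => //; rewrite xz.
apply: (locally_constant_itv (P := P) ler01); last by rewrite /P seg0; exact: Hr.
move=> s s01.
have D : 0 < 1 + nm (z - z0) by rewrite ltr_wpDr// nm_ge0.
have close d' s' : `|s' - s| < d' / (1 + nm (z - z0)) -> nm (seg z0 z s' - seg z0 z s) < d'.
  rewrite ltr_pdivlMr// => h; rewrite segB nmM nm_real.
  by have := normr_ge0 (s' - s); lra.
have [Ps|Ps] := pselect (P s).
  have [x xs] := Ps.
  have nx : ~ is_vertex x.
    move=> /dev_map_vertex[v]; rewrite xs => /projP; exact: avoid.
  have [d d0 Hd] := dev_map_open nx xs.
  exists (d / (1 + nm (z - z0))); first by rewrite divr_gt0.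
  by move=> s' s'01 /close ss'; split=> // _; exact: Hd.
have [|d d0 Hd] := @dev_map_closed (seg z0 z s); first by move=> x xs; apply: Ps; exists x.
exists (d / (1 + nm (z - z0))); first by rewrite divr_gt0.
by move=> s' s'01 /close ss'; split=> // -[x xs']; case: (Hd _ ss' x).
Qed.

Lemma nm_dev_le u x : nm (dev (e u) x) <= \sum_a nm (e u a).
Proof.
apply: le_trans (nm_sum _ _ _) _; apply: ler_sum => a _.
by rewrite nmM nm_real ger0_norm ?bary_ge0// ler_piMl ?nm_ge0// bary_le1.
Qed.

(** On a face, the development is injective and bounded, and only finitely many
    lattice points are in reach. *)
Lemma dev_map_finite (y : T) : finite_set (dev_map @^-1` [set y]).
Proof.
have [z zy] := proj_surj y.
have -> : dev_map @^-1` [set y] =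
  \bigcup_(t in [set` face X]) [set x | in_face t (val x) /\ dev_map x = y].
  apply/seteqP; split=> [x xy|x [t _ []]//].
  by have [t tf xt] := point_face x; exists t.
apply: bigcup_finite => // t tf.
have [u [v [ut vt uv]]] := face_two_vertices tf.
have [w [w' h]] := exists_hinge tf ut vt uv.
have [s Hs] := lattice_finite indep (nm (Q u - z) + \sum_a nm (e u a) + 1).
have [[x0 [x0t x0y]]|none] := pselect (exists x, in_face t (val x) /\ dev_map x = y); last first.
  have -> // : [set x | in_face t (val x) /\ dev_map x = y] = set0.
  by apply/seteqP; split=> // x xy; apply: none; exists x.
apply: (sub_finite_set (B := (fun g => xget x0 [set x | in_face t (val x) /\
   Q u - z + dev (e u) x = g]) @` [set` s])); last exact/finite_image/finite_seq.
move=> x [xt xy]; exists (Q u - z + dev (e u) x).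
  rewrite /=; apply: Hs.
    have : proj (Q u + dev (e u) x) = proj z by rewrite zy -(dev_mapE tf xt ut).
    by move=> /projP; congr Gamma; ring.
  by apply: le_lt_trans (nmD _ _) _; have := nm_dev_le u x; lra.
case: xgetP => [x1 _ [x1t /addrI E]|/(_ x)]; last by case.
apply: bary_inj => a.
have cE := coordE h (dev_placed De h) tf ut vt.
by rewrite (cE _ x1t) (cE _ xt) E.
Qed.

End Map.
End Covering.

(** * The map to the torus is a ramified covering *)

Section CoveringMap.
Variables (R : realType) (X : flat_surface R) (dz : one_form X).
Local Notation C := (CC R).
Local Notation S := (realization X).
Local Notation I := 'I_(nv X).
Implicit Types (x y p : S) (t : {set I}).
Variables (e : I -> I -> C) (k : R).
Hypothesis De : development dz e k.
Hypothesis Hne : [set: S] !=set0.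
Variables (w1 w2 : C).
Hypothesis indep : independent w1 w2.
Local Notation T := (torus w1 w2).
Local Notation proj := (@torus_proj R w1 w2).
Local Notation Gamma := (lattice w1 w2).
Variable Q : I -> C.
Hypothesis HQ : forall t u v, t \in face X -> u \in t -> v \in t -> Gamma (Q v - Q u - e u v).
Local Notation f := (dev_map e w1 w2 Q).

Let k0 : 0 < k. Proof. exact: dev_scale De. Qed.

Lemma points_separated (n : nat) (pt : 'I_n -> S) : injective pt ->
  \forall r \near (0 : R)^'+, forall i j x, (forall a, `|bary x a - bary (pt i) a| < r) ->
    (forall a, `|bary x a - bary (pt j) a| < r) -> i = j.
Proof.
move=> pinj; apply: filter_forall => i; apply: filter_forall => j.
have [->|ij] := eqVneq i j; first by apply: filterE.
have [a ne] : exists a, bary (pt i) a != bary (pt j) a.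
  apply: contrapT => none; move/eqP: ij; apply; apply: pinj; apply: bary_inj => a.
  by apply: contrapT => /eqP ne; apply: none; exists a.
have d0 : 0 < `|bary (pt i) a - bary (pt j) a| / 2.
  by rewrite divr_gt0// normr_gt0 subr_eq0.
apply: filterS (nbhs_right_lt d0) => r rd x /(_ a) h1 /(_ a) h2; exfalso.
have := ler_normB (bary x a - bary (pt j) a) (bary x a - bary (pt i) a).
have -> : bary x a - bary (pt j) a - (bary x a - bary (pt i) a) = bary (pt i) a - bary (pt j) a by ring.
by lra.
Qed.

(** Over a small disc, compactness leaves only points near the finitely many points
    [pt i] over [y], and near each of these [dev_map] is an embedding in the plane
    followed by the projection. *)
Lemma dev_map_evenly_covered (y : T) : (forall v, y <> proj (Q v)) ->
  exists W, [/\ open W, W y & evenly_covered f W].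
Proof.
move=> yQ; have [z zy] := proj_surj y.
have [d d0 gap] := lattice_gap indep.
have /finite_seqP[s0 s0E] := dev_map_finite De indep HQ y.
pose s := undup s0.
have sE x : x \in s <-> f x = y.
  rewrite mem_undup; have := congr1 (fun A : set S => A x) s0E => /= E.
  by rewrite -E.
pose pt (i : 'I_(size s)) := tnth (in_tuple s) i.
have ptE i : f (pt i) = y by apply/sE; exact: mem_tnth.
have pt_inj : injective pt.
  by apply: tuple_uniqP; exact: undup_uniq.
have pt_ex x : f x = y -> exists i, x = pt i.
  by move=> /sE/(tnthP (in_tuple s))[i ->]; exists i.
have ex i : exists uv : I * I, (exists w w', hinge uv.1 uv.2 w w') /\ edge_star uv.1 uv.2 (pt i).
  have : ~ is_vertex (pt i).
    by move=> /(dev_map_vertex De HQ)[v]; rewrite ptE; exact: yQ.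
  by move=> /nonvertex_edge[u [v [w [w' [h ps]]]]]; exists (u, v); split=> //; exists w, w'.
have [st Hst] := choice ex.
pose D i x := Q (st i).1 + dev (e (st i).1) x.
pose St i := edge_star (st i).1 (st i).2.
have Demb i : open_embedding (St i) (D i).
  by have [[w [w' h]] _] := Hst i; exact: (edge_star_embedding De Q h).
have Sp i : St i (pt i) by case: (Hst i).
have fD i x : St i x -> f x = proj (D i x) by move=> [xu _]; exact: (dev_map_star De HQ xu).
pose c i := D i (pt i).
have cz i : Gamma (c i - z) by apply/projP; rewrite zy -(ptE i) (fD i).
(* the sheets over the disc of radius [r] around [z]; the properties below hold for
    all small [r] *)
pose V r i := [set x | St i x /\ nm (D i x - c i) < r].
have small : \forall r \near (0 : R)^'+, forall i, forall z', nm (z' - c i) < r ->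
    exists2 x, St i x & D i x = z'.
  apply: filter_forall => i.
  have [r r0 Hr] := open_embedding_disc (Demb i) (Sp i) filterT.
  apply: filterS (nbhs_right_lt r0) => r' r'r z' z'r.
  by have [|x [xs _ xz]] := Hr z'; [exact: lt_trans z'r r'r|exists x].
have disj : \forall r \near (0 : R)^'+, forall i j, V r i `&` V r j !=set0 -> i = j.
  have [r1 [r10 Hr1]] := filter_ex (filterI (nbhs_right_gt (0 : R)) (points_separated pt_inj)).
  have loc i : \forall r \near (0 : R)^'+, forall x, V r i x -> forall a, `|bary x a - bary (pt i) a| < r1.
    have N : nbhs (pt i) [set x | forall a, `|bary x a - bary (pt i) a| < r1].
      by apply/nbhs_SP; exists r1.
    have [r r0 Hr] := open_embedding_disc (Demb i) (Sp i) N.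
    apply: filterS (nbhs_right_lt r0) => r' r'r x [xs xr].
    have [x' [x's x'N x'x]] := Hr (D i x) (lt_trans xr r'r).
    have [_ inj _ _] := Demb i.
    by rewrite (inj x x')//; exact/mem_set.
  have locA : \forall r \near (0 : R)^'+, forall i x, V r i x -> forall a, `|bary x a - bary (pt i) a| < r1.
    exact: filter_forall loc.
  apply: filterS locA => r Hr i j [x [xi xj]].
  by apply: (Hr1 i j x); exact: Hr.
have cover : \forall r \near (0 : R)^'+, [set: S] `<=` (fun x => forall z', nm (z' - z) < r ->
    f x = proj z' -> exists i, V r i x).
  have /compact_near_coveringP cov := @compactS R X.
  have FF : Filter (0^'+ : set_system R) by exact: at_right_proper_filter.
  apply: (cov _ _ (fun r x => forall z', nm (z' - z) < r -> f x = proj z' -> exists i, V r i x)) => x _.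
  have [xy|xy] := pselect (f x = y).
    have [i xi] := pt_ex x xy.
    have d4 : 0 < d / 4 by rewrite divr_gt0.
    have oS : open (St i) by case: (Demb i).
    have N1 := nbhs_and (open_near oS (Sp i)) (near_dev e (st i).1 (pt i) d4).
    exists (St i `&` [set x | nm (dev (e (st i).1) x - dev (e (st i).1) (pt i)) < d / 4],
      [set r | r < d / 4]); first by rewrite xi; split=> //; exact: nbhs_right_lt.
    move=> [x' r] /= [[x's x'd] rd] z' z'r; rewrite (fD i)// => /projP g.
    have Dc : D i x' - c i = dev (e (st i).1) x' - dev (e (st i).1) (pt i) by rewrite /c /D; ring.
    have := latticeB g (cz i).
    have -> : D i x' - z' - (c i - z) = (D i x' - c i) - (z' - z) by ring.
    move=> /gap E; exists i; split=> //.
    have : D i x' - c i = z' - z.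
      apply/eqP; rewrite -subr_eq0; apply/eqP/E.
      have := nmD (D i x' - c i) (- (z' - z)); rewrite nmN Dc; lra.
    by move=> ->.
  have [u xu] := exists_bary_pos x.
  have nG : ~ Gamma (Q u + dev (e u) x - z).
    by move=> /projP; rewrite -(dev_map_star De HQ xu) zy.
  have [d' d'0 Hd] := lattice_closed indep nG.
  have d2 : 0 < d' / 2 by rewrite divr_gt0.
  have N1 := nbhs_and (near_star xu) (near_dev e u x d2).
  exists ([set y | 0 < bary y u] `&` [set y | nm (dev (e u) y - dev (e u) x) < d' / 2],
          [set r | r < d' / 2]); first by split=> //; exact: nbhs_right_lt.
  move=> [x' r] /= [[yu yx] rd] z' z'r; rewrite (dev_map_star De HQ yu) => /projP g.
  have := Hd _ g.
  have -> : Q u + dev (e u) x - z - (Q u + dev (e u) x' - z') =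
     (z' - z) - (dev (e u) x' - dev (e u) x) by ring.
  by have := nmD (z' - z) (- (dev (e u) x' - dev (e u) x)); rewrite nmN; lra.
have d2 : 0 < d / 2 by rewrite divr_gt0.
have [r [r0 [rd [Hs [Hd Hc]]]]] := filter_ex (filterI (nbhs_right_gt (0 : R))
   (filterI (nbhs_right_lt d2) (filterI small (filterI disj cover)))).
have fV i x : V r i x -> f x = proj (D i x - c i + z).
  move=> [xs _]; rewrite (fD i)//; apply/projP; have := cz i; congr Gamma; ring.
exists (proj @` [set z' | nm (z' - z) < r]); split.
- exact/proj_open_map/open_disc.
- by exists z => //=; rewrite subrr nm0.
exists (size s), (V r); split.
- by move=> i j _ _; exact: Hd.
- apply/seteqP; split=> x.
    by move=> [z' z'r /esym fx]; have [i xi] := Hc x Logic.I z' z'r fx; exists i.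
  move=> [i _ xi]; exists (D i x - c i + z); last by rewrite (fV i).
  by rewrite /= addrK; case: xi.
move=> i; have [oS inj _ Dop] := Demb i; split; last first.
  apply/seteqP; split=> [_ [x xi <-]|_ [z' z'r <-]].
    by exists (D i x - c i + z); [rewrite /= addrK; case: xi|rewrite (fV i)].
  have [|x xs xE] := Hs i (c i + (z' - z)); first by rewrite addrC addKr.
  have xV : V r i x by split=> //; rewrite xE addrC addKr.
  by exists x => //; rewrite (fV i)// xE; congr proj; ring.
split.
- rewrite openE => x [xs xr].
  have r'0 : 0 < r - nm (D i x - c i) by rewrite subr_gt0.
  apply: filterS (nbhs_and (open_near oS xs) (near_dev e (st i).1 x r'0)) => x' [x's x'r].
  split=> //; have := nmBD (D i x) (D i x') (c i).
  have -> : D i x' - D i x = dev (e (st i).1) x' - dev (e (st i).1) x by rewrite /D; ring.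
  by lra.
- move=> x x' /set_mem[xs xr] /set_mem[x's x'r].
  rewrite (fD i)// (fD i)// => E.
  apply: inj; [exact/mem_set|exact/mem_set|].
  by apply: (proj_disc_inj (c := c i) gap _ _ E); exact: lt_trans rd.
- by move=> x _; exact: (dev_map_continuous De HQ).
move=> A oA AV.
have -> : f @` A = proj @` (D i @` A).
  rewrite image_comp; apply/seteqP; split=> _ [x Ax <-]; exists x => //=.
    by rewrite -(fD i)//; case: (AV _ Ax).
  by rewrite (fD i)//; case: (AV _ Ax).
by apply: proj_open_map; apply: Dop => // x /AV[].
Qed.

Lemma dev_map_covering : finite_ramified_covering f.
Proof.
split; [exact: (dev_map_surjective De Hne indep HQ)|exact: (dev_map_finite De indep HQ)|].
exists ((fun v => proj (Q v)) @` setT); first exact/finite_image/finite_finset.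
move=> y yQ; apply: dev_map_evenly_covered => v yv; apply: yQ.
by exists v.
Qed.

(** By compatibility [dz] has a constant coefficient [a] in some isometric chart,
    where its primitive is then affine. The modulus of [a] is computed at a nearby
    point that is not a vertex, since [p] may be a vertex of cone angle 2 pi. *)
Lemma dev_nonsingular p u : compatible_form dz -> nonsingular p -> 0 < bary p u ->
  exists (U : set S) (phi : S -> C) (a m : C), [/\ isometric_chart U phi, U p, nm a = k &
    \forall x \near p, dev (e u) x = a * phi x + m].
Proof.
move=> [_ comp] np pu; have [U [phi [a [ci Up const]]]] := comp p np.
have [F [E DF]] := dev_primitive De (or_introl ci) Up pu.
have [oe isoU] := ci; have [oU _ cphi _] := oe.
have NN := nbhs_and (open_near oU Up) (nbhs_and DF E).
have [r r0 Hr] := open_embedding_disc oe Up NN.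
have D1 z : nm (z - phi p) < r -> is_derive z 1 F a.
  by move=> /Hr[x [Ux [_ [Dx _]] <-]]; rewrite -(const _ Ux).
have D2 z : nm (z - phi p) < r -> is_derive z 1 (fun z : C => a * z + 0) a.
  by move=> _; exact: is_derive_linear.
pose m := F (phi p) - a * phi p.
have nE : \forall x \near p, dev (e u) x = a * phi x + m.
  have nr : \forall x \near p, nm (phi x - phi p) < r by exact: (cphi p Up _ (near_disc _ r0)).
  apply: filterS (nbhs_and E nr) => x [-> xr].
  by have := primitive_unique D1 D2 xr; rewrite !addr0 -/m => <-; ring.
exists U, phi, a, m; split=> //.
have [q [[Uq qu] qE] nvq] :=
  near_nonvertex (nbhs_and (nbhs_and (open_near oU Up) (near_star pu)) (near_near nE)).
have [v [w [w' [h qs]]]] := nonvertex_hinge nvq qu.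
have [l [m' [nl lE]]] := isometric_unique h k0 (dev_placed De h) qs (isoU q Uq).
have [x [s [[xE xl] s0 xs]]] := dev_moves De nvq qu (nbhs_and qE lE).
have al : a * l = 1.
  have s1 : s%:C%C != 0 :> C by rewrite -nm_gt0 nm_real gtr0_norm.
  apply: (mulIf s1); rewrite mul1r -[RHS]xs xE (nbhs_singleton qE) xl (nbhs_singleton lE) -xs; ring.
apply: (mulIf (x := k^-1)); first by rewrite gt_eqF// invr_gt0.
by rewrite mulfV ?gt_eqF// -nl -nmM al nm1.
Qed.

(** Near [p] the map is an isometric chart, scaled by [a] of modulus [k], followed
    by the projection, which preserves small distances. *)
Lemma dev_map_isometry p : compatible_form dz -> nonsingular p -> local_isometry_at k^-1 f p.
Proof.
move=> comp np; have [u pu] := exists_bary_pos p.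
have [U [phi [a [m [[oe iso] Up na nE]]]]] := dev_nonsingular comp np pu.
have [oU _ _ Uopen] := oe.
have [[[A B] /= [pA pB] HAB] _] := iso p Up.
have [d d0 gap] := lattice_gap indep.
have d4 : 0 < d / 4 by rewrite divr_gt0.
pose N x := [/\ U x, 0 < bary x u, dev (e u) x = a * phi x + m, A x /\ B x &
  nm (dev (e u) x - dev (e u) p) < d / 4].
have nN : nbhs p N.
  apply: filterS (nbhs_and (nbhs_and (open_near oU Up) (nbhs_and (near_star pu) nE))
    (nbhs_and (nbhs_and pA pB) (near_dev e u p d4))) => x [[xU [xu xE]] [[xA xB] xd]].
  by split.
have VN x : N° x -> N x by exact: nbhs_singleton.
have a0 : a != 0 by rewrite -nm_gt0 na.
exists N°; split.
- exact: open_interior.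
- exact: nN.
- have -> : f @` N° = proj @` ((fun z => a * z + (Q u + m)) @` (phi @` N°)).
    rewrite !image_comp; apply/seteqP; split=> _ [x Nx <-]; exists x => //=;
      have [_ xu xE _ _] := VN x Nx;
      rewrite (dev_map_star De HQ xu) xE; congr proj; ring.
  apply/proj_open_map/open_affine => //.
  by apply: Uopen; [exact: open_interior|move=> x /VN[]].
move=> x y /VN[_ xu xE [xA _] xd] /VN[_ yu yE [_ yB] yd].
rewrite (dev_map_star De HQ xu) (dev_map_star De HQ yu).
have xyE : Q u + dev (e u) x - (Q u + dev (e u) y) = a * (phi x - phi y).
  by rewrite xE yE; ring.
rewrite (torus_dist_local _ gap) ?invr_gt0//.
  by rewrite xyE nmM na (HAB (x, y))// mulKf// gt_eqF.
have := nmD (dev (e u) x - dev (e u) p) (- (dev (e u) y - dev (e u) p)); rewrite nmN.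
have -> : dev (e u) x - dev (e u) p - (dev (e u) y - dev (e u) p) =
  Q u + dev (e u) x - (Q u + dev (e u) y) by ring.
lra.
Qed.

End CoveringMap.

(** * The criterion *)

Section Main.
Variables (R : realType) (X : flat_surface R) (dz : one_form X).
Local Notation C := (CC R).

Lemma independent_scale (h v : C) (a b : R) : 0 < a -> 0 < b -> independent h v ->
  independent (a%:C%C * h) (b%:C%C * v).
Proof.
move=> a0 b0 ind s t; rewrite !mulrA -!rmorphM /= => /ind[/eqP + /eqP].
by rewrite !mulf_eq0 (gt_eqF a0) (gt_eqF b0) !orbF => /eqP -> /eqP ->.
Qed.

(** The two groups of periods are contained in cyclic ones, so all integrals along
    closed paths lie in the lattice spanned by [a h] and [b v], and [dev_map] modulo
    this lattice is the covering. *)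
Lemma periods_covering e (k : R) : development dz e k -> compatible_form dz ->
  connected [set: realization X] -> [set: realization X] !=set0 ->
  (exists h v : C, [/\ independent h v, discrete_subgroup (V_periods dz h v) &
    discrete_subgroup (H_periods dz h v)]) ->
  ramified_covering_of_torus X.
Proof.
move=> De comp Hconn Hne [h [v [ind /discrete_cyclic[b b0 Hb] /discrete_cyclic[a a0 Ha]]]].
pose w1 : C := a%:C%C * h; pose w2 : C := b%:C%C * v.
have indw : independent w1 w2 by exact: independent_scale.
have Hper g z : closed_path g -> path_integral dz g z -> lattice w1 w2 z.
  move=> cg ig; have [s [t zE]] := independent_span ind z; rewrite zE in ig *.
  have [|m ->] := Ha s; first by exists g, t.
  have [|n ->] := Hb t; first by exists g, s.
  by exists m, n; rewrite /w1 /w2 !mulrz_complex !rmorphM /=; ring.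
have [Q HQ] := vertex_positions De Hconn Hne Hper.
exists w1, w2, (dev_map e w1 w2 Q), k^-1; split=> //.
- by rewrite invr_gt0; exact: dev_scale De.
- exact: (dev_map_holomorphic De indw HQ).
- exact: (dev_map_covering De Hne indw HQ).
by move=> p np _; exact: (dev_map_isometry De indw HQ comp np).
Qed.

End Main.

Theorem theoremA (R : realType) (X : flat_surface R) (dz : one_form X) :
  PK0_curve X -> compatible_form dz -> nonzero_form dz ->
  ramified_covering_of_torus X <->
  exists h v : CC R, [/\ independent h v,
    discrete_subgroup (V_periods dz h v) &
    discrete_subgroup (H_periods dz h v)].
Proof.
move=> [Hne Hconn _] comp nz.
have [e [k De]] := development_exists Hconn comp nz.
split; first exact: (covering_periods De Hconn Hne).
exact: (periods_covering De comp Hconn Hne).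
Qed.
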